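(* Let $N\ge 1$ be an integer, $p>1$, $\gamma<1$, $0<\sigma\leq 1$, $0\leq \eta\leq 1$, $\mu\in\mathbb{R}$, and let $\chi$ be the weight function on $\mathbb{R}^N$ defined in the context (for an admissible exponent $q$). Let $u_0,u_1$ be functions on $\mathbb{R}^N$ with $u_0\chi,\,u_1\chi\in L^1(\mathbb{R}^N)$. Let $T\in(0,+\infty]$ and assume that $u$ is a nontrivial weak solution (in the sense defined in the context; for $T=+\infty$ this means a global weak solution) of $$\left\{\begin{array}{l}u_{tt}+(-\triangle)^\sigma u+\mu(-\triangle)^\eta u_t={}_0I_t^{1-\gamma}(|u|^{p}),\quad (t,x)\in (0,T)\times\mathbb{R}^N,\\ u(0,x)=u_0(x),\quad u_t(0,x)=u_1(x),\quad x\in \mathbb{R}^N,\end{array}\right.$$ and that $|u|^p\chi \in L_{loc}^1([0,T),L^1(\mathbb{R}^N))$. If $p\gamma\leq 1$, then $T<+\infty$.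
   Context: All functions are real-valued. ''Nontrivial'' means not equal to $0$ almost everywhere. Fractional integral: for $\alpha>0$, ${}_0I_t^{\alpha}v(t)=\frac{1}{\Gamma(\alpha)}\int_0^t (t-s)^{\alpha-1}v(s)\,ds$ (Riemann-Liouville integral in the time variable). Fractional Laplacian: $(-\triangle)^1=-\triangle$, $(-\triangle)^0$ is the identity, and for $s\in(0,1)$ $$(-\triangle)^s\psi(x)=\frac{s2^{2s-1}\Gamma(\frac{N+2s}{2})}{\pi^{N/2}\Gamma(1-s)}\int_{\mathbb{R}^N}\frac{2\psi(x)-\psi(x+y)-\psi(x-y)}{|y|^{N+2s}}\,dy .$$ Weight: $\chi(x)=\Big(\int_{\mathbb{R}^N}(1+|y|^2)^{-q/2}dy\Big)^{-1}(1+|x|^2)^{-q/2}$, where the exponent $q$ satisfies: $q>N$ if $\sigma=1$ and $\eta\in\{0,1\}$; $q\in(N,N+2\sigma]$ if $0<\sigma<1$ and $\eta\in\{0,1\}$; $q\in(N,N+2\min\{\sigma,\eta\}]$ if $0<\sigma\le 1$ and $0<\eta<1$. $|u|^p\chi \in L_{loc}^1([0,T),L^1(\mathbb{R}^N))$ means that $|u|^p\chi\in L^1((0,T'),L^1(\mathbb{R}^N))$ for every finite $T'\in(0,T)$. Weak solution: let $0<T<+\infty$, $(1+|x|)^{-N-2\eta}u_0\in L^1(\mathbb{R}^N)$ and $u_1\in L^1_{loc}(\mathbb{R}^N)$. A function $u$ is a weak solution of the problem on $(0,T)\times\mathbb{R}^N$ if $u\in L^p((0,T),L^p_{loc}(\mathbb{R}^N))$,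 $(1+|x|)^{-N-2\min\{\eta,\sigma\}}u\in L^1((0,T),L^1(\mathbb{R}^N))$ and $$\int_{\mathbb{R}^N}\int_0^T\big[{}_0I_t^{1-\gamma}(|u|^{p})\varphi+(u_0+tu_1)\varphi_{tt}+\mu u_0(-\triangle)^\eta(-\varphi_t)\big]dt\,dx=\int_{\mathbb{R}^N}\int_0^Tu(-\triangle)^\sigma\varphi\,dt\,dx+\int_{\mathbb{R}^N}\int_0^Tu\big[\varphi_{tt}+\mu(-\triangle)^\eta(-\varphi_t)\big]dt\,dx$$ for every test function $\varphi(t,x)=\psi(x)\phi(t)$ with $\psi\in C_0^\infty(\mathbb{R}^N)$, $\phi\in C^2([0,T])$ and $\phi(T)=\phi'(T)=0$. The function $u$ is a global weak solution if $T>0$ can be chosen arbitrarily, i.e. $u$ is defined on $(0,\infty)\times\mathbb{R}^N$ and is a weak solution on $(0,T)\times\mathbb{R}^N$ for every finite $T>0$. *)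

(* Defs.v *)
From HB Require Import structures.
From mathcomp Require Export all_boot all_order all_algebra.
From mathcomp Require Export all_classical all_reals all_analysis.
Export numFieldNormedType.Exports.

Set Implicit Arguments.
Unset Strict Implicit.
Unset Printing Implicit Defensive.

Import Order.TTheory GRing.Theory Num.Theory.

Local Open Scope classical_set_scope.
Local Open Scope ring_scope.

(* R^n is 'rV[R]_n. The library gives it its topology and its derivatives; the
   sigma-algebra below is generated by the coordinates, hence it is the Borel
   one. *)
Section measurable_rV.
Context {R : realType}.
Variable n : nat.

Let coor : 'I_n -> 'rV[R]_n -> R := fun i v => v ord0 i.

Let rV_set0 : g_sigma_preimage coor set0.
Proof. exact: sigma_algebra0. Qed.

Let rV_setC A : g_sigma_preimage coor A -> g_sigma_preimage coor (~` A).
Proof. exact: sigma_algebraC. Qed.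

Let rV_bigcup (F : _^nat) : (forall i, g_sigma_preimage coor (F i)) ->
  g_sigma_preimage coor (\bigcup_i (F i)).
Proof. exact: sigma_algebra_bigcup. Qed.

HB.instance Definition _ := @isMeasurable.Build
  (measure_tuple_display default_measure_display)
  'rV[R]_n (g_sigma_preimage coor) rV_set0 rV_setC rV_bigcup.

End measurable_rV.

Lemma measurable_coor (R : realType) n (i : 'I_n) :
  measurable_fun [set: 'rV[R]_n] (fun v : 'rV[R]_n => v ord0 i).
Proof.
move=> _ Y mY; rewrite setTI; apply: sub_sigma_algebra => /=.
rewrite -bigcup_seq/=; exists i => /=; first by rewrite mem_index_enum.
by exists Y => //; rewrite setTI.
Qed.

Lemma measurable_fun_rVP d (T : measurableType d) (R : realType) n
    (f : T -> 'rV[R]_n) :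
  (forall i, measurable_fun [set: T] (fun x => f x ord0 i)) ->
  measurable_fun [set: T] f.
Proof.
move=> mf.
suff H : (measurable : set (set 'rV[R]_n)) `<=`
    image_set_system [set: T] f measurable.
  by move=> _ A mA; exact: H.
apply: smallest_sub.
  exact: sigma_algebra_image (sigma_algebra_measurable _).
rewrite -bigcup_seq/=; apply: bigcup_sub => i _ _ [B mB <-].
by rewrite /image_set_system/= !setTI; have := mf i measurableT B mB;
  rewrite setTI.
Qed.

Section lebesgue_Rn.
Context {R : realType}.

Definition rV_cons n (p : measurableTypeR R * 'rV[R]_n) : 'rV[R]_n.+1 :=
  \row_i (if unlift ord0 i is Some j then p.2 ord0 j else p.1).

Definition rV_uncons n (v : 'rV[R]_n.+1) : measurableTypeR R * 'rV[R]_n :=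
  (v ord0 ord0, \row_j v ord0 (lift ord0 j)).

Lemma rV_consK n : cancel (@rV_cons n) (@rV_uncons n).
Proof.
case=> x v; rewrite /rV_uncons mxE unlift_none; congr pair.
by apply/rowP => j; rewrite !mxE liftK.
Qed.

Lemma rV_unconsK n : cancel (@rV_uncons n) (@rV_cons n).
Proof.
move=> v; apply/rowP => i; rewrite mxE.
by case: unliftP => [j|] ->; rewrite ?mxE.
Qed.

Lemma measurable_rV_cons n : measurable_fun [set: _] (@rV_cons n).
Proof.
apply: measurable_fun_rVP => i; case: (unliftP ord0 i) => [j|] ->.
  apply: (eq_measurable_fun (fun p : measurableTypeR R * 'rV[R]_n =>
    p.2 ord0 j)) => [p _|]; first by rewrite mxE liftK.
  apply: (@measurableT_comp _ _ _ _ _ _ (fun v : 'rV[R]_n => v ord0 j)) => //.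
  exact: measurable_coor.
apply: (eq_measurable_fun (fun p : measurableTypeR R * 'rV[R]_n =>
  p.1)) => [p _|]; first by rewrite mxE unlift_none.
exact: measurable_fst.
Qed.

Lemma measurable_rV_uncons n : measurable_fun [set: _] (@rV_uncons n).
Proof.
apply/measurable_fun_pairP; split; first exact: measurable_coor.
apply: measurable_fun_rVP => i.
apply: (eq_measurable_fun (fun v : 'rV[R]_n.+1 => v ord0 (lift ord0 i)))
  => [v _|]; first by rewrite /= mxE.
exact: measurable_coor.
Qed.

Section cons_measure.
Context n (m : {sigma_finite_measure set 'rV[R]_n -> \bar R}).

Definition cons_measure : set 'rV[R]_n.+1 -> \bar R :=
  pushforward (lebesgue_measure \x m)%E (@rV_cons n).

Let cons_measure0 : cons_measure set0 = 0%E.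
Proof. by rewrite /cons_measure /pushforward preimage_set0 measure0. Qed.

Let cons_measure_ge0 A : (0 <= cons_measure A)%E.
Proof. by rewrite /cons_measure /pushforward measure_ge0. Qed.

Let cons_measure_sigma_additive : semi_sigma_additive cons_measure.
Proof.
move=> F mF tF mUF; rewrite /cons_measure /pushforward preimage_bigcup.
apply: measure_semi_sigma_additive.
- by move=> k; rewrite -[X in measurable X]setTI; exact: measurable_rV_cons.
- apply/trivIsetP => /= i j _ _ ij; rewrite -preimage_setI.
  by move/trivIsetP : tF => /(_ _ _ _ _ ij) ->//; rewrite preimage_set0.
- rewrite -preimage_bigcup -[X in measurable X]setTI.
  exact: measurable_rV_cons.
Qed.

HB.instance Definition _ := isMeasure.Build _ _ _ cons_measure
  cons_measure0 cons_measure_ge0 cons_measure_sigma_additive.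

Let cons_measure_sigma_finite : sigma_finite setT cons_measure.
Proof.
have /sigma_finiteP[F [TF ndF Foo]] := sigma_finiteT (@lebesgue_measure R).
have /sigma_finiteP[G [TG ndG Goo]] := sigma_finiteT m.
exists (fun k => @rV_uncons n @^-1` (F k `*` G k)).
  rewrite -preimage_bigcup [X in _ @^-1` X](_ : _ = setT) ?preimage_setT//.
  rewrite predeqE => -[x y]; split=> // _.
  have [i _ Fix] : (\bigcup_k F k) x by rewrite -TF.
  have [j _ Gjy] : (\bigcup_k G k) y by rewrite -TG.
  exists (maxn i j) => //; split => /=.
  - by move: x Fix; exact/subsetPset/ndF/leq_maxl.
  - by move: y Gjy; exact/subsetPset/ndG/leq_maxr.
move=> k; have [mFk Fk] := Foo k; have [mGk Gk] := Goo k; split.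
  rewrite -[X in measurable X]setTI; apply: measurable_rV_uncons => //.
  exact: measurableX.
rewrite /cons_measure /pushforward -comp_preimage.
rewrite [X in X @^-1` _](_ : _ = id); last first.
  by apply/funext => z /=; rewrite rV_consK.
rewrite preimage_id product_measure1E// lte_mul_pinfty//.
by rewrite ge0_fin_numE.
Qed.

HB.instance Definition _ := Measure_isSigmaFinite.Build _ _ _ cons_measure
  cons_measure_sigma_finite.

End cons_measure.

Definition dirac_rV0 : set 'rV[R]_0 -> \bar R := dirac (0 : 'rV[R]_0).

HB.instance Definition _ := Measure.on dirac_rV0.

Let dirac_rV0_sigma_finite : sigma_finite setT dirac_rV0.
Proof.
exists (fun=> setT); first by rewrite bigcup_const.
by move=> _; split => //; rewrite /dirac_rV0 diracT ltry.
Qed.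

HB.instance Definition _ := Measure_isSigmaFinite.Build _ _ _ dirac_rV0
  dirac_rV0_sigma_finite.

(* Lebesgue measure on R^n: the n-fold product of the one on R. *)
Fixpoint lebesgue_Rn n : {sigma_finite_measure set 'rV[R]_n -> \bar R} :=
  if n is m.+1 then cons_measure (lebesgue_Rn m) else dirac_rV0.

End lebesgue_Rn.

Section calculus.
Context {R : realType} {N : nat}.
Local Notation mu := lebesgue_measure.
Local Notation Rn := 'rV[R]_N.
Local Notation mu_tx := (@lebesgue_measure R \x lebesgue_Rn N)%E.

(* The library norm on 'rV[R]_N is the sup norm. *)
Definition enorm (x : Rn) : R := Num.sqrt (\sum_(i < N) x ord0 i ^+ 2).

Definition partial (i : 'I_N) (f : Rn -> R) : Rn -> R :=
  fun x => 'D_(delta_mx ord0 i) f x.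

Definition partials (s : seq 'I_N) (f : Rn -> R) : Rn -> R :=
  foldr partial f s.

Definition smooth (f : Rn -> R) : Prop :=
  forall s : seq 'I_N, continuous (partials s f) /\
    forall i x, derivable (partials s f) x (delta_mx ord0 i).

Definition test_function (f : Rn -> R) : Prop :=
  smooth f /\ compact (closure [set x | f x != 0]).

Definition laplacian (f : Rn -> R) : Rn -> R :=
  fun x => \sum_(i < N) partial i (partial i f) x.

Definition Gamma (a : R) : R :=
  \int[mu]_(t in `]0, +oo[) (t `^ (a - 1) * expR (- t)).

Definition frac_laplacian (s : R) (f : Rn -> R) : Rn -> R :=
  fun x =>
    if s == 0 then f x
    else if s == 1 then - laplacian f x
    else s * 2 `^ (2 * s - 1) * Gamma ((N%:R + 2 * s) / 2)
           / (pi `^ (N%:R / 2) * Gamma (1 - s)) *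
         \int[lebesgue_Rn N]_y
           ((2 * f x - f (x + y) - f (x - y)) / enorm y `^ (N%:R + 2 * s)).

Definition frac_integral (alpha : R) (v : R -> R) (t : R) : R :=
  (Gamma alpha)^-1 * \int[mu]_(s in `]0, t[) ((t - s) `^ (alpha - 1) * v s).

Definition L1loc (f : Rn -> R) : Prop :=
  forall K : set Rn, compact K -> (lebesgue_Rn N).-integrable K (EFin \o f).

Definition admissible_exponent (sigma eta q : R) : Prop :=
  [\/ [/\ sigma = 1, eta = 0 \/ eta = 1 & N%:R < q],
      [/\ 0 < sigma < 1, eta = 0 \/ eta = 1 & N%:R < q <= N%:R + 2 * sigma] |
      [/\ 0 < sigma <= 1, 0 < eta < 1 &
          N%:R < q <= N%:R + 2 * Num.min sigma eta]].

Definition chi (q : R) (x : Rn) : R :=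
  (\int[lebesgue_Rn N]_y ((1 + enorm y ^+ 2) `^ (- q / 2)))^-1 *
  (1 + enorm x ^+ 2) `^ (- q / 2).

(* phi is in C^2([0, T]), with first and second derivatives phi' and phi''
   extended by continuity (equivalently, one-sided) at the end points. *)
Definition C2_on (T : R) (phi phi' phi'' : R -> R) : Prop :=
  [/\ {within `[0, T], continuous phi},
      {within `[0, T], continuous phi'},
      {within `[0, T], continuous phi''},
      (forall t, 0 < t < T -> is_derive t (1 : R) phi (phi' t)) &
      (forall t, 0 < t < T -> is_derive t (1 : R) phi' (phi'' t))].

Section weak_solution.
Variables (p gamma sigma eta m : R) (u0 u1 : Rn -> R).

Definition weak_identity (T : R) (u : R -> Rn -> R)
    (psi : Rn -> R) (phi phi' phi'' : R -> R) : Prop :=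
  \int[lebesgue_Rn N]_x \int[mu]_(t in `]0, T[)
    (frac_integral (1 - gamma) (fun s => `|u s x| `^ p) t * (psi x * phi t)
     + (u0 x + t * u1 x) * (psi x * phi'' t)
     + m * u0 x * frac_laplacian eta (fun y => - (psi y * phi' t)) x)
  =
  \int[lebesgue_Rn N]_x \int[mu]_(t in `]0, T[)
    (u t x * frac_laplacian sigma (fun y => psi y * phi t) x)
  + \int[lebesgue_Rn N]_x \int[mu]_(t in `]0, T[)
    (u t x * (psi x * phi'' t
              + m * frac_laplacian eta (fun y => - (psi y * phi' t)) x)).

(* On functions of (t, x), L^r((0, T), L^r(A)) is rendered as L^r of the
   product (0, T) x A. *)
Definition weak_solution (T : R) (u : R -> Rn -> R) : Prop :=
  [/\ (lebesgue_Rn N).-integrable setT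
        (fun x => ((1 + enorm x) `^ (- N%:R - 2 * eta) * u0 x)%:E) /\
      L1loc u1,
      measurable_fun (`]0, T[ `*` setT : set (measurableTypeR R * Rn))
        (fun z => u z.1 z.2) /\
      (forall K : set Rn, compact K ->
        mu_tx.-integrable (`]0, T[ `*` K)
          (fun z => (`|u z.1 z.2| `^ p)%:E)),
      mu_tx.-integrable (`]0, T[ `*` setT)
        (fun z => ((1 + enorm z.2) `^ (- N%:R - 2 * Num.min eta sigma)
                   * u z.1 z.2)%:E) &
      forall (psi : Rn -> R) (phi phi' phi'' : R -> R),
        test_function psi -> C2_on T phi phi' phi'' ->
        phi T = 0 -> phi' T = 0 ->
        weak_identity T u psi phi phi' phi''].

(* A weak solution on (0, T) with T in (0, +oo]; for T = +oo it is a global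
   one. *)
Definition weak_solution_upto (T : \bar R) (u : R -> Rn -> R) : Prop :=
  match T with
  | T'%:E => 0 < T' /\ weak_solution T' u
  | +oo%E => forall T' : R, 0 < T' -> weak_solution T' u
  | -oo%E => False
  end.

End weak_solution.

Definition nontrivial (T : \bar R) (u : R -> Rn -> R) : Prop :=
  ~ {ae mu_tx, forall z, 0 < z.1 -> (z.1%:E < T)%E -> u z.1 z.2 = 0}.

Definition L1loc_in_time (T : \bar R) (f : R -> Rn -> R) : Prop :=
  forall T' : R, 0 < T' -> (T'%:E < T)%E ->
    mu_tx.-integrable (`]0, T'[ `*` setT) (fun z => (f z.1 z.2)%:E).

End calculus.

(* Main.v *)
Require Import Defs.
From HB Require Import structures.
From mathcomp Require Import measurable_realfun.
From mathcomp Require Import ring lra.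

Set Implicit Arguments.
Unset Strict Implicit.
Unset Printing Implicit Defensive.

Import Order.TTheory GRing.Theory Num.Theory.
Local Open Scope classical_set_scope.
Local Open Scope ring_scope.

(* Write al = 1 - gamma, w x = (1 + |x|^2)^(-q/2) and rho t = 1 - t/T, and
   suppose that u is global. Test the equation with psi(x - z) rho(t)^(n+2),
   where psi is one fixed bump. Both fractional Laplacians of psi are O(w): this
   is where the upper bounds on q come from. Exchanging the two time
   integrations moves the fractional integral onto rho^(n+2), which becomes
   comparable to (T - t)^al rho^(n+2). Integrating the resulting inequality
   against w(z) dz, with w * w <= C w and w * psi >= c w, gives for T >= 1
       T^al X(T) <= C (I(T) + M0),
       X(T) = int int |u|^p rho^(al+n+2) w,   I(T) = int int |u| rho^n w,
   where M0 bounds the data. Since p gamma <= 1 means al >= 1 - 1/p, Young's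
   inequality gives T^-al I(T) <= e X(T) + C_e with C_e independent of T and
   small when e is large. With e small, X is bounded, so |u|^p w is integrable on
   (0, oo) x R^N. With e large, and with Young's inequality used only after a
   large time B, letting T -> oo forces |u|^p w to have integral zero. *)

(** * Integrals of radial powers *)

(** Test functions have compact support in [x], whereas [u] is controlled only against [chi], which
    has full support. Averaging translates bridges the two without a limit in the test function,
    provided no constant depends on the centre [z]; volume bounds for cubes of arbitrary centre
    provide this uniformity. In time, powers of [rho] are convenient: two derivatives cost two
    powers, the transposed fractional integral can be bounded below by hand, and [n] stays free. It
    is chosen with [al + n + 2 <= n p], so that [rho ^+ n] raised to the power [p] is at most the
    time weight of X. When p gamma = 1, the conjugate power of T^-al exactly balances the length of
    the time interval. The remainder in Young's inequality is then bounded but does not tend to 0,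
    so a single pass can only give boundedness. Real-valued integrals pass through [fine], which
    turns an infinite integral into 0; much of the work is to establish finiteness before an
    identity between such integrals can be used. *)

Lemma measurable_sublevel d (T : measurableType d) (R : realType) (f : T -> R)
  (a : R) : measurable_fun setT f -> measurable [set x | f x < a].
Proof.
move=> mf; rewrite (_ : [set x | _] = f @^-1` `]-oo, a[).
  by rewrite -[X in measurable X]setTI; apply: mf.
by apply/seteqP; split => x /=; rewrite in_itv/=.
Qed.

Lemma one_powR (R : realType) (x : R) : 1 `^ x = 1.
Proof. by rewrite powR1. Qed.

Section cube.
Context {R : realType}.

Definition cube n (c : 'rV[R]_n) (r : R) : set 'rV[R]_n :=
  [set x | forall i, `|x ord0 i - c ord0 i| < r].

Lemma measurable_cube n (c : 'rV[R]_n) (r : R) : measurable (cube c r).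
Proof.
rewrite (_ : cube c r = \big[setI/setT]_(i < n)
  [set x : 'rV[R]_n | `|x ord0 i - c ord0 i| < r]).
  apply: bigsetI_measurable => i _.
  apply: (@measurable_sublevel _ _ _
    (fun x : 'rV[R]_n => `|x ord0 i - c ord0 i|)).
  apply: measurableT_comp => //; apply: measurable_funB => //.
  exact: measurable_coor.
rewrite -bigcap_seq; apply/seteqP; split => x /=.
  by move=> H i _; exact: H.
by move=> H i; apply: H; rewrite /= mem_index_enum.
Qed.

(** Induction along the construction of [lebesgue_Rn]: the preimage of a cube under [rV_cons] is an
    interval times a cube of one dimension less. Every later volume estimate in space goes through
    this one. As the centre is arbitrary, it also takes the place of translation invariance of the
    measure. *)
Lemma lebesgue_Rn_cube n (c : 'rV[R]_n) (r : R) : 0 < r ->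
  lebesgue_Rn n (cube c r) = ((2 * r) ^+ n)%:E.
Proof.
move=> r0; elim: n c => [|n IH] c /=.
  rewrite /dirac_rV0 (_ : cube c r = setT) ?diracT ?expr0//.
  by rewrite -subTset => x _ [].
rewrite /cons_measure /pushforward.
have -> : @rV_cons R n @^-1` cube c r =
    ball (c ord0 ord0) r `*` cube (\row_j c ord0 (lift ord0 j)) r.
  apply/seteqP; split => -[t v] /=.
    move=> H; split.
      by have := H ord0; rewrite mxE unlift_none distrC.
    by move=> i; have := H (lift ord0 i); rewrite !mxE liftK.
  rewrite /ball/= => -[H1 H2] i; rewrite mxE; case: unliftP => [j|] ->.
    by have := H2 j; rewrite mxE.
  by rewrite distrC.
rewrite product_measure1E//; last 2 first.
- exact: measurable_ball.
- exact: measurable_cube.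
transitivity ((r *+ 2)%:E * ((2 * r) ^+ n)%:E)%E.
  by congr (_ * _)%E; [apply: lebesgue_measure_ball; exact: ltW|exact: IH].
by rewrite -EFinM exprS mulr_natl.
Qed.

End cube.

(* [r] plays the role of a distance whose sublevel sets grow at most like
   [t ^ D]; no other property of the measure is needed. *)
Section dyadic.
Context d (T : measurableType d) (R : realType) (m : {measure set T -> \bar R}).
Variables (r : T -> R) (V D : R).
Hypothesis mr : measurable_fun setT r.
Hypothesis r_ge0 : forall x, 0 <= r x.
Hypothesis V0 : 0 <= V.
Hypothesis volume : forall t, 0 < t -> (m [set x | (r x < t)%R] <= (V * t `^ D)%:E)%E.

(** Pointwise, [f] is at most the sum over [j] of [c j] times the indicator of [r < t j]; termwise
    integration leaves a geometric series. The radii [t j] may shrink to 0 or grow to infinity, so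
    both ends of a radial power are covered. *)
Lemma dyadic_integral_le (f : T -> R) (c t : nat -> R) (A q : R) :
  measurable_fun setT f -> (forall x, 0 <= f x) ->
  (forall j, 0 <= c j) -> (forall j, 0 < t j) ->
  (forall x, f x = 0 \/ exists j, r x < t j /\ f x <= c j) ->
  0 <= A -> 0 < q < 1 -> (forall j, c j * t j `^ D <= A * q ^+ j) ->
  (\int[m]_x (f x)%:E <= (V * (A / (1 - q)))%:E)%E.
Proof.
move=> mf f0 c0 t0 fc A0 /andP[q0 q1] ctA.
pose g j x : \bar R := ((c j)%:E * (\1_[set y | r y < t j] x)%:E)%E.
have mS j : measurable [set y | r y < t j] by exact: measurable_sublevel.
have g0 j x : (0 <= g j x)%E by rewrite /g mule_ge0// lee_fin.
have mg j : measurable_fun setT (g j).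
  by apply: measurable_funeM; apply/measurable_EFinP; exact: measurable_indic.
have fg x : ((f x)%:E <= \sum_(0 <= j <oo) g j x)%E.
  have [->|[j [rj fj]]] := fc x; first exact: nneseries_ge0.
  apply: le_trans (nneseries_lim_ge j.+1 _) => //.
  rewrite big_nat_recr//=; apply: (@le_trans _ _ (g j x)); last first.
    by rewrite leeDr// sume_ge0.
  by rewrite /g indicE mem_set//= mule1 lee_fin.
apply: (@le_trans _ _ (\int[m]_x \sum_(0 <= j <oo) g j x)%E).
  apply: ge0_le_integral => //.
  - by move=> x _; rewrite lee_fin.
  - exact/measurable_EFinP.
  - exact: ge0_emeasurable_sum.
rewrite integral_nneseries//.
apply: (@le_trans _ _ (\sum_(0 <= j <oo) (V * (A * q ^+ j))%:E)%E).
  apply: lee_nneseries => [j _ _|j _]; first exact: integral_ge0.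
  rewrite /g ge0_integralZl//; last 2 first.
  - by apply/measurable_EFinP; exact: measurable_indic.
  - by rewrite lee_fin.
  rewrite integral_indic// setIT.
  apply: (@le_trans _ _ ((c j)%:E * (V * t j `^ D)%:E)%E).
    by rewrite lee_wpmul2l ?lee_fin ?volume.
  by rewrite -EFinM lee_fin mulrCA ler_wpM2l.
apply: lime_le => //.
  by apply: is_cvg_nneseries => j _ _; rewrite lee_fin !mulr_ge0// exprn_ge0// ltW.
near=> n.
rewrite sumEFin lee_fin -mulr_sumr ler_wpM2l//.
apply: geometric_le_lim => //.
by rewrite gtr0_norm.
Unshelve. all: by end_near. Qed.

Lemma dyadic_near0 (x : R) : 0 < x < 1 ->
  exists j : nat, x < 2^-1 ^+ j /\ 2^-1 ^+ j.+1 <= x.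
Proof.
move=> /andP[x0 x1].
have [n nx] : exists n : nat, 2^-1 ^+ n <= x.
  have /cvgrPdist_lt/(_ _ x0) := @cvg_expr R 2^-1 ltac:(rewrite ger0_norm; lra).
  case=> n _ /(_ n (leqnn n)) /=; rewrite sub0r normrN ger0_norm ?exprn_ge0//.
  by exists n; exact: ltW.
have ex : exists n : nat, 2^-1 ^+ n <= x by exists n.
case: (ex_minnP ex) => -[|j] Hj Hmin.
  by move: Hj; rewrite expr0 leNgt x1.
exists j; split => //; rewrite ltNge; apply/negP => /Hmin.
by rewrite ltnn.
Qed.

Lemma near0_integral_le (b : R) : b < D ->
  (\int[m]_(x in [set x | (r x < 1)%R]) (r x `^ (- b))%:E <=
    (V * (1 + 2 `^ b / (1 - 2^-1 `^ (D - b))))%:E)%E.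
Proof.
move=> bD.
have mS : measurable [set x | (r x < 1)%R] by exact: measurable_sublevel.
have mrb : measurable_fun setT (fun x => r x `^ (- b)).
  apply: (@measurableT_comp _ _ _ _ _ _ (@powR R ^~ (- b))) => //.
have h0 : (0 : R) < 2^-1 by rewrite invr_gt0.
have h1 : 0 < 2^-1 `^ (D - b) < 1.
  rewrite powR_gt0//= -[ltRHS](one_powR (D - b)) gt0_ltr_powR ?nnegrE ?subr_gt0 ?invr_ge0//.
  by rewrite invf_lt1// ltr1n.
(* For [b <= 0] the integrand is at most 1 and the volume at radius 1 suffices. The dyadic bound
   below relies on a power that decreases in the radius. *)
have [b0|b0] := leP b 0.
  apply: (@le_trans _ _ V%:E); last first.
    rewrite lee_fin ler_peMr// lerDl divr_ge0 ?powR_ge0// subr_ge0.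
    by case/andP: h1 => _ /ltW.
  apply: (@le_trans _ _ (\int[m]_(x in [set x | (r x < 1)%R]) (cst 1%:E x))%E).
    apply: ge0_le_integral => //.
    - by move=> x _; rewrite lee_fin powR_ge0.
    - by apply: measurable_funTS; exact/measurable_EFinP.
    - move=> x /= rx1; rewrite lee_fin.
      have [->|rx0] := eqVneq (r x) 0.
        have [->|b1] := eqVneq (- b) 0; first by rewrite powRr0.
        by rewrite powR0.
      by rewrite -(one_powR (- b)) ge0_ler_powR ?nnegrE ?oppr_ge0// ltW.
  rewrite integral_cst//= mul1e (le_trans (volume _))//.
  by rewrite powR1 mulr1.
apply: (@le_trans _ _ (V * (2 `^ b / (1 - 2^-1 `^ (D - b))))%:E); last first.
  by rewrite lee_fin ler_wpM2l// lerDr.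
rewrite integral_mkcond.
have H : forall x, ((fun x => (r x `^ (- b))%:E) \_ [set x | (r x < 1)%R]) x =
   ((fun x => r x `^ (- b)) \_ [set x | (r x < 1)%R] x)%:E.
  by move=> x; rewrite !patchE; case: ifP.
under eq_integral do rewrite H.
apply: (@dyadic_integral_le _ (fun j => 2 `^ b * (2^-1 ^+ j) `^ (- b)) (fun j => 2^-1 ^+ j)).
- by apply/(measurable_restrictT _ mS); exact: measurable_funTS.
- by move=> x; rewrite patchE; case: ifP => // _; exact: powR_ge0.
- by move=> j; rewrite mulr_ge0 ?powR_ge0.
- by move=> j; rewrite exprn_gt0.
- move=> x; rewrite patchE; case: ifPn => [|_]; last by left.
  rewrite inE/= => rx1.
  (* A nonzero power of 0 is 0 by convention, so the singular point falls under the alternative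
     [f x = 0]. *)
  have [rx0|rx0] := eqVneq (r x) 0.
    by left; rewrite rx0 powR0// oppr_eq0 gt_eqF.
  right.
  have {}rx0 : 0 < r x by rewrite lt_neqAle eq_sym rx0 r_ge0.
  have [|j [H1 H2]] := @dyadic_near0 (r x); first by rewrite rx0.
  exists j; split=> //.
  rewrite [X in X * _](_ : _ = (2^-1) `^ (- b)).
    rewrite -powRM ?exprn_ge0 ?invr_ge0// -exprS !powRN lef_pV2 ?posrE ?powR_gt0 ?exprn_gt0//.
    by apply: ge0_ler_powR; rewrite ?nnegrE ?exprn_ge0// ltW.
  by rewrite powRN -(powR_inv1 (ler0n R 2)) -powRrM mulN1r powRN invrK.
- exact: powR_ge0.
- by [].
- move=> j; rewrite -mulrA ler_wpM2l ?powR_ge0// -powRD; last first.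
    by apply/implyP => _; rewrite expf_neq0// gt_eqF.
  rewrite -(powR_mulrn j (ltW h0)) -(powR_mulrn j (powR_ge0 _ _)) -!powRrM addrC.
  by rewrite mulrC.
Qed.

Lemma dyadic_tail (x : R) : 0 <= x ->
  exists j : nat, x < 2 ^+ j /\ (Num.max 1 x) >= 2 ^+ j / 2.
Proof.
move=> x0.
have ex : exists n : nat, x < 2 ^+ n.
  exists (Num.bound x); apply: lt_trans (archi_boundP x0) _.
  by rewrite -natrX ltr_nat ltn_expl.
case: (ex_minnP ex) => -[|j] Hj Hmin.
  exists 0%N; split => //; rewrite expr0 le_max mul1r; apply/orP; left.
  by rewrite invf_le1// ler1n.
exists j.+1; split => //; rewrite exprSr mulfK// le_max; apply/orP; right.
by rewrite leNgt; apply/negP => /Hmin; rewrite ltnn.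
Qed.

Lemma tail_integral_le (q : R) : 0 <= D < q ->
  (\int[m]_x ((Num.max 1 (r x)) `^ (- q))%:E <=
    (V * (2 `^ q / (1 - 2 `^ (D - q))))%:E)%E.
Proof.
move=> /andP[D0 Dq].
have q0 : 0 < q by exact: le_lt_trans Dq.
apply: (@dyadic_integral_le _ (fun j => 2 `^ q * (2 ^+ j) `^ (- q)) (fun j => 2 ^+ j)).
- apply: (@measurableT_comp _ _ _ _ _ _ (@powR R ^~ (- q))); first exact: measurable_powR.
  exact: measurable_maxr.
- by move=> x; exact: powR_ge0.
- by move=> j; rewrite mulr_ge0 ?powR_ge0.
- by move=> j; rewrite exprn_gt0.
- move=> x; right; have [j [H1 H2]] := dyadic_tail (r_ge0 x).
  exists j; split=> //.
  rewrite [leRHS](_ : _ = (2 ^+ j / 2) `^ (- q)).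
    rewrite !powRN lef_pV2 ?posrE ?powR_gt0 ?divr_gt0 ?exprn_gt0//.
      by rewrite ge0_ler_powR ?nnegrE ?divr_ge0 ?exprn_ge0 ?(ltW q0)// le_max ler01.
    by rewrite lt_max ltr01.
  rewrite powRM ?exprn_ge0 ?invr_ge0// mulrC; congr (_ * _).
  by rewrite powRN -(powR_inv1 (ler0n R 2)) -powRrM mulN1r powRN invrK.
- exact: powR_ge0.
- rewrite powR_gt0//= -opprB powRN invf_lt1 ?powR_gt0//.
  by rewrite -[ltLHS](one_powR (q - D)) gt0_ltr_powR ?nnegrE ?subr_gt0// ltr1n.
- move=> j; rewrite -mulrA ler_wpM2l ?powR_ge0// -powRD; last first.
    by apply/implyP => _; rewrite expf_neq0.
  rewrite -(powR_mulrn j (ler0n R 2)) -(powR_mulrn j (powR_ge0 _ _)) -!powRrM addrC.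
  by rewrite mulrC.
Qed.

End dyadic.

(** * Bump functions *)

Section bump.
Context {R : realType}.
Implicit Types (P Q : {poly R}) (t x : R).

(** The left side is the [n]-th power of [x * expR (- (x / n))], and this is at most [n] because
    [expR (x / n)] is at least [x / n]. For [n = 0] both sides use that a zeroth power is 1. *)
Lemma exprn_expRN_le n x : 0 <= x -> x ^+ n * expR (- x) <= n%:R ^+ n.
Proof.
move=> x0; case: n => [|n]; first by rewrite !expr0 mul1r -expR0 ler_expR oppr_le0.
have n0 : (0 : R) < n.+1%:R by rewrite ltr0n.
have -> : expR (- x) = expR (- (x / n.+1%:R)) ^+ n.+1.
  by rewrite -expRM_natl mulrN mulrC divfK// gt_eqF.
rewrite -exprMn lerXn2r ?nnegrE ?mulr_ge0 ?expR_ge0// ?ler0n//.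
rewrite expRN ler_pdivrMr ?expR_gt0// mulrC -ler_pdivrMr//.
by apply: le_trans (expR_ge1Dx _); rewrite lerDr.
Qed.

Lemma horner_expRN_bounded P :
  exists2 C : R, 0 <= C & forall x, 0 <= x -> `|P.[x]| * expR (- x) <= C.
Proof.
exists (\sum_(i < size P) `|P`_i| * i%:R ^+ i).
  by apply: sumr_ge0 => i _; rewrite mulr_ge0.
move=> x x0; rewrite horner_coef.
apply: (@le_trans _ _ ((\sum_(i < size P) `|P`_i| * x ^+ i) * expR (- x))).
  rewrite ler_wpM2r ?expR_ge0//; apply: le_trans (ler_norm_sum _ _ _) _.
  by apply: ler_sum => i _; rewrite normrM (ger0_norm (exprn_ge0 _ x0)).
rewrite mulr_suml; apply: ler_sum => i _.
by rewrite -mulrA ler_wpM2l// exprn_expRN_le.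
Qed.

(* The functions [flat P] form a class closed under differentiation, the
   derivative acting on [P] as [flatD]. *)
Definition flat P t : R := if 0 < t then P.[t^-1] * expR (- t^-1) else 0.

Definition flatD P : {poly R} := 'X^2 * (P - P^`()).

Lemma flat_bounded P : exists2 C : R, 0 <= C & forall t, `|flat P t| <= C.
Proof.
have [C C0 H] := horner_expRN_bounded P; exists C => // t.
rewrite /flat; case: ifPn => t0; last by rewrite normr0.
by rewrite normrM (ger0_norm (expR_ge0 _)) H// invr_ge0 ltW.
Qed.

Lemma flatN P t : flat (- P) t = - flat P t.
Proof. by rewrite /flat; case: ifP; rewrite ?oppr0// hornerN mulNr. Qed.

(** Multiplying the polynomial by ['X^2] divides the function by [t ^+ 2], so [flat_bounded]
    applies. Quadratic vanishing at 0 gives the zero derivative where the two branches of [flat]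
    meet. *)
Lemma flat_quad P : exists2 C : R, 0 <= C & forall t, `|flat P t| <= C * t ^+ 2.
Proof.
have [C C0 H] := flat_bounded ('X^2 * P); exists C => // t.
have [t0|t0] := ltP 0 t; last first.
  by rewrite /flat ltNge t0/= normr0 mulr_ge0// sqr_ge0.
rewrite -ler_pdivrMr ?exprn_gt0//; apply: le_trans (H t).
rewrite /flat t0 hornerM hornerXn !normrM -mulrA mulrC.
by rewrite normfV (gtr0_norm t0) -invfM -expr2.
Qed.

Lemma is_derive_horner P t : is_derive t 1 (fun x => P.[x]) P^`().[t].
Proof.
apply: DeriveDef; first exact: derivable_horner.
by rewrite -derive1E -derivE.
Qed.

Lemma is_derive_flat P t : is_derive t 1 (flat P) (flat (flatD P) t).
Proof.
have [t0|t0|t0] := ltgtP 0 t.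
- have nt : \near t, (fun x : R => P.[x^-1] * expR (- x^-1)) t = flat P t.
    by near=> x; rewrite /flat (_ : 0 < x)//; near: x; exact: lt_nbhsr.
  apply: (near_eq_is_derive nt).
  have tn0 : t != 0 by rewrite gt_eqF.
  have dV : is_derive t 1 (fun x : R => x^-1) (- t ^- 2).
    have := @is_deriveV R id t 1 1 tn0 (is_derive_id _ _).
    by rewrite /GRing.scale/= mulr1.
  have dNV : is_derive t 1 (fun x : R => - x^-1) (t ^- 2).
    by have := is_deriveN dV; rewrite opprK.
  have d1 := @is_derive1_comp R (fun x => P.[x]) _ t _ _ (is_derive_horner P t^-1) dV.
  have d2 := @is_derive1_comp R expR _ t _ _ (is_derive_expR _) dNV.
  have := is_deriveM d1 d2.
  rewrite /flat t0 /flatD hornerM hornerXn hornerD hornerN /GRing.scale/= exprVn.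
  move=> H; apply: is_derive_eq H _; ring.
- have nt : \near t, (fun x : R => 0) t = flat P t.
    near=> x; rewrite /flat ltNge (_ : x <= 0)//; apply: ltW; near: x; exact: lt_nbhsl.
  apply: (near_eq_is_derive nt).
  rewrite /flat ltNge (ltW t0)/=; exact: is_derive_cst.
- rewrite -t0 [flat _ 0]/flat ltxx.
  have [C C0 H] := flat_quad P.
  have cv : (h^-1 *: ((flat P \o shift 0) (h *: (1 : R)) - flat P 0)) @[h --> (0:R)^'] --> (0 : R).
    apply/cvgrPdist_le => e e0; near=> h.
    rewrite sub0r normrN [flat P 0]/flat ltxx subr0 /= addr0 /GRing.scale/= mulr1 normrM normfV.
    have h0 : h != 0 by near: h; exact: nbhs_dnbhs_neq.
    rewrite mulrC ler_pdivrMr ?normr_gt0//.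
    apply: le_trans (H h) _; rewrite -[h ^+ 2]ger0_norm ?sqr_ge0// normrX expr2 mulrA ler_wpM2r//.
    have : `|h| <= e / (C + 1).
      near: h; apply: dnbhs0_le; rewrite divr_gt0//; lra.
    rewrite ler_pdivlMr; last lra.
    apply: le_trans; rewrite mulrC ler_wpM2l//; lra.
  apply: DeriveDef; first exact: cvgP cv.
  exact: cvg_lim cv.
Unshelve. all: by end_near. Qed.

(* A list of pairs (P, Q) encodes the sum of the [flat P (1 + t) * flat Q (1 - t)],
   on which the Leibniz rule acts as [bumpD]. *)
Fixpoint bumpF (l : seq ({poly R} * {poly R})) t : R :=
  if l is pq :: l' then flat pq.1 (1 + t) * flat pq.2 (1 - t) + bumpF l' t
  else 0.

Fixpoint bumpD (l : seq ({poly R} * {poly R})) :=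
  if l is pq :: l' then [:: (flatD pq.1, pq.2), (pq.1, - flatD pq.2) & bumpD l']
  else [::].

Lemma is_derive_bumpF l t : is_derive t 1 (bumpF l) (bumpF (bumpD l) t).
Proof.
elim: l => [|[P Q] l IH] /=; first exact: is_derive_cst.
have d1 : is_derive t 1 (fun t => flat P (1 + t)) (flat (flatD P) (1 + t)).
  have d : is_derive t 1 (fun t : R => 1 + t) 1.
    have := is_deriveD (is_derive_cst (1 : R) t (1 : R)) (is_derive_id t (1 : R)).
    by rewrite add0r.
  have := @is_derive1_comp R (flat P) _ t _ _ (is_derive_flat P (1 + t)) d.
  by rewrite mulr1.
have d2 : is_derive t 1 (fun t => flat Q (1 - t)) (- flat (flatD Q) (1 - t)).
  have d : is_derive t 1 (fun t : R => 1 - t) (- 1).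
    have := is_deriveB (is_derive_cst (1 : R) t (1 : R)) (is_derive_id t (1 : R)).
    by rewrite sub0r.
  have := @is_derive1_comp R (flat Q) _ t _ _ (is_derive_flat Q (1 - t)) d.
  by rewrite mulrN1.
have := is_deriveD (is_deriveM d1 d2) IH.
rewrite /GRing.scale/= flatN => H; apply: is_derive_eq H _; ring.
Qed.

Lemma bumpF_bounded l : exists2 C : R, 0 <= C & forall t, `|bumpF l t| <= C.
Proof.
elim: l => [|[P Q] l [C C0 H]] /=; first by exists 0 => // t; rewrite normr0.
have [A A0 HA] := flat_bounded P; have [B B0 HB] := flat_bounded Q.
exists (A * B + C); first by rewrite addr_ge0// mulr_ge0.
move=> t; apply: le_trans (ler_normD _ _) _.
by rewrite lerD// normrM ler_pM.
Qed.

Lemma bumpF_supp l t : 1 <= `|t| -> bumpF l t = 0.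
Proof.
move=> t1; elim: l => [|[P Q] l IH] //=; rewrite IH addr0 /flat.
have [t0|t0] := leP 0 t.
  move: t1; rewrite ger0_norm// => t1.
  by rewrite [X in _ * X](_ : _ = 0) ?mulr0// ltNge subr_le0 t1.
move: t1; rewrite ltr0_norm// => t1.
by rewrite [X in X * _](_ : _ = 0) ?mul0r// ifF// ltNge; apply/negbF; lra.
Qed.

(** For [n = 0] this is the classical bump exp(-2/(1 - t^2)) on (-1, 1), extended by 0, since 1/(1 +
    t) + 1/(1 - t) = 2/(1 - t^2). The index counts derivatives. *)
Definition bump (n : nat) : R -> R := bumpF (iter n bumpD [:: (1, 1)]).

Lemma is_derive_bump n t : is_derive t 1 (bump n) (bump n.+1 t).
Proof. exact: is_derive_bumpF. Qed.

Lemma bump_bounded n : exists2 C : R, 0 <= C & forall t, `|bump n t| <= C.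
Proof. exact: bumpF_bounded. Qed.

Lemma bump_supp n t : 1 <= `|t| -> bump n t = 0.
Proof. exact: bumpF_supp. Qed.

Lemma bump_ge0 t : 0 <= bump 0 t.
Proof.
rewrite /bump/= addr0 /flat mulr_ge0//; case: ifP => // _;
  by rewrite hornerC mul1r expR_ge0.
Qed.

(** On this range 1/(1 + t) and 1/(1 - t) are both below 2, whence the exponent 4. *)
Lemma bump_ge t : `|t| < 2^-1 -> expR (- 4) <= bump 0 t.
Proof.
rewrite ltr_norml => /andP[t1 t2].
rewrite /bump/= addr0 /flat !ifT; [|lra|lra].
rewrite !hornerC !mul1r -expRD ler_expR.
suff H (s : R) : 2^-1 < s -> - 2 <= - s^-1.
  have := H (1 + t); have := H (1 - t); lra.
move=> s2; rewrite lerN2 -[leRHS]invrK lef_pV2 ?posrE; lra.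
Qed.

Lemma continuous_bump n : continuous (bump n).
Proof.
move=> t; apply: differentiable_continuous; apply/derivable1_diffP.
exact: @ex_derive _ _ _ _ _ _ _ (is_derive_bump n t).
Qed.

End bump.

Section tensor_bump.
Context {R : realType} {N : nat}.
Local Notation Rn := 'rV[R]_N.
Implicit Types (x y z : Rn) (k : 'I_N -> nat).

(* [k i] is the order of the partial derivative in the i-th coordinate. *)
Definition tbump z k x : R := \prod_(i < N) bump (k i) (x ord0 i - z ord0 i).

Lemma continuous_tbump z k : continuous (tbump z k).
Proof.
move=> x; rewrite /tbump /continuous_at.
apply: cvg_big => //=.
- by move=> [a b]; apply: cvgM; [exact: cvg_fst|exact: cvg_snd].
- exact: (nbhs_filter x).
- move=> i _.
  have c1 : continuous (fun y : Rn => y ord0 i - z ord0 i).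
    move=> y; have H := @coord_continuous R 1 N ord0 i y.
    by apply: (cvgB H); exact: cvg_cst.
  exact: (cvg_comp _ _ (c1 x) (@continuous_bump _ _ _)).
Qed.

Definition incr k (j : 'I_N) : 'I_N -> nat := fun i => ((i == j) + k i)%N.

(** Along the [j]-th axis only the [j]-th factor moves, so the difference quotient is a constant
    times a one-dimensional one, and no differential in several variables is involved. *)
Lemma is_derive_tbump z k x j :
  is_derive x (delta_mx ord0 j) (tbump z k) (tbump z (incr k j) x).
Proof.
pose c := \prod_(i < N | i != j) bump (k i) (x ord0 i - z ord0 i).
have E (h : R) : tbump z k (h *: delta_mx ord0 j + x) =
    c * bump (k j) (h + (x ord0 j - z ord0 j)).
  rewrite /tbump (bigD1 j)//= !mxE !eqxx mulr1 addrA mulrC; congr (_ * _).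
  apply: eq_bigr => i ij; rewrite !mxE eqxx (negbTE ij) mulr0 add0r//.
have E' : tbump z (incr k j) x = c * bump (k j).+1 (x ord0 j - z ord0 j).
  rewrite /tbump (bigD1 j)//= /incr eqxx mulrC; congr (_ * _).
  by apply: eq_bigr => i ij; rewrite (negbTE ij).
have [d1 d2] := @is_derive_bump R (k j) (x ord0 j - z ord0 j).
have cv : h^-1 *: ((tbump z k \o shift x) (h *: delta_mx ord0 j) - tbump z k x)
    @[h --> 0^'] --> tbump z (incr k j) x.
  rewrite E'.
  rewrite (_ : (fun h : R => _) = fun h => c * (h^-1 *:
    ((bump (k j) \o shift (x ord0 j - z ord0 j)) (h *: 1) - bump (k j) (x ord0 j - z ord0 j)))).
    apply: cvgM; [exact: cvg_cst|rewrite -d2; exact: d1].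
  apply/funext => h /=; have := E h; have := E 0; rewrite scale0r !add0r => -> ->.
  by rewrite /GRing.scale/= mulr1; ring.
apply: DeriveDef; first exact: cvgP cv.
exact: cvg_lim cv.
Qed.

Lemma partial_tbump z k j : partial j (tbump z k) = tbump z (incr k j).
Proof. by apply/funext => x; rewrite /partial (@derive_val _ _ _ _ _ _ _ (is_derive_tbump _ _ _ _)). Qed.

Lemma partials_tbump z k s :
  partials s (tbump z k) = tbump z (fun i => (count_mem i s + k i)%N).
Proof.
elim: s => [//|j s IH] /=; rewrite IH partial_tbump; congr tbump.
by apply/funext => i; rewrite /incr addnA (eq_sym i).
Qed.

Lemma tbump_supp z k x i : 1 <= `|x ord0 i - z ord0 i| -> tbump z k x = 0.
Proof. by move=> H; rewrite /tbump (bigD1 i)//= bump_supp// mul0r. Qed.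

Lemma test_function_tbump z k : test_function (tbump z k).
Proof.
split=> [s|].
  rewrite partials_tbump; split; first exact: continuous_tbump.
  by move=> i x; exact: (@ex_derive _ _ _ _ _ _ _ (is_derive_tbump _ _ _ _)).
have cK : compact [set v : Rn | forall i, `[z ord0 i - 1, z ord0 i + 1]%classic (v ord0 i)].
  apply: (@rV_compact R N (fun i => `[z ord0 i - 1, z ord0 i + 1]%classic)) => i; exact: segment_compact.
apply: (subclosed_compact _ cK); first exact: closed_closure.
have clK := compact_closed (@norm_hausdorff _ _) cK.
rewrite [X in _ `<=` X]((closure_id _).1 clK).
apply: closureS => x /= /eqP nx i /=; rewrite in_itv/=.
have [|H] := ltP `|x ord0 i - z ord0 i| 1; first by rewrite ltr_norml => /andP[? ?]; apply/andP; split; lra.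
by exfalso; apply: nx; exact: tbump_supp H.
Qed.

Lemma tbump_bounded k : exists2 C : R, 0 <= C & forall z x, `|tbump z k x| <= C.
Proof.
have H i : exists C : R, 0 <= C /\ forall t, `|bump (k i) t| <= C.
  by have [C C0 HC] := @bump_bounded R (k i); exists C.
have [C HC] := choice H.
exists (\prod_i C i); first by apply: prodr_ge0 => i _; case: (HC i).
move=> z x; rewrite /tbump normr_prod; apply: ler_prod => i _.
by rewrite normr_ge0/=; case: (HC i).
Qed.

Lemma tbump_ge0 z x : 0 <= tbump z (fun=> 0%N) x.
Proof. by apply: prodr_ge0 => i _; exact: bump_ge0. Qed.

Lemma tbump_ge z x : cube z 2^-1 x -> expR (- 4) ^+ N <= tbump z (fun=> 0%N) x.
Proof.
move=> zx; rewrite -[X in _ ^+ X]card_ord -prodr_const; apply: ler_prod => i _.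
by rewrite expR_ge0/= bump_ge.
Qed.

Lemma measurable_bump n : measurable_fun setT (@bump R n).
Proof. by apply: continuous_measurable_fun; exact: continuous_bump. Qed.

End tensor_bump.

Section enorm.
Context {R : realType} {N : nat}.
Local Notation Rn := 'rV[R]_N.
Implicit Types (x y z : Rn).

Lemma enorm_ge0 x : 0 <= enorm x. Proof. exact: sqrtr_ge0. Qed.

Lemma enorm2E x : enorm x ^+ 2 = \sum_(i < N) x ord0 i ^+ 2.
Proof. by rewrite sqr_sqrtr// sumr_ge0// => i _; exact: sqr_ge0. Qed.

Lemma enormN x : enorm (- x) = enorm x.
Proof. by congr Num.sqrt; apply: eq_bigr => i _; rewrite mxE sqrrN. Qed.

Lemma coord_le_enorm x i : `|x ord0 i| <= enorm x.
Proof.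
rewrite -(@ler_sqr _ `|x ord0 i|) ?nnegrE ?enorm_ge0// enorm2E real_normK ?num_real//.
by rewrite (bigD1 i)//= lerDl sumr_ge0// => j _; exact: sqr_ge0.
Qed.

(** This coordinatewise inequality does the work of the triangle inequality for [enorm]: comparisons
    of weights involve only squares, up to constant factors. *)
Lemma enormD2_le x y : enorm (x + y) ^+ 2 <= 2 * enorm x ^+ 2 + 2 * enorm y ^+ 2.
Proof.
rewrite !enorm2E !mulr_sumr -big_split/=; apply: ler_sum => i _.
by rewrite mxE; have := sqr_ge0 (x ord0 i - y ord0 i); nra.
Qed.

Lemma cube_enorm2_le c x : cube c 1 x -> enorm (x - c) ^+ 2 <= N%:R.
Proof.
move=> H; rewrite enorm2E -[leRHS](@mulr_natl _ 1) mulr1 -[in leRHS](card_ord N) -sumr_const.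
apply: ler_sum => i _; rewrite !mxE -real_normK ?num_real//.
by rewrite exprn_ile1//; exact/ltW/H.
Qed.

Lemma measurable_rVD : measurable_fun setT (fun p : Rn * Rn => p.1 + p.2).
Proof.
apply: measurable_fun_rVP => i.
apply: (eq_measurable_fun (fun p : Rn * Rn => p.1 ord0 i + p.2 ord0 i)).
  by move=> p _; rewrite mxE.
apply: measurable_funD.
  exact: (measurableT_comp (measurable_coor i) measurable_fst).
exact: (measurableT_comp (measurable_coor i) measurable_snd).
Qed.

Lemma measurable_rVN : measurable_fun setT (fun x : Rn => - x).
Proof.
apply: measurable_fun_rVP => i.
apply: (eq_measurable_fun (fun x : Rn => - x ord0 i)).
  by move=> p _; rewrite mxE.
by apply: measurable_funN; exact: measurable_coor.
Qed.

Lemma measurable_rVB : measurable_fun setT (fun p : Rn * Rn => p.1 - p.2).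
Proof.
apply: (@measurableT_comp _ _ _ _ _ _ (fun p : Rn * Rn => p.1 + p.2)
  _ (fun p : Rn * Rn => (p.1, - p.2))).
  exact: measurable_rVD.
apply/measurable_fun_pairP; split; first exact: measurable_fst.
exact: (measurableT_comp measurable_rVN measurable_snd).
Qed.

Lemma measurable_rVBr z : measurable_fun setT (fun x : Rn => x - z).
Proof.
apply: (@measurableT_comp _ _ _ _ _ _ (fun p : Rn * Rn => p.1 - p.2)
  _ (fun x : Rn => (x, z))).
  exact: measurable_rVB.
by apply/measurable_fun_pairP; split; [exact: measurable_id|exact: measurable_cst].
Qed.

Lemma measurable_enorm : measurable_fun setT (@enorm R N).
Proof.
apply: (eq_measurable_fun (fun x : Rn => (\sum_(i < N) x ord0 i ^+ 2) `^ 2^-1)).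
  by move=> x _; rewrite powR12_sqrt// sumr_ge0// => i _; exact: sqr_ge0.
apply: (@measurableT_comp _ _ _ _ _ _ (@powR R ^~ 2^-1)); first exact: measurable_powR.
apply: measurable_sum => i; apply: measurable_funX; exact: measurable_coor.
Qed.

Lemma measurable_tbump z k : measurable_fun setT (tbump z k).
Proof.
apply: measurable_prod => i _.
apply: (@measurableT_comp _ _ _ _ _ _ (@bump R (k i))); first exact: measurable_bump.
by apply: measurable_funB => //; exact: measurable_coor.
Qed.

Lemma enorm_volume z (t : R) : 0 < t ->
  (lebesgue_Rn N [set x | (enorm (x - z) < t)%R] <= (2 ^+ N * t `^ N%:R)%:E)%E.
Proof.
move=> t0; apply: (@le_trans _ _ (lebesgue_Rn N (cube z t))); last first.
  by rewrite lebesgue_Rn_cube// exprMn powR_mulrn// ltW.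
apply: le_measure.
- rewrite inE; apply: measurable_sublevel.
  exact: (measurableT_comp measurable_enorm (measurable_rVBr z)).
- by rewrite inE; exact: measurable_cube.
- move=> x /= xt i; apply: le_lt_trans xt.
  by have := coord_le_enorm (x - z) i; rewrite !mxE.
Qed.

End enorm.

(** * Decay of the fractional Laplacian of a bump *)

Section second_difference.
Context {R : realType} {N : nat}.
Local Notation Rn := 'rV[R]_N.
Implicit Types (x y z : Rn) (f g : Rn -> R).

Lemma derive_bounded_lipschitz (f f' : R -> R) (M : R) :
  (forall t : R, is_derive t (1 : R) f (f' t)) -> (forall t, `|f' t| <= M) ->
  forall a b, `|f b - f a| <= M * `|b - a|.
Proof.
move=> df f'M.
have cf : continuous f.
  move=> t; apply: differentiable_continuous; apply/derivable1_diffP.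
  exact: (@ex_derive _ _ _ _ _ _ _ (df t)).
have H a b : a <= b -> `|f b - f a| <= M * `|b - a|.
  move=> ab; have [|c _ ->] := @MVT_segment R f f' a b ab (fun t _ => df t).
    exact: continuous_subspaceT.
  by rewrite normrM ler_wpM2r.
move=> a b; have [/H//|/ltW/H] := leP a b.
by rewrite distrC (distrC a).
Qed.

(* The Lipschitz bound is there only to make the class stable under products. *)
Definition C11 f := exists2 B : R, 0 <= B & forall x y,
  [/\ `|f x| <= B, `|f (x + y) - f x| <= B * enorm y &
      `|f (x + y) + f (x - y) - 2 * f x| <= B * enorm y ^+ 2].

Lemma C11_cst (c : R) : C11 (fun=> c).
Proof.
exists `|c| => // x y; split => //.
  by rewrite subrr normr0 mulr_ge0// enorm_ge0.
have -> : c + c - 2 * c = 0 by ring.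
by rewrite normr0 mulr_ge0// sqr_ge0.
Qed.

Lemma C11M f g : C11 f -> C11 g -> C11 (fun x => f x * g x).
Proof.
move=> [A A0 HA] [B B0 HB]; exists (4 * (A * B)); first by rewrite !mulr_ge0.
move=> x y; have [f0 f1 f2] := HA x y; have [g0 g1 g2] := HB x y.
have [_ f1' _] := HA x (- y); have [_ g1' _] := HB x (- y).
have [g0' _ _] := HB (x + y) y.
rewrite enormN in f1' g1'.
have e0 := enorm_ge0 y; have AB0 : 0 <= A * B by rewrite mulr_ge0.
split.
- rewrite normrM (le_trans (ler_pM _ _ f0 g0))//; lra.
- rewrite (_ : _ - _ = (f (x + y) - f x) * g (x + y) + f x * (g (x + y) - g x)); last ring.
  apply: le_trans (ler_normD _ _) _; rewrite !normrM.
  have := ler_pM (normr_ge0 _) (normr_ge0 _) f1 g0'.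
  have := ler_pM (normr_ge0 _) (normr_ge0 _) f0 g1.
  have := mulr_ge0 AB0 e0.
  nra.
(* Leibniz rule for second differences. The last two terms multiply two first differences, each of
   order [enorm y], so they are quadratic as well; the four terms give the constant 4. *)
- rewrite (_ : _ - _ = (f (x + y) + f (x - y) - 2 * f x) * g x
   + f x * (g (x + y) + g (x - y) - 2 * g x)
   + (f (x + y) - f x) * (g (x + y) - g x)
   + (f (x - y) - f x) * (g (x - y) - g x)); last ring.
  have T4 (a b c d : R) : `|a + b + c + d| <= `|a| + `|b| + `|c| + `|d|.
    by do 3![apply: le_trans (ler_normD _ _) _; rewrite lerD2r].
  apply: le_trans (T4 _ _ _ _) _.
  have := ler_pM (normr_ge0 _) (normr_ge0 _) f2 g0.
  have := ler_pM (normr_ge0 _) (normr_ge0 _) f0 g2.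
  have := ler_pM (normr_ge0 _) (normr_ge0 _) f1 g1.
  have := ler_pM (normr_ge0 _) (normr_ge0 _) f1' g1'.
  rewrite -!normrM => h1 h2 h3 h4.
  apply: le_trans (lerD (lerD (lerD h4 h3) h2) h1) _.
  rewrite le_eqVlt; apply/orP; left; apply/eqP; ring.
Qed.

Lemma C11_tbump z k : C11 (tbump z k).
Proof.
rewrite /tbump; elim: (index_enum _) => [|i r IH].
  by rewrite [X in C11 X](_ : _ = fun=> 1); [exact: C11_cst|apply/funext => x; rewrite big_nil].
rewrite [X in C11 X](_ : _ = fun x => bump (k i) (x ord0 i - z ord0 i) *
    \prod_(i <- r) bump (k i) (x ord0 i - z ord0 i)); last first.
  by apply/funext => x; rewrite big_cons.
apply: C11M IH.
have [A A0 HA] := @bump_bounded R (k i).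
have [B B0 HB] := @bump_bounded R (k i).+1.
have [C C0 HC] := @bump_bounded R (k i).+2.
have L1 := derive_bounded_lipschitz (is_derive_bump (k i)) HB.
have L2 := derive_bounded_lipschitz (is_derive_bump (k i).+1) HC.
have D2 (t h : R) : 0 <= h ->
    `|bump (k i) (t + h) + bump (k i) (t - h) - 2 * bump (k i) t| <= 2 * C * h ^+ 2.
  move=> h0.
  (* The second difference is [p h - p 0]. The mean value theorem turns it into [h] times a
     difference of first derivatives at distance [2 * c], and the Lipschitz bound [L2] gives the
     second factor [h]. *)
  pose p s : R := bump (k i) (t + s) + bump (k i) (t - s).
  have dp (s : R) : is_derive s (1 : R) p (bump (k i).+1 (t + s) - bump (k i).+1 (t - s)).
    have e1 : is_derive s (1 : R) (fun s : R => t + s) 1.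
      have := is_deriveD (is_derive_cst t s (1 : R)) (is_derive_id s (1 : R)).
      by rewrite add0r.
    have e2 : is_derive s (1 : R) (fun s : R => t - s) (- 1).
      have := is_deriveB (is_derive_cst t s (1 : R)) (is_derive_id s (1 : R)).
      by rewrite sub0r.
    have := is_deriveD (@is_derive1_comp R (bump (k i)) _ s _ _ (is_derive_bump _ _) e1)
       (@is_derive1_comp R (bump (k i)) _ s _ _ (is_derive_bump _ _) e2).
    by rewrite mulr1 mulrN1.
  have cp : continuous p.
    move=> s; apply: differentiable_continuous; apply/derivable1_diffP.
    exact: (@ex_derive _ _ _ _ _ _ _ (dp s)).
  have [|c] := @MVT_segment R p _ 0 h h0 (fun t _ => dp t).
    exact: continuous_subspaceT.
  rewrite in_itv/= => /andP[c0 ch].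
  rewrite {1 2}/p addr0 !subr0 => E.
  rewrite (_ : _ - _ = (bump (k i).+1 (t + c) - bump (k i).+1 (t - c)) * h); last by rewrite -E; ring.
  rewrite normrM (ger0_norm h0) expr2 mulrA ler_wpM2r//.
  apply: le_trans (L2 _ _) _.
  rewrite (_ : t + c - (t - c) = 2 * c); last ring.
  rewrite ger0_norm; last lra.
  rewrite [leLHS]mulrCA -mulrA ler_wpM2l// ler_wpM2l//.
exists (A + B + 2 * C); first lra.
move=> x y; have e0 := enorm_ge0 y; have ye := coord_le_enorm y i; split.
- apply: le_trans (HA _) _; lra.
- rewrite !mxE; apply: le_trans (L1 _ _) _.
  rewrite (_ : _ - _ = y ord0 i); last ring.
  by apply: ler_pM => //; lra.
- rewrite !mxE.
  have {}D2 : `|bump (k i) (x ord0 i + y ord0 i - z ord0 i) +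
      bump (k i) (x ord0 i - y ord0 i - z ord0 i) -
      2 * bump (k i) (x ord0 i - z ord0 i)| <= 2 * C * `|y ord0 i| ^+ 2.
    rewrite ![_ + _ - z ord0 i]addrAC.
    rewrite real_normK ?num_real//.
    have [y0|y0] := leP 0 (y ord0 i); first exact: D2.
    have := D2 (x ord0 i - z ord0 i) (- y ord0 i).
    rewrite oppr_ge0 (ltW y0) opprK sqrrN => /(_ isT).
    by rewrite [X in `|X - _|]addrC.
  apply: le_trans D2 _; apply: ler_pM => //.
  + by rewrite mulr_ge0.
  + lra.
  + by rewrite lerXn2r ?nnegrE.
Qed.

End second_difference.

Lemma Rintegral_le_bound d (T : measurableType d) (R : realType)
    (m : {measure set T -> \bar R}) (g : T -> R) (c : R) :
  measurable_fun setT g -> (\int[m]_x `|g x|%:E <= c%:E)%E ->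
  m.-integrable setT (EFin \o g) /\ `|\int[m]_x g x| <= c.
Proof.
move=> mg gc.
have ig : m.-integrable setT (EFin \o g).
  apply/integrableP; split; first exact/measurable_EFinP.
  by apply: le_lt_trans gc (ltry _).
split => //; rewrite -lee_fin EFin_normr_Rintegral//.
apply: le_trans gc; apply: le_abse_integral => //; exact/measurable_EFinP.
Qed.

Section weight.
Context {R : realType} {N : nat}.
Local Notation Rn := 'rV[R]_N.
Implicit Types (x y z : Rn) (q : R).

Definition weight q x : R := (1 + enorm x ^+ 2) `^ (- q / 2).

Lemma weight_gt0 q x : 0 < weight q x.
Proof. by apply: powR_gt0; rewrite ltr_pwDl// sqr_ge0. Qed.

Lemma weight_ge0 q x : 0 <= weight q x.
Proof. exact/ltW/weight_gt0. Qed.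

Lemma measurable_weight q : measurable_fun setT (weight q).
Proof.
apply: (@measurableT_comp _ _ _ _ _ _ (@powR R ^~ (- q / 2))).
  exact: measurable_powR.
by apply: measurable_funD => //; apply: measurable_funX; exact: measurable_enorm.
Qed.

Lemma weight_le_max q x : 0 <= q -> weight q x <= Num.max 1 (enorm x) `^ (- q).
Proof.
move=> q0; rewrite (_ : - q = 2 * (- q / 2)); last by field.
have m0 : 0 < Num.max 1 (enorm x) by rewrite lt_max ltr01.
rewrite powRrM [X in X `^ _]powR_mulrn ?(ltW m0)// /weight.
rewrite mulNr !powRN lef_pV2 ?posrE ?powR_gt0 ?ltr_pwDl ?sqr_ge0 ?exprn_gt0//.
apply: ge0_ler_powR; rewrite ?nnegrE ?divr_ge0 ?addr_ge0 ?sqr_ge0//.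
by have [?|?] := leP 1 (enorm x); rewrite ?expr1n; have := sqr_ge0 (enorm x); lra.
Qed.

Lemma weight_le_exponent q q' x : q <= q' -> weight q' x <= weight q x.
Proof.
move=> qq'; rewrite /weight ler_powR// ?lerDl ?sqr_ge0//.
by rewrite !mulNr lerN2 ler_pM2r// invr_gt0.
Qed.

Lemma weight_ge q x (M : R) : 0 <= q -> enorm x ^+ 2 <= M ->
  (1 + M) `^ (- q / 2) <= weight q x.
Proof.
move=> q0 xM; have x0 := sqr_ge0 (enorm x).
have p1 : 0 < 1 + enorm x ^+ 2 by lra.
have p2 : 0 < 1 + M by lra.
rewrite /weight mulNr !powRN lef_pV2 ?posrE ?powR_gt0//.
by apply: ge0_ler_powR; rewrite ?nnegrE ?divr_ge0//; lra.
Qed.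

Lemma max_enorm_integral_le q z : N%:R < q ->
  (\int[lebesgue_Rn N]_x (Num.max 1 (enorm (x - z)) `^ (- q))%:E <=
   (2 ^+ N * (2 `^ q / (1 - 2 `^ (N%:R - q))))%:E)%E.
Proof.
move=> Nq; apply: (@tail_integral_le _ _ _ _ (fun x => enorm (x - z))).
- exact: (measurableT_comp measurable_enorm (measurable_rVBr z)).
- by move=> x; exact: enorm_ge0.
- by [].
- by move=> t t0; exact: enorm_volume.
- by rewrite ler0n.
Qed.

Lemma weight_integral_le q z : N%:R < q ->
  (\int[lebesgue_Rn N]_x (weight q (x - z))%:E <=
   (2 ^+ N * (2 `^ q / (1 - 2 `^ (N%:R - q))))%:E)%E.
Proof.
move=> Nq; apply: le_trans (max_enorm_integral_le z Nq).
have q0 : 0 <= q by apply: le_trans (ltW Nq).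
apply: ge0_le_integral => //.
- by move=> x _; rewrite lee_fin weight_ge0.
- by apply/measurable_EFinP; exact: (measurableT_comp (measurable_weight q) (measurable_rVBr z)).
- apply/measurable_EFinP.
  apply: (@measurableT_comp _ _ _ _ _ _ (@powR R ^~ (- q))); first exact: measurable_powR.
  apply: measurable_maxr => //.
  exact: (measurableT_comp measurable_enorm (measurable_rVBr z)).
- by move=> x _; rewrite lee_fin weight_le_max.
Qed.

Lemma near0_enorm_integral_le (b : R) : b < N%:R ->
  exists2 K : R, 0 <= K & (\int[lebesgue_Rn N]_(x in [set x | (enorm x < 1)%R]) (enorm x `^ (- b))%:E <= K%:E)%E.
Proof.
move=> bN.
have HK := @near0_integral_le _ _ _ (lebesgue_Rn N) (@enorm R N) (2 ^+ N) N%:R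
  measurable_enorm enorm_ge0 (exprn_ge0 _ (ler0n R 2)) _ b bN.
eexists; last first.
  apply: HK => t t0; have := @enorm_volume R N 0 t t0.
  by under eq_set do rewrite subr0.
have h1 : 2^-1 `^ (N%:R - b) < 1 :> R.
  rewrite -[ltRHS](one_powR (N%:R - b)) gt0_ltr_powR ?nnegrE ?subr_gt0 ?invr_ge0//.
  by rewrite invf_lt1// ltr1n.
by rewrite mulr_ge0// addr_ge0// divr_ge0 ?powR_ge0// subr_ge0 ltW.
Qed.

End weight.

Section frac_laplacian_decay.
Context {R : realType} {N : nat}.
Local Notation Rn := 'rV[R]_N.
Implicit Types (x y z : Rn) (q s : R).

Definition frac_quotient (a : R) (f : Rn -> R) (p : Rn * Rn) : R :=
  (2 * f p.1 - f (p.1 + p.2) - f (p.1 - p.2)) / enorm p.2 `^ a.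

Lemma measurable_frac_quotient a (f : Rn -> R) : measurable_fun setT f ->
  measurable_fun setT (frac_quotient a f).
Proof.
move=> mf; apply: (eq_measurable_fun (fun p : Rn * Rn =>
  (2 * f p.1 - f (p.1 + p.2) - f (p.1 - p.2)) * enorm p.2 `^ (- a))).
  by move=> p _; rewrite powRN.
apply: measurable_funM.
  apply: measurable_funB; first apply: measurable_funB.
  - by apply: measurable_funM => //; exact: (measurableT_comp mf measurable_fst).
  - exact: (measurableT_comp mf measurable_rVD).
  - exact: (measurableT_comp mf measurable_rVB).
apply: (@measurableT_comp _ _ _ _ _ _ (@powR R ^~ (- a))); first exact: measurable_powR.
exact: (measurableT_comp measurable_enorm measurable_snd).
Qed.

Lemma pair_measurable (x : Rn) : measurable_fun setT (fun y : Rn => (x, y)).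
Proof. by apply/measurable_fun_pairP; split; [exact: measurable_cst|exact: measurable_id]. Qed.

(* Far from the unit cube the quotient is supported where [x + y] or [x - y]
   lies in that cube, so that [y] is comparable to [x]. *)
Lemma frac_quotient_far a q B x (f : Rn -> R) :
  0 < q <= a -> 0 <= B -> (forall y, `|f y| <= B) ->
  measurable_fun setT f ->
  (forall y, f y != 0 -> cube 0 1 y) -> 4 * N%:R + 2 < enorm x ^+ 2 ->
  (\int[lebesgue_Rn N]_y `|frac_quotient a f (x, y)|%:E <=
   (2 * B * 8 `^ (a / 2) * (2 * 2 ^+ N) * weight q x)%:E)%E.
Proof.
move=> /andP[q0 qa] B0 fB mf fs xN.
have a0 : 0 < a by exact: lt_le_trans qa.
have N0 : (0 : R) <= N%:R by [].
have fx0 : f x = 0.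
  apply/eqP; apply: contraT => /fs /cube_enorm2_le; rewrite subr0; lra.
pose A := cube (- x) 1 `|` cube x 1.
have mA : measurable A by apply: measurableU; exact: measurable_cube.
pose L := 8 `^ (a / 2) * weight q x.
have L0 : 0 <= L by rewrite mulr_ge0 ?powR_ge0 ?weight_ge0.
have BL0 : 0 <= 2 * B * L by rewrite mulr_ge0// mulr_ge0.
have far y : 1 + enorm x ^+ 2 <= 8 * enorm y ^+ 2 -> (enorm y `^ a)^-1 <= L.
  move=> xy; have e0 := enorm_ge0 y; have x0 := sqr_ge0 (enorm x).
  have ep : 0 < enorm y.
    rewrite lt_neqAle e0 andbT eq_sym; apply/eqP => y0; move: xy; rewrite y0; lra.
  (* The true decay exponent is [a], which will be [N + 2 * s]; passing to [weight q] is the place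
     where [q <= a] enters. *)
  apply: (@le_trans _ _ (8 `^ (a / 2) * weight a x)); last first.
    by rewrite ler_wpM2l ?powR_ge0// weight_le_exponent.
  have p1 : 0 < 1 + enorm x ^+ 2 by lra.
  rewrite /weight mulNr powRN ler_pdivlMr ?powR_gt0// mulrC ler_pdivrMr ?powR_gt0//.
  rewrite (_ : enorm y `^ a = (enorm y ^+ 2) `^ (a / 2)); last first.
    by rewrite -powR_mulrn// -powRrM; congr powR; field.
  rewrite -powRM ?sqr_ge0//; apply: ge0_ler_powR; rewrite ?nnegrE ?divr_ge0 ?(ltW a0)//.
    by rewrite addr_ge0.
  by rewrite mulr_ge0// sqr_ge0.
(* Here |x|^2 <= 2N + 2|y|^2, and |x|^2 > 4N + 2 lets half of |x|^2 absorb 2N + 1. The factor 8 is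
   generous. *)
have near y v : cube 0 1 v -> v = x + y -> 1 + enorm x ^+ 2 <= 8 * enorm y ^+ 2.
  move=> /cube_enorm2_le; rewrite subr0 => vN vxy.
  have := enormD2_le v (- y); rewrite enormN vxy addrK -vxy; lra.
have pw y : `|frac_quotient a f (x, y)| <= (2 * B * L) * \1_A y.
  rewrite /frac_quotient/= fx0 mulr0 sub0r normrM normfV (ger0_norm (powR_ge0 _ _)).
  have [yA|yA] := pselect (A y).
    rewrite indicE mem_set// mulr1; apply: ler_pM => //.
      by rewrite invr_ge0 powR_ge0.
      apply: le_trans (ler_normB _ _) _; rewrite normrN.
      by have := fB (x + y); have := fB (x - y); lra.
    apply: far; case: yA => Hy.
      apply: (@near y (x + y)) => // i; have := Hy i; rewrite !mxE subr0 opprK.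
      by rewrite addrC.
    have := @near (- y) (x - y); rewrite enormN; apply => // i.
    by have := Hy i; rewrite !mxE subr0 distrC.
  rewrite indicE memNset// mulr0 [X in `|X|](_ : _ = 0) ?normr0 ?mul0r//.
  have -> : f (x + y) = 0.
    apply/eqP; apply: contraT => /fs H; exfalso; apply: yA; left => i.
    by have := H i; rewrite !mxE subr0 opprK addrC.
  have -> : f (x - y) = 0.
    apply/eqP; apply: contraT => /fs H; exfalso; apply: yA; right => i.
    by have := H i; rewrite !mxE subr0 distrC.
  by rewrite subr0 oppr0.
have mq : measurable_fun setT (fun y => frac_quotient a f (x, y)).
  exact: (measurableT_comp (measurable_frac_quotient a mf) (pair_measurable x)).
apply: (@le_trans _ _ (\int[lebesgue_Rn N]_y ((2 * B * L)%:E * (\1_A y)%:E))%E).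
  apply: ge0_le_integral => //.
  - by apply/measurable_EFinP; exact: measurableT_comp.
  - by apply/measurable_EFinP; apply: measurable_funM => //; exact: measurable_indic.
  - by move=> y _; rewrite -EFinM lee_fin.
rewrite ge0_integralZl_EFin//; last first.
  by apply/measurable_EFinP; exact: measurable_indic.
rewrite integral_indic// setIT.
have lA : (lebesgue_Rn N A <= (2 * 2 ^+ N)%:E)%E.
  apply: (le_trans (measureU2 _ _ _)); [exact: measurable_cube..|].
  rewrite /= !lebesgue_Rn_cube// -EFinD lee_fin mulr1; lra.
apply: le_trans (lee_wpmul2l _ lA) _; first by rewrite lee_fin.
rewrite -EFinM lee_fin /L le_eqVlt; apply/orP; left; apply/eqP; ring.
Qed.

(** For |y| < 1 the second difference gains |y|^2 and leaves the power [- (a - 2)], integrable since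
    [a < N + 2]. For |y| >= 1 the numerator is at most [4 * B], and the power [- a] is integrable
    since [N < a]. *)
Lemma frac_quotient_near a (f : Rn -> R) :
  N%:R < a < N%:R + 2 -> measurable_fun setT f -> C11 f ->
  exists2 C : R, 0 <= C & forall x,
  (\int[lebesgue_Rn N]_y `|frac_quotient a f (x, y)|%:E <= C%:E)%E.
Proof.
move=> /andP[Na aN] mf [B B0 HB].
have [K1 K10 HK1] : exists2 K : R, 0 <= K &
    (\int[lebesgue_Rn N]_(x in [set x | (enorm x < 1)%R]) (enorm x `^ (- (a - 2)))%:E <= K%:E)%E.
  by apply: near0_enorm_integral_le; lra.
pose K2 : R := (2 ^+ N * (2 `^ a / (1 - 2 `^ (N%:R - a)))).
have HK2 := @max_enorm_integral_le R N a 0 Na; rewrite -/K2 in HK2.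
have K20 : 0 <= K2.
  rewrite -lee_fin; apply: le_trans HK2; apply: integral_ge0 => x _.
  by rewrite lee_fin powR_ge0.
clearbody K2.
exists (B * K1 + 4 * B * K2); first by apply: addr_ge0; rewrite !mulr_ge0.
move=> x.
pose S : set Rn := [set y | enorm y < 1].
have mS : measurable S.
  by apply: measurable_sublevel; exact: measurable_enorm.
pose g1 y := (enorm y `^ (- (a - 2)))%:E.
pose g2 y := (Num.max 1 (enorm (y - 0)) `^ (- a))%:E.
have mg1 : measurable_fun setT g1.
  apply/measurable_EFinP; apply: (@measurableT_comp _ _ _ _ _ _ (@powR R ^~ _)).
    exact: measurable_powR.
  exact: measurable_enorm.
have mg2 : measurable_fun setT g2.
  apply/measurable_EFinP.
  apply: (@measurableT_comp _ _ _ _ _ _ (@powR R ^~ (- a))); first exact: measurable_powR.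
  apply: measurable_maxr => //.
  exact: (measurableT_comp measurable_enorm (measurable_rVBr 0)).
have mg1S : measurable_fun setT (g1 \_ S).
  by apply/(measurable_restrictT _ mS); exact: measurable_funTS.
have g10 y : (0 <= (g1 \_ S) y)%E.
  by rewrite patchE; case: ifP => // _; rewrite lee_fin powR_ge0.
have g20 y : (0 <= g2 y)%E by rewrite lee_fin powR_ge0.
have mq : measurable_fun setT (fun y => frac_quotient a f (x, y)).
  exact: (measurableT_comp (measurable_frac_quotient a mf) (pair_measurable x)).
apply: (@le_trans _ _ (\int[lebesgue_Rn N]_y (B%:E * (g1 \_ S) y + (4 * B)%:E * g2 y))%E).
  apply: ge0_le_integral => //.
  - by apply/measurable_EFinP; exact: measurableT_comp.
  - by apply: emeasurable_funD; apply: measurable_funeM.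
  move=> y _; rewrite /frac_quotient/=.
  have [f0 _ f2] := HB x y; have [f0' _ _] := HB (x + y) y; have [f0'' _ _] := HB (x - y) y.
  have e0 := enorm_ge0 y.
  rewrite patchE; case: ifPn => [|]; rewrite ?inE/= => ye.
    apply: (@le_trans _ _ (B%:E * g1 y)%E); last first.
      by rewrite leeDl// mule_ge0// lee_fin mulr_ge0.
    rewrite -EFinM lee_fin.
    have [y0|yn0] := eqVneq (enorm y) 0.
      move: f2; rewrite y0 expr0n/= mulr0 => f2.
      rewrite [X in `|X / _|](_ : _ = - (f (x + y) + f (x - y) - 2 * f x)); last ring.
      have /eqP -> : f (x + y) + f (x - y) - 2 * f x == 0 by rewrite -normr_le0.
      by rewrite oppr0 mul0r normr0 mulr_ge0// powR_ge0.
    have ep : 0 < enorm y by rewrite lt_neqAle eq_sym yn0.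
    rewrite opprB powRB; last by rewrite yn0 implybT.
    rewrite normrM normfV (ger0_norm (powR_ge0 _ _)) mulrA ler_wpM2r ?invr_ge0 ?powR_ge0//.
    rewrite powR_mulrn// -normrN.
    by rewrite [X in `|X|](_ : _ = f (x + y) + f (x - y) - 2 * f x)//; ring.
  rewrite mule0 add0e -EFinM lee_fin subr0.
  have {}ye : 1 <= enorm y by rewrite leNgt; move: ye; rewrite notin_setE/= => /negP.
  rewrite max_r// powRN normrM normfV (ger0_norm (powR_ge0 _ _)).
  rewrite ler_wpM2r ?invr_ge0 ?powR_ge0//.
  move: f0 f0' f0''; rewrite !ler_norml => /andP[? ?] /andP[? ?] /andP[? ?].
  by apply/andP; split; lra.
rewrite ge0_integralD//; last 4 first.
- by move=> y _; rewrite mule_ge0.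
- exact: measurable_funeM.
- by move=> y _; rewrite mule_ge0// lee_fin mulr_ge0.
- exact: measurable_funeM.
rewrite !ge0_integralZl//; [|by rewrite lee_fin mulr_ge0].
rewrite EFinD !EFinM -integral_mkcond; apply: leeD.
  by apply: lee_wpmul2l.
by rewrite -EFinM; apply: lee_wpmul2l; rewrite ?lee_fin ?mulr_ge0.
Qed.

(** On the bounded region where [frac_quotient_far] does not apply, the weight is bounded below by
    [D], so the uniform bound of [frac_quotient_near] can be rewritten as a multiple of the
    weight. *)
Lemma frac_quotient_bound q s (f : Rn -> R) :
  0 < s < 1 -> 0 < q <= N%:R + 2 * s -> measurable_fun setT f -> C11 f ->
  (forall y, f y != 0 -> cube 0 1 y) ->
  exists2 C : R, 0 <= C & forall x,
  (\int[lebesgue_Rn N]_y `|frac_quotient (N%:R + 2 * s) f (x, y)|%:E <=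
    (C * weight q x)%:E)%E.
Proof.
move=> /andP[s0 s1] /[dup] q0s /andP[q0 qs] mf cf fs.
have [B B0 HB] := cf.
have [|C1 C10 HC1] := @frac_quotient_near (N%:R + 2 * s) f _ mf cf.
  by apply/andP; split; lra.
pose C2 := 2 * B * 8 `^ ((N%:R + 2 * s) / 2) * (2 * 2 ^+ N).
have C20 : 0 <= C2.
  by apply: mulr_ge0; [apply: mulr_ge0; [exact: mulr_ge0|exact: powR_ge0]|exact: mulr_ge0].
pose D := (1 + (4 * N%:R + 2)) `^ (- q / 2) : R.
have D0 : 0 < D by rewrite powR_gt0// addr_gt0// addr_ge0// mulr_ge0.
exists (C1 / D + C2); first by rewrite addr_ge0// divr_ge0// ltW.
move=> x; have [xN|xN] := leP (enorm x ^+ 2) (4 * N%:R + 2).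
  apply: le_trans (HC1 x) _; rewrite lee_fin mulrDl.
  have := weight_ge (ltW q0) xN; rewrite -/D => H.
  apply: (@le_trans _ _ (C1 / D * D)); first by rewrite divfK// gt_eqF.
  apply: (@le_trans _ _ (C1 / D * weight q x)).
    by rewrite ler_wpM2l// divr_ge0// ltW.
  by rewrite lerDl mulr_ge0// weight_ge0.
have /le_trans := @frac_quotient_far (N%:R + 2 * s) q B x f q0s B0
  (fun y => let: And3 h _ _ := HB y 0 in h) mf fs xN; apply.
by rewrite lee_fin ler_wpM2r ?weight_ge0// -/C2 lerDr divr_ge0// ltW.
Qed.

(** Serves the local operators, the identity and the Laplacian: compact support beats a weight of
    any exponent, which is why [s = 0] and [s = 1] impose no upper bound on [q]. *)
Lemma supported_le_weight q B (f : Rn -> R) : 0 < q -> 0 <= B ->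
  (forall x, `|f x| <= B) -> (forall y, f y != 0 -> cube 0 1 y) ->
  forall x, `|f x| <= B / (1 + N%:R) `^ (- q / 2) * weight q x.
Proof.
move=> q0 B0 fB fs x.
have D0 : 0 < (1 + N%:R) `^ (- q / 2) :> R by rewrite powR_gt0// ltr_pwDl.
have [->|/fs /cube_enorm2_le] := eqVneq (f x) 0.
  by rewrite normr0 mulr_ge0 ?weight_ge0// divr_ge0// ltW.
rewrite subr0 => /(weight_ge (ltW q0)) H.
apply: (@le_trans _ _ (B / (1 + N%:R) `^ (- q / 2) * (1 + N%:R) `^ (- q / 2))).
  by rewrite divfK// gt_eqF.
by rewrite ler_wpM2l// divr_ge0// ltW.
Qed.

Lemma tbumpE z k x : tbump z k x = tbump 0 k (x - z).
Proof. by apply: eq_bigr => i _; rewrite !mxE subr0. Qed.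

Lemma tbump_supp0 k x : tbump 0 k x != 0 -> cube (0 : Rn) 1 x.
Proof.
move=> fx i; rewrite ltNge; apply/negP => H.
by move: fx; rewrite (tbump_supp _ H) eqxx.
Qed.

Lemma laplacian_tbump z k x :
  laplacian (tbump z k) x = \sum_(i < N) tbump z (incr (incr k i) i) x.
Proof. by apply: eq_bigr => i _; rewrite !partial_tbump. Qed.

Lemma partialZ (c : R) i z k :
  partial i (fun x => c * tbump z k x) = (fun x => c * partial i (tbump z k) x).
Proof.
apply/funext => x; rewrite /partial.
have := @deriveZ R Rn R (tbump z k) c x (delta_mx ord0 i).
by apply; exact: (@ex_derive _ _ _ _ _ _ _ (is_derive_tbump _ _ _ _)).
Qed.

Definition frac_laplacian_cst s : R :=
  s * 2 `^ (2 * s - 1) * Gamma ((N%:R + 2 * s) / 2)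
           / (pi `^ (N%:R / 2) * Gamma (1 - s)).

Lemma frac_laplacianE s (f : Rn -> R) x : 0 < s < 1 ->
  frac_laplacian s f x = frac_laplacian_cst s *
    \int[lebesgue_Rn N]_y frac_quotient (N%:R + 2 * s) f (x, y).
Proof.
by move=> /andP[s0 s1]; rewrite /frac_laplacian gt_eqF// lt_eqF.
Qed.

Definition psi0 z : Rn -> R := tbump z (fun=> 0%N).

(** Only the evaluation point moves; the integration variable [y] is untouched. Translating the
    fractional Laplacian therefore takes no change of variables in the integral. *)
Lemma frac_quotient_psi0_translate a z x y :
  frac_quotient a (psi0 z) (x, y) = frac_quotient a (psi0 0) (x - z, y).
Proof. by rewrite /frac_quotient/= /psi0 !(tbumpE z) !(addrAC _ _ (- z)). Qed.

Lemma frac_laplacian_psi0_translate s z x : 0 <= s <= 1 ->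
  frac_laplacian s (psi0 z) x = frac_laplacian s (psi0 0) (x - z).
Proof.
move=> /andP[]; rewrite le_eqVlt => /orP[/eqP <- _|s0].
  by rewrite /frac_laplacian eqxx /psi0 tbumpE.
rewrite le_eqVlt => /orP[/eqP -> |s1].
  rewrite /frac_laplacian oner_eq0 eqxx !laplacian_tbump; congr (- _).
  by apply: eq_bigr => i _; rewrite tbumpE.
have s01 : 0 < s < 1 by rewrite s0.
rewrite (frac_laplacianE _ x s01) (frac_laplacianE _ (x - z) s01).
by under eq_Rintegral do rewrite frac_quotient_psi0_translate.
Qed.

(** By translation it is enough to treat the bump at 0, and [C] is then the same for all [z]; the
    averaging over [z] rests on this. *)
Lemma frac_laplacian_psi0_bound s q : 0 <= s <= 1 -> 0 < q ->
  [\/ s = 0, s = 1 | q <= N%:R + 2 * s] ->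
  exists2 C : R, 0 <= C & forall z x,
    `|frac_laplacian s (psi0 z) x| <= C * weight q (x - z).
Proof.
move=> s01 q0 Hs.
suff [C C0 H] : exists2 C : R, 0 <= C & forall x,
    `|frac_laplacian s (psi0 0) x| <= C * weight q x.
  by exists C => // z x; rewrite frac_laplacian_psi0_translate.
have D0 : 0 < (1 + N%:R) `^ (- q / 2) :> R by rewrite powR_gt0// ltr_pwDl.
have [s0|s0] := eqVneq s 0.
  have [B B0 HB] := @tbump_bounded R N (fun=> 0%N).
  exists (B / (1 + N%:R) `^ (- q / 2)); first by rewrite divr_ge0// ltW.
  rewrite /frac_laplacian s0 eqxx; apply: supported_le_weight => //.
    by move=> x; exact: HB.
  exact: (@tbump_supp0 _).
have [s1|s1] := eqVneq s 1.
  have H i : exists B : R, 0 <= B /\ forall z x, `|@tbump R N z (incr (incr (fun=> 0%N) i) i) x| <= B.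
    by have [B B0 HB] := @tbump_bounded R N (incr (incr (fun=> 0%N) i) i); exists B.
  have [B HB] := choice H.
  have B0 : 0 <= \sum_i B i by apply: sumr_ge0 => i _; case: (HB i).
  exists (\sum_i B i / (1 + N%:R) `^ (- q / 2)).
    by apply: sumr_ge0 => i _; rewrite divr_ge0 ?(ltW D0)//; case: (HB i).
  rewrite -mulr_suml /frac_laplacian s1 oner_eq0 eqxx.
  apply: supported_le_weight => // x.
    rewrite normrN laplacian_tbump; apply: le_trans (ler_norm_sum _ _ _) _.
    by apply: ler_sum => i _; case: (HB i).
  rewrite oppr_eq0 laplacian_tbump => H0; apply: contrapT => nx.
  move/negP : H0; apply; rewrite big1// => i _; apply/eqP; apply: contraT => /tbump_supp0.
  by [].
have {}s01 : 0 < s < 1 by move: s01; rewrite !le_eqVlt eq_sym (negbTE s0) (negbTE s1).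
case: Hs => [/eqP|/eqP|qs]; rewrite ?(negbTE s0) ?(negbTE s1)//.
have [|C C0 HC] := @frac_quotient_bound q s (psi0 0) s01 _ (measurable_tbump _ _) (C11_tbump _ _) (@tbump_supp0 _).
  by rewrite q0.
exists (`|frac_laplacian_cst s| * C); first by rewrite mulr_ge0.
move=> x; rewrite frac_laplacianE// normrM -mulrA ler_wpM2l//.
have [|_ //] := Rintegral_le_bound _ (HC x).
exact: (measurableT_comp (measurable_frac_quotient _ (measurable_tbump _ _)) (pair_measurable x)).
Qed.

(** The integrals of the positive and negative parts are measurable in the parameter by Tonelli, and
    [fine] is measurable, so this holds even where the inner integral diverges. *)
Lemma integral_measurable_param (f : Rn * Rn -> R) : measurable_fun setT f ->
  measurable_fun setT (fun x => \int[lebesgue_Rn N]_y f (x, y)).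
Proof.
move=> mf; apply: (@measurableT_comp _ _ _ _ _ _ (@fine R)) => //.
have -> : (fun x => \int[lebesgue_Rn N]_y (f (x, y))%:E)%E =
  (fubini_F (lebesgue_Rn N) (EFin \o f)^\+ \- fubini_F (lebesgue_Rn N) (EFin \o f)^\-)%E.
  apply/funext => x; rewrite integralE /fubini_F; congr (_ - _)%E;
    by apply: eq_integral => y _; rewrite ?funeposE ?funenegE.
have mf' : measurable_fun setT (EFin \o f) by exact/measurable_EFinP.
by apply: emeasurable_funB; apply: measurable_fun_fubini_tonelli_F => //;
  [exact: measurable_funepos|exact: measurable_funeneg].
Qed.

Lemma measurable_frac_laplacian_psi0 s z : 0 <= s <= 1 ->
  measurable_fun setT (frac_laplacian s (psi0 z)).
Proof.
move=> s01; have [s0|s0] := eqVneq s 0.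
  by rewrite /frac_laplacian s0 eqxx; exact: measurable_tbump.
have [s1|s1] := eqVneq s 1.
  rewrite /frac_laplacian s1 oner_eq0 eqxx; apply: measurable_funN.
  apply: (eq_measurable_fun (fun x => \sum_(i < N) tbump z (incr (incr (fun=> 0%N) i) i) x)).
    by move=> x _; rewrite laplacian_tbump.
  by apply: measurable_sum => i; exact: measurable_tbump.
have {}s01 : 0 < s < 1 by move: s01; rewrite !le_eqVlt eq_sym (negbTE s0) (negbTE s1).
apply: (eq_measurable_fun (fun x => frac_laplacian_cst s *
    \int[lebesgue_Rn N]_y frac_quotient (N%:R + 2 * s) (psi0 z) (x, y))).
  by move=> x _; rewrite frac_laplacianE.
apply: measurable_funM => //; apply: integral_measurable_param.
apply: measurable_frac_quotient; exact: measurable_tbump.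
Qed.

(** In [weak_identity] the time factor sits inside the argument of [frac_laplacian] and has to be
    taken out. Pulling a constant out of the integral requires integrability of the quotient,
    obtained from [frac_quotient_bound] with the exponent [N + 2 * s]. *)
Lemma frac_laplacian_psi0Z s (c : R) z x : 0 <= s <= 1 ->
  frac_laplacian s (fun y => c * psi0 z y) x = c * frac_laplacian s (psi0 z) x.
Proof.
move=> s01; rewrite /frac_laplacian; case: ifPn => // s0; case: ifPn => s1.
  rewrite mulrN; congr (- _); rewrite /laplacian mulr_sumr; apply: eq_bigr => i _.
  by rewrite partialZ partial_tbump partialZ.
have {}s01 : 0 < s < 1 by move: s01; rewrite !le_eqVlt eq_sym (negbTE s0) (negbTE s1).
rewrite [RHS]mulrCA; congr (_ * _).
pose a : R := N%:R + 2 * s.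
have [|C C0 HC] := @frac_quotient_bound a s (psi0 0) s01 _ (measurable_tbump _ _) (C11_tbump _ _) (@tbump_supp0 _).
  by rewrite lexx andbT /a; case/andP: s01 => ? ?; rewrite ltr_wpDl// mulr_gt0.
have [|H _] := Rintegral_le_bound _ (HC (x - z)).
  exact: (measurableT_comp (measurable_frac_quotient _ (measurable_tbump _ _)) (pair_measurable _)).
have {}H : (lebesgue_Rn N).-integrable setT (EFin \o (fun y => frac_quotient a (psi0 z) (x, y))).
  by apply: eq_integrable H => // y _ /=; rewrite (frac_quotient_psi0_translate a z).
rewrite -(RintegralZl _ _ H)//; apply: eq_Rintegral => y _.
by rewrite /frac_quotient/=; ring.
Qed.

End frac_laplacian_decay.

(** * The Gamma function and the transposed kernel of the fractional integral *)

Section one_dim.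
Context {R : realType}.
Local Notation mu := (@lebesgue_measure R).

Lemma dist_volume (c t : R) : 0 < t -> (mu [set x | (`|x - c| < t)%R] <= (2 * t `^ 1)%:E)%E.
Proof.
move=> t0; rewrite (_ : [set x | _] = ball c t); last first.
  by apply/seteqP; split => x; rewrite /ball/= distrC.
by rewrite lebesgue_measure_ball ?(ltW t0)// powRr1 ?(ltW t0)// mulr_natl lexx.
Qed.

Lemma measurable_dist (c : R) : measurable_fun setT (fun x : R => `|x - c|).
Proof. by apply: measurableT_comp => //; exact: measurable_funB. Qed.

Definition near0_cst (b : R) : R := 2 * (1 + 2 `^ b / (1 - 2^-1 `^ (1 - b))).

Lemma dist_near0_integral_le (c b : R) : b < 1 ->
  (\int[mu]_(x in [set x | (`|x - c| < 1)%R]) (`|x - c| `^ (- b))%:E <=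
    (near0_cst b)%:E)%E.
Proof.
move=> b1; apply: (@near0_integral_le _ _ _ mu (fun x => `|x - c|) 2 1) => //.
  exact: measurable_dist.
by move=> t t0; exact: dist_volume.
Qed.

Lemma dist_tail_integral_lty : (\int[mu]_x (Num.max 1 `|x - 0| `^ (- 2))%:E < +oo)%E.
Proof.
apply: le_lt_trans (ltry _).
apply: (@tail_integral_le _ _ _ mu (fun x => `|x - 0|) 2 1) => //.
- exact: measurable_dist.
- by move=> t t0; exact: dist_volume.
- by rewrite ler01/= ltr1n.
Qed.

Lemma measurable_shift_powR (c b : R) : measurable_fun setT (fun x : R => `|x - c| `^ b).
Proof.
apply: (@measurableT_comp _ _ _ _ _ _ (@powR R ^~ b)); first exact: measurable_powR.
exact: measurable_dist.
Qed.

(** A divergent integral would have value 0 under [fine], so convergence must be proved along with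
    positivity: a power near 0, the exponential at infinity, and a lower bound on [1, 2]. *)
Lemma Gamma_gt0 (a : R) : 0 < a -> 0 < Gamma a.
Proof.
move=> a0; rewrite /Gamma /Rintegral.
set f := fun t : R => (t `^ (a - 1) * expR (- t))%:E.
have mf : measurable_fun setT f.
  apply/measurable_EFinP; apply: measurable_funM; first exact: measurable_powR.
  by apply: measurableT_comp => //; exact: measurable_funN.
have f0 x : (0 <= f x)%E by rewrite lee_fin mulr_ge0 ?powR_ge0 ?expR_ge0.
have fin : (\int[mu]_(t in `]0%R, +oo[) f t < +oo)%E.
  (* Chosen so that, for x >= 1, the power x^(a - 1) times x^2 is at most x^n; the integrand is then
     at most n^n x^(-2). *)
  have [n na] : exists n : nat, a + 1 <= n%:R.
    by exists (Num.bound (a + 1)); apply/ltW/archi_boundP; lra.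
  pose S := [set x : R | `|x - 0| < 1].
  have mS : measurable S by apply: measurable_sublevel; exact: measurable_dist.
  pose g1 (x : R) := (`|x - 0| `^ (- (1 - a)))%:E.
  pose g2 (x : R) := (Num.max 1 `|x - 0| `^ (- 2))%:E.
  have mg1 : measurable_fun setT g1.
    by apply/measurable_EFinP; exact: measurable_shift_powR.
  have mg2 : measurable_fun setT g2.
    apply/measurable_EFinP.
    apply: (@measurableT_comp _ _ _ _ _ _ (@powR R ^~ (- 2))); first exact: measurable_powR.
    by apply: measurable_maxr => //; exact: measurable_dist.
  have mg1S : measurable_fun setT (g1 \_ S).
    by apply/(measurable_restrictT _ mS); exact: measurable_funTS.
  have g10 y : (0 <= (g1 \_ S) y)%E.
    by rewrite patchE; case: ifP => // _; rewrite lee_fin powR_ge0.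
  have g20 y : (0 <= g2 y)%E by rewrite lee_fin powR_ge0.
  rewrite integral_mkcond.
  apply: (@le_lt_trans _ _ (\int[mu]_x ((g1 \_ S) x + (n%:R ^+ n)%:E * g2 x))%E).
    apply: ge0_le_integral => //.
    - by move=> x _; rewrite patchE; case: ifP.
    - by apply/(measurable_restrictT _ (measurable_itv _)); exact: measurable_funTS.
    - by apply: emeasurable_funD => //; exact: measurable_funeM.
    move=> x _; rewrite patchE; case: ifPn => [|_]; last first.
      by rewrite adde_ge0// mule_ge0// lee_fin exprn_ge0.
    rewrite inE/= in_itv/= andbT => x0.
    rewrite patchE /g2 subr0 (gtr0_norm x0).
    have [xS|xS] := pselect (S x); rewrite ?(mem_set xS) ?(memNset xS);
      move: xS; rewrite /S/= subr0 (gtr0_norm x0) => x1.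
      apply: (@le_trans _ _ ((x `^ (- (1 - a)))%:E)); last first.
        by rewrite /g1 subr0 (gtr0_norm x0) leeDl// mule_ge0// lee_fin ?exprn_ge0 ?powR_ge0.
      by rewrite opprB lee_fin ler_piMr ?powR_ge0// -expR0 ler_expR oppr_le0 ltW.
    rewrite add0e -EFinM lee_fin.
    have {}x1 : 1 <= x by rewrite leNgt; exact/negP.
    rewrite max_r// powRN ler_pdivlMr ?powR_gt0// mulrAC -powRD; last by apply/implyP => _; rewrite gt_eqF.
    apply: le_trans (exprn_expRN_le n (ltW x0)).
    rewrite ler_wpM2r ?expR_ge0// -powR_mulrn ?(ltW x0)//.
    by apply: ler_powR => //; lra.
  rewrite ge0_integralD//; last 2 first.
    by move=> y _; rewrite mule_ge0// lee_fin exprn_ge0.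
    exact: measurable_funeM.
  rewrite ge0_integralZl//.
  rewrite lte_add_pinfty//.
    rewrite -integral_mkcond; apply: le_lt_trans (ltry _).
    by apply: dist_near0_integral_le; lra.
  by rewrite lte_mul_pinfty// ?lee_fin ?exprn_ge0//; exact: dist_tail_integral_lty.
apply: fine_gt0; rewrite fin andbT.
(* On [1, 2] the power is smallest at 1 or at 2 according to the sign of [a - 1], and the
   exponential is smallest at 2. *)
pose c : R := Num.min 1 (2 `^ (a - 1)) * expR (- 2).
have c0 : 0 < c by rewrite mulr_gt0 ?expR_gt0// lt_min ltr01 powR_gt0.
apply: (@lt_le_trans _ _ (\int[mu]_(t in `[1%R, 2%R]) c%:E)%E).
  rewrite integral_cst//= lebesgue_measure_itv/= lte_fin ltr1n.
  by rewrite -EFinD -EFinM lte_fin mulr_gt0//; lra.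
apply: (@le_trans _ _ (\int[mu]_(t in `[1%R, 2%R]) f t)%E); last first.
  apply: ge0_subset_integral => //; first exact: measurable_funTS.
  by move=> x /=; rewrite !in_itv/= andbT => /andP[x1 _]; lra.
apply: ge0_le_integral => //.
- by move=> x _; rewrite lee_fin ltW.
- exact: measurable_funTS.
move=> x /=; rewrite in_itv/= => /andP[x1 x2]; rewrite lee_fin /c.
have x0 : 0 < x by lra.
apply: ler_pM; rewrite ?expR_ge0 ?ler_expR ?lerN2//.
rewrite ge_min; have [a1|a1] := leP 1 a.
  apply/orP; left; rewrite -[leLHS](one_powR (a - 1)); apply: ge0_ler_powR; rewrite ?nnegrE//; lra.
apply/orP; right; rewrite -[a - 1]opprB !powRN lef_pV2 ?posrE ?powR_gt0//.
by apply: ge0_ler_powR; rewrite ?nnegrE//; lra.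
Qed.

Section kernel.
Variables (al T : R) (k : nat).
Hypothesis al0 : 0 < al.
Hypothesis T0 : 0 < T.

(* The kernel of the fractional integral, up to the factor [1 / Gamma al]. *)
Definition rkernel (t s : R) : R :=
  if [&& 0 < s, s < t & t < T] then (t - s) `^ (al - 1) else 0.

Definition rho (t : R) : R := 1 - t / T.

Lemma measurable_rkernel : measurable_fun setT (fun p : R * R => rkernel p.1 p.2).
Proof.
apply: measurable_fun_ifT.
- apply: measurable_and; first exact: measurable_fun_ltr.
  by apply: measurable_and; exact: measurable_fun_ltr.
- apply: (@measurableT_comp _ _ _ _ _ _ (@powR R ^~ (al - 1))); first exact: measurable_powR.
  exact: measurable_funB.
- exact: measurable_cst.
Qed.

Lemma measurable_rho : measurable_fun setT rho.
Proof. by apply: measurable_funB => //; apply: measurable_funM. Qed.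

(** Up to [Gamma al], the right-sided Riemann-Liouville integral of [rho T ^+ k] on (s, T), that is,
    the transpose of the fractional integral. For 0 < s < T it equals a Beta constant times (T -
    s)^al rho(s)^k; a lower bound of that shape and plain boundedness are all that is proved. *)
Definition rweight (s : R) : \bar R := (\int[mu]_t (rkernel t s * rho t ^+ k)%:E)%E.

Lemma rho_bound t : 0 <= t <= T -> 0 <= rho t <= 1.
Proof.
move=> /andP[t0 tT]; rewrite /rho subr_ge0 ler_pdivrMr// mul1r tT/= lerBlDr lerDl.
by rewrite divr_ge0// ltW.
Qed.

Definition rweight_max : R := near0_cst (1 - al) + (1 + T `^ (al - 1)) * T.

Lemma measurable_rkernel_rho s : measurable_fun setT (fun t => rkernel t s * rho t ^+ k).
Proof.
apply: measurable_funM; last by apply: measurable_funX; exact: measurable_rho.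
apply: (@measurableT_comp _ _ _ _ _ _ (fun p : R * R => rkernel p.1 p.2)
  _ (fun t => (t, s))); first exact: measurable_rkernel.
by apply/measurable_fun_pairP; split; [exact: measurable_id|exact: measurable_cst].
Qed.

Lemma rkernel_rho_ge0 t s : 0 <= rkernel t s * rho t ^+ k.
Proof.
rewrite /rkernel; case: ifPn => [/and3P[s0 st tT]|_]; last by rewrite mul0r.
rewrite mulr_ge0 ?powR_ge0// exprn_ge0//.
have /rho_bound/andP[//] : 0 <= t <= T by rewrite (ltW tT) andbT ltW// (lt_trans s0).
Qed.

(** The singular part |t - s| < 1 is separated from the rest of the interval. The bound may grow
    with [T], since it serves only for integrability. *)
Lemma rweight_le s : (rweight s <= rweight_max%:E)%E.
Proof.
pose S := [set x : R | `|x - s| < 1].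
have mS : measurable S by apply: measurable_sublevel; exact: measurable_dist.
pose g1 (x : R) := (`|x - s| `^ (- (1 - al)))%:E.
pose c := 1 + T `^ (al - 1).
have c0 : 0 <= c by rewrite addr_ge0// powR_ge0.
pose g2 (x : R) := (\1_(`]0, T[%classic : set R) x)%:E : \bar R.
have mg1 : measurable_fun setT g1.
  by apply/measurable_EFinP; exact: measurable_shift_powR.
have mg2 : measurable_fun setT g2.
  by apply/measurable_EFinP; exact: measurable_indic.
have mg1S : measurable_fun setT (g1 \_ S).
  by apply/(measurable_restrictT _ mS); exact: measurable_funTS.
have g10 y : (0 <= (g1 \_ S) y)%E.
  by rewrite patchE; case: ifP => // _; rewrite lee_fin powR_ge0.
have g20 y : (0 <= g2 y)%E by rewrite lee_fin.
apply: (@le_trans _ _ (\int[mu]_x ((g1 \_ S) x + c%:E * g2 x))%E).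
  apply: ge0_le_integral => //.
  - by move=> t _; rewrite lee_fin rkernel_rho_ge0.
  - by apply/measurable_EFinP; exact: measurable_rkernel_rho.
  - by apply: emeasurable_funD => //; exact: measurable_funeM.
  move=> t _; rewrite /rkernel; case: ifPn => [/and3P[s0 st tT]|_]; last first.
    by rewrite mul0r adde_ge0// mule_ge0// lee_fin.
  have t0 : 0 < t by exact: lt_trans st.
  have /rho_bound/andP[r0 r1] : 0 <= t <= T by rewrite !ltW.
  apply: (@le_trans _ _ ((t - s) `^ (al - 1))%:E).
    by rewrite lee_fin ler_piMr ?powR_ge0// exprn_ile1.
  have ts : 0 < t - s by rewrite subr_gt0.
  have -> : g2 t = 1%E by rewrite /g2 indicE mem_set//= in_itv/= t0.
  rewrite mule1 patchE /g1.
  have [tS|tS] := pselect (S t); rewrite ?(mem_set tS) ?(memNset tS);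
    move: tS; rewrite /S/= (gtr0_norm ts) => ts1.
    by rewrite opprB leeDl// lee_fin.
  rewrite add0e lee_fin /c.
  have {}ts1 : 1 <= t - s by rewrite leNgt; exact/negP.
  have [a1|a1] := leP 1 al.
    apply: (@le_trans _ _ (T `^ (al - 1))); last by rewrite lerDr.
    by apply: ge0_ler_powR; rewrite ?nnegrE; lra.
  apply: (@le_trans _ _ 1); last by rewrite lerDl powR_ge0.
  by rewrite -[leRHS](powRr0 (t - s)); apply: ler_powR => //; lra.
rewrite ge0_integralD//; last 2 first.
  by move=> y _; rewrite mule_ge0// lee_fin.
  exact: measurable_funeM.
rewrite ge0_integralZl// -integral_mkcond /g2 integral_indic// setIT.
rewrite /= lebesgue_measure_itv/= lte_fin T0 sube0 -EFinM /rweight_max EFinD leeD//.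
by apply: dist_near0_integral_le; rewrite ltrBlDr ltrDl.
Qed.

(** In the window of [rweight_ge] the ratio v of [t - s] to [T - s] lies between 1/4 and 1, so v^(al
    - 1) is at least (1/4)^|al - 1| for either sign of [al - 1]. The second factor comes from
    [rho t >= rho s / 2], the third from the length of the window. Nothing depends on [T]. *)
Definition rweight_min : R := 4^-1 `^ `|al - 1| * 2^-1 ^+ k * 4^-1.

Lemma rweight_min_gt0 : 0 < rweight_min.
Proof. by rewrite !mulr_gt0 ?exprn_gt0 ?powR_gt0 ?invr_gt0. Qed.

(* Keep only the [t] with [t - s] between a quarter and a half of [T - s]. *)
Lemma rweight_ge s : 0 < s < T ->
  ((rweight_min * (T - s) `^ al * rho s ^+ k)%:E <= rweight s)%E.
Proof.
move=> /andP[s0 sT].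
pose h := T - s.
have h0 : 0 < h by rewrite subr_gt0.
pose I := `]s + h / 4, s + h / 2[%classic : set R.
have mI : measurable I by exact: measurable_itv.
pose c := 4^-1 `^ `|al - 1| * h `^ (al - 1) * (rho s / 2) ^+ k.
have r0 : 0 <= rho s by have /rho_bound/andP[] : 0 <= s <= T by rewrite !ltW.
have c0 : 0 <= c.
  by rewrite !mulr_ge0 ?powR_ge0// exprn_ge0// divr_ge0.
apply: (@le_trans _ _ (\int[mu]_(t in I) (cst c%:E t))%E).
  rewrite integral_cst//= lebesgue_measure_itv/= lte_fin.
  rewrite ifT; last lra.
  rewrite -EFinB -EFinM lee_fin /c /rweight_min.
  rewrite (_ : s + h / 2 - (s + h / 4) = h / 4); last by field.
  have -> : (T - s) `^ al = h * h `^ (al - 1) by rewrite mulr_powRB1// ltW.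
  by rewrite exprMn le_eqVlt; apply/orP; left; apply/eqP; field.
apply: (@le_trans _ _ (\int[mu]_(t in I) (rkernel t s * rho t ^+ k)%:E)%E); last first.
  apply: ge0_subset_integral => //; first by apply/measurable_EFinP; exact: measurable_rkernel_rho.
  by move=> x _; rewrite lee_fin rkernel_rho_ge0.
apply: ge0_le_integral => //.
- by apply: measurable_funTS; apply/measurable_EFinP; exact: measurable_rkernel_rho.
suff H (t : R) : I t -> c <= rkernel t s * rho t ^+ k by move=> t It; rewrite lee_fin H.
rewrite /I/= in_itv/= => /andP[t1 t2]; rewrite /rkernel ifT; last first.
  by rewrite s0/=; apply/andP; split; rewrite /h in t1 t2 h0 *; lra.
apply: ler_pM.
- by rewrite mulr_ge0 ?powR_ge0.
- by rewrite exprn_ge0// divr_ge0.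
- pose v := (t - s) / h.
  have hn0 : h != 0 by rewrite gt_eqF.
  have v1 : 4^-1 <= v by rewrite /v ler_pdivlMr//; lra.
  have v2 : v <= 1 by rewrite /v ler_pdivrMr//; lra.
  have v0 : 0 < v by apply: lt_le_trans v1; rewrite invr_gt0.
  rewrite (_ : t - s = v * h); last by rewrite /v divfK.
  rewrite powRM ?(ltW h0) ?(ltW v0)// ler_wpM2r ?powR_ge0//.
  apply: (@le_trans _ _ (v `^ `|al - 1|)).
    by apply: ge0_ler_powR; rewrite ?nnegrE ?invr_ge0 ?(ltW v0).
  by apply: ger_powR; rewrite ?v0// ler_norm.
- apply: lerXn2r; rewrite ?nnegrE ?divr_ge0//.
    have /rho_bound/andP[//] : 0 <= t <= T by apply/andP; split; rewrite /h in t1 t2 h0 *; lra.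
  have Tn0 : T != 0 by rewrite gt_eqF.
  have -> : rho s / 2 = (h / 2) / T by rewrite /rho /h; field.
  have -> : rho t = (T - t) / T by rewrite /rho; field.
  by rewrite ler_pM2r ?invr_gt0//; rewrite /h in t1 t2 h0 *; lra.
Qed.

End kernel.

End one_dim.

Section fine_integral.
Context d (X : measurableType d) (R : realType) (m : {measure set X -> \bar R}).

(** An integrable function is finite almost everywhere, so [fine] alters it only on a null set. This
    links iterated real-valued integrals to the extended ones that Fubini handles. *)
Lemma integral_fine (f : X -> \bar R) : m.-integrable setT f ->
  m.-integrable setT (EFin \o fine \o f) /\
  (\int[m]_x (fine (f x))%:E = \int[m]_x f x)%E.
Proof.
move=> intf; have mf : measurable_fun setT f by exact: measurable_int intf.
have mff : measurable_fun setT (EFin \o fine \o f).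
  by apply/measurable_EFinP; exact: measurableT_comp.
split.
  apply: le_integrable intf => // x _ /=.
  by case: (f x) => [r| |] /=; rewrite ?lexx// normr0 leey.
apply: ae_eq_integral => //.
have := integrable_ae measurableT intf.
by apply: filterS => x /(_ I) fx _ /=; rewrite fineK.
Qed.

End fine_integral.

Lemma integrable_fubini_G d1 d2 (T1 : measurableType d1) (T2 : measurableType d2)
    (R : realType) (m1 : {sigma_finite_measure set T1 -> \bar R})
    (m2 : {sigma_finite_measure set T2 -> \bar R}) (f : T1 * T2 -> \bar R) :
  (m1 \x m2)%E.-integrable setT f -> m2.-integrable setT (fubini_G m1 f).
Proof.
move=> intf; have mf : measurable_fun setT f by exact: measurable_int intf.
have maf : measurable_fun setT (abse \o f) by exact: measurableT_comp.
apply/integrableP; split; first exact: measurable_fubini_G intf.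
have /integrableP[_] := intf.
rewrite (fubini_tonelli2 (abse \o f))//; last by move=> z /=.
apply: le_lt_trans; apply: ge0_le_integral => //.
- by apply: measurableT_comp => //; exact: measurable_fubini_G intf.
- by apply: (measurable_fun_fubini_tonelli_G (m1 := m1) (abse \o f)) => // z /=.
- move=> y _; apply: le_abse_integral => //.
  apply: (measurableT_comp mf); apply/measurable_fun_pairP; split.
    exact: measurable_id.
  exact: measurable_cst.
Qed.

(** * Exchanging the time integrals *)

Section slab.
Context d (X : measurableType d) (R : realType) (m : {sigma_finite_measure set X -> \bar R}).
Local Notation mu := (@lebesgue_measure R).
Local Notation mR := (measurableTypeR R).
Variable T : R.
Hypothesis T0 : 0 < T.

Definition slab : set (mR * X) := `]0, T[ `*` setT.

Lemma measurable_slab : measurable slab.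
Proof. by apply: measurableX => //; exact: measurable_itv. Qed.

Lemma mem_slab z : (z \in slab) = (0 < z.1) && (z.1 < T).
Proof. by apply/idP/idP; rewrite inE /slab/= in_itv/=; [case|]. Qed.

(** Joint integrability makes the inner time integral finite for almost every [x], so the inner
    [fine] is harmless. It brings the three iterated integrals of [weak_identity] onto the slab. *)
Lemma iterated_Rintegral (F : R -> X -> R) :
  (mu \x m)%E.-integrable slab (fun z => (F z.1 z.2)%:E) ->
  \int[m]_x \int[mu]_(t in `]0, T[) F t x = \int[(mu \x m)%E]_(z in slab) F z.1 z.2.
Proof.
move=> intF.
have {}intF : (mu \x m)%E.-integrable setT ((fun z => (F z.1 z.2)%:E) \_ slab).
  by apply/(integrable_mkcond _ measurable_slab).
rewrite /Rintegral [in RHS]integral_mkcond -integral21_prod_meas1//.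
have [_ eG] := integral_fine (integrable_fubini_G intF).
rewrite -eG; apply: (congr1 fine); apply: eq_integral => x _.
apply: (congr1 (EFin \o fine)); rewrite [LHS]integral_mkcond /fubini_G; apply: eq_integral => t _.
rewrite !patchE; congr (if _ then _ else _).
by rewrite mem_slab/= mem_setE in_itv.
Qed.

Variables (al : R) (k : nat).
Hypothesis al0 : 0 < al.
Variables (v : R -> X -> R) (g : X -> R).
Hypothesis mv : measurable_fun slab (fun z => v z.1 z.2).
Hypothesis v0 : forall t x, 0 <= v t x.
Hypothesis mg : measurable_fun setT g.
Hypothesis g0 : forall x, 0 <= g x.

Let v' (z : mR * X) : R := if (0 < z.1) && (z.1 < T) then v z.1 z.2 else 0.

Let mv' : measurable_fun setT v'.
Proof.
rewrite (_ : v' = ((fun z => v z.1 z.2) \_ slab)).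
  by apply/(measurable_restrictT _ measurable_slab).
apply/funext => z; rewrite patchE /v' mem_slab.
by case: ifP.
Qed.

Let v'0 z : 0 <= v' z.
Proof. by rewrite /v'; case: ifP. Qed.

(** The integrand at ((t, x), s). The cutoffs in [rkernel] and [v'] make it nonnegative and
    measurable everywhere, so that Tonelli applies without tracking the domain s < t. *)
Let F (p : (mR * X) * mR) : R :=
  (rkernel al T p.1.1 p.2 * rho T p.1.1 ^+ k) * (v' (p.2, p.1.2) * g p.1.2).

Let mF : measurable_fun setT F.
Proof.
apply: measurable_funM; first apply: measurable_funM.
- apply: (@measurableT_comp _ _ _ _ _ _ (fun p : R * R => rkernel al T p.1 p.2)
    _ (fun p : (mR * X) * mR => (p.1.1, p.2))); first exact: measurable_rkernel.
  apply/measurable_fun_pairP; split; last exact: measurable_snd.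
  exact: (measurableT_comp measurable_fst measurable_fst).
- apply: measurable_funX; apply: (measurableT_comp (measurable_rho T)).
  exact: (measurableT_comp measurable_fst measurable_fst).
- apply: measurable_funM.
    apply: (measurableT_comp mv'); apply/measurable_fun_pairP; split; first exact: measurable_snd.
    exact: (measurableT_comp measurable_snd measurable_fst).
  apply: (measurableT_comp mg).
  exact: (measurableT_comp measurable_snd measurable_fst).
Qed.

Let F0 p : 0 <= F p.
Proof. by rewrite /F mulr_ge0 ?rkernel_rho_ge0// mulr_ge0. Qed.

Let H (z : mR * X) : \bar R := (\int[mu]_s (F (z, s))%:E)%E.

Let mH : measurable_fun setT H.
Proof.
apply: (measurable_fun_fubini_tonelli_F (m2 := mu) (EFin \o F)).
  exact/measurable_EFinP.
by move=> p; rewrite /= lee_fin.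
Qed.

Let H0 z : (0 <= H z)%E.
Proof. by apply: integral_ge0 => s _; rewrite lee_fin. Qed.

Let measurable_rweight : measurable_fun setT (rweight al T k).
Proof.
apply: (measurable_fun_fubini_tonelli_G (m1 := mu)
  (fun p : mR * mR => (rkernel al T p.1 p.2 * rho T p.1 ^+ k)%:E)).
  apply/measurable_EFinP; apply: measurable_funM; first exact: measurable_rkernel.
  by apply: measurable_funX; exact: (measurableT_comp (measurable_rho T) measurable_fst).
by move=> p; rewrite lee_fin rkernel_rho_ge0.
Qed.

Let rweight_ge0 s : (0 <= rweight al T k s)%E.
Proof. by apply: integral_ge0 => t _; rewrite lee_fin rkernel_rho_ge0. Qed.

(** For fixed [x] the variables [t] and [s] are exchanged; the [t]-integral of the kernel against
    the profile is then [rweight], which acts on [v] as a multiplier. *)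
Lemma frac_tonelli : (\int[mu \x m]_z H z =
  \int[mu \x m]_z ((v' z * g z.2)%:E * rweight al T k z.1))%E.
Proof.
rewrite (fubini_tonelli2 H)// (fubini_tonelli2 (fun z => (v' z * g z.2)%:E * rweight al T k z.1)%E).
- apply: eq_integral => x _; rewrite /fubini_G /H.
  pose Fx (p : mR * mR) := (F ((p.1, x), p.2))%:E.
  rewrite (@fubini_tonelli _ _ _ _ _ mu mu Fx); last 2 first.
  + apply/measurable_EFinP; apply: (measurableT_comp mF).
    apply/measurable_fun_pairP; split; last exact: measurable_snd.
    by apply/measurable_fun_pairP; split; [exact: measurable_fst|exact: measurable_cst].
  + by move=> p; rewrite lee_fin.
  apply: eq_integral => s _; rewrite /fubini_G /Fx /F/= /rweight muleC.
  rewrite -ge0_integralZr//.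
  + by apply/measurable_EFinP; exact: measurable_rkernel_rho.
  + by move=> t _; rewrite lee_fin rkernel_rho_ge0.
  + by rewrite lee_fin mulr_ge0.
- apply: emeasurable_funM.
    apply/measurable_EFinP; apply: measurable_funM; first exact: mv'.
    exact: (measurableT_comp mg measurable_snd).
  exact: (measurableT_comp measurable_rweight measurable_fst).
- by move=> z; rewrite mule_ge0// lee_fin mulr_ge0.
Qed.

Let A (z : mR * X) : R :=
  frac_integral al (fun s => v s z.2) z.1 * (g z.2 * rho T z.1 ^+ k).

(** This holds at every point, even where the fractional integral diverges: there [frac_integral] is
    0 through [fine], and [H z] is either infinite or, when the spatial factor vanishes, 0, so its
    [fine] is 0 too. *)
Let AE z : (A \_ slab) z = (Gamma al)^-1 * fine (H z).
Proof.
rewrite patchE mem_slab.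
case: ifPn => [/andP[t0 tT]|nt]; last first.
  rewrite /H; under eq_integral => s _.
    rewrite /F/= /rkernel ifF; last first.
      apply/negP => /and3P[s0 st tT]; move/negP: nt; apply.
      by rewrite (lt_trans s0 st) tT.
    rewrite !mul0r; over.
  by rewrite integral0/= mulr0.
rewrite /A /frac_integral -mulrA; congr (_ * _).
pose J := (\int[mu]_(s in `]0%R, z.1[) ((z.1 - s) `^ (al - 1) * v s z.2)%:E)%E.
have c0 : 0 <= g z.2 * rho T z.1 ^+ k.
  rewrite mulr_ge0// exprn_ge0//.
  by have /(rho_bound T0)/andP[] : 0 <= z.1 <= T by rewrite !ltW.
have mJ : measurable_fun setT
  (((fun s => ((z.1 - s) `^ (al - 1) * v s z.2)%:E) \_ `]0%R, z.1[) : mR -> \bar R).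
  rewrite (_ : (_ \_ _) = (fun s => (rkernel al T z.1 s * v' (s, z.2))%:E)).
    apply/measurable_EFinP; apply: measurable_funM.
      apply: (@measurableT_comp _ _ _ _ _ _ (fun p : R * R => rkernel al T p.1 p.2)
        _ (fun s => (z.1, s))); first exact: measurable_rkernel.
      by apply/measurable_fun_pairP; split; [exact: measurable_cst|exact: measurable_id].
    apply: (measurableT_comp mv').
    by apply/measurable_fun_pairP; split; [exact: measurable_id|exact: measurable_cst].
  apply/funext => s; rewrite patchE mem_setE in_itv/= /rkernel tT andbT.
  case: ifPn => [/andP[s0 st]|_]; last by rewrite mul0r.
  by rewrite /v'/= s0 (lt_trans st tT).
have -> : H z = ((g z.2 * rho T z.1 ^+ k)%:E * J)%E.
  rewrite /J integral_mkcond -ge0_integralZl//; last first.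
    by move=> s _; rewrite patchE; case: ifP => // _; rewrite lee_fin mulr_ge0// powR_ge0.
  apply: eq_integral => s _; rewrite patchE mem_setE in_itv/= /F/= /rkernel tT andbT.
  case: ifPn => [/andP[s0 st]|_]; last by rewrite !mul0r mule0.
  rewrite /v'/= s0 (lt_trans st tT) -EFinM.
  have E (a b c e : R) : a * b * (c * e) = e * b * (a * c) by ring.
  by congr EFin; exact: E.
rewrite mulrC /Rintegral -/J; case: J => [r| |]/=.
- by [].
- by rewrite mulr0; move: c0; rewrite le_eqVlt => /predU1P[<-|c0]; rewrite ?mul0e// gt0_muley.
- by rewrite mulr0; move: c0; rewrite le_eqVlt => /predU1P[<-|c0]; rewrite ?mul0e// gt0_muleNy.
Qed.

(** After the exchange in [frac_tonelli], [rweight_le] gives integrability and [rweight_ge] the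
    lower bound. *)
Lemma frac_energy :
  (\int[mu \x m]_(z in slab) (v z.1 z.2 * g z.2)%:E < +oo)%E ->
  (mu \x m)%E.-integrable slab (EFin \o A) /\
  (((Gamma al)^-1 * rweight_min al k)%:E *
    \int[mu \x m]_(z in slab) (v z.1 z.2 * g z.2 * ((T - z.1) `^ al * rho T z.1 ^+ k))%:E
  <= \int[mu \x m]_(z in slab) (A z)%:E)%E.
Proof.
move=> fin.
have G0 : 0 < (Gamma al)^-1 by rewrite invr_gt0 Gamma_gt0.
have v'E z : (v' z * g z.2)%:E = ((fun z => (v z.1 z.2 * g z.2)%:E) \_ slab) z.
  rewrite patchE mem_slab /v'.
  by case: ifP => //; rewrite mul0r.
have mvg : measurable_fun setT (fun z => (v' z * g z.2)%:E).
  apply/measurable_EFinP; apply: measurable_funM; first exact: mv'.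
  exact: (measurableT_comp mg measurable_snd).
have vg0 z : (0 <= (v' z * g z.2)%:E)%E by rewrite lee_fin mulr_ge0.
have mr1 : measurable_fun setT (fun z : mR * X => rweight al T k z.1).
  exact: (measurableT_comp measurable_rweight measurable_fst).
have intH : (mu \x m)%E.-integrable setT H.
  apply/integrableP; split => //.
  under eq_integral do rewrite gee0_abs//.
  rewrite frac_tonelli.
  apply: (@le_lt_trans _ _ (\int[mu \x m]_z ((v' z * g z.2)%:E * (rweight_max al T)%:E))%E).
    apply: ge0_le_integral => //.
    - by move=> z _; rewrite mule_ge0.
    - exact: emeasurable_funM.
    - by apply: emeasurable_funM.
    - by move=> z _; apply: lee_wpmul2l => //; exact: rweight_le.
  have M0 : (0 <= (rweight_max al T)%:E)%E.
    by apply: le_trans (rweight_ge0 0) _; exact: rweight_le.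
  rewrite ge0_integralZr// muleC lte_mul_pinfty//.
  by under eq_integral do rewrite v'E; rewrite -integral_mkcond.
have [iF eF] := integral_fine intH.
have EA : (EFin \o A) \_ slab = (fun z => ((Gamma al)^-1)%:E * (fine (H z))%:E)%E.
  apply/funext => z; rewrite -EFinM -AE !patchE.
  by case: ifP.
split.
  by apply/(integrable_mkcond _ measurable_slab); rewrite EA; exact: integrableZl.
rewrite [leRHS]integral_mkcond EA ge0_integralZl_EFin//; last 3 first.
- by move=> z _; rewrite lee_fin fine_ge0.
- exact: measurable_int iF.
- exact: ltW.
rewrite eF frac_tonelli EFinM -muleA lee_pmul2l// integral_mkcond.
have rm0 := rweight_min_gt0 al k.
have mw : measurable_fun setT (fun z : mR * X => (T - z.1) `^ al * rho T z.1 ^+ k).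
  apply: measurable_funM.
    apply: (@measurableT_comp _ _ _ _ _ _ (@powR R ^~ al)); first exact: measurable_powR.
    by apply: measurable_funB => //; exact: measurable_fst.
  by apply: measurable_funX; exact: (measurableT_comp (measurable_rho T) measurable_fst).
have pE z : ((fun z => (v z.1 z.2 * g z.2 * ((T - z.1) `^ al * rho T z.1 ^+ k))%:E) \_ slab) z =
   ((v' z * g z.2) * ((T - z.1) `^ al * rho T z.1 ^+ k))%:E.
  rewrite patchE mem_slab /v'.
  by case: ifP => //; rewrite !mul0r.
have r0 z : 0 <= v' z * g z.2 * ((T - z.1) `^ al * rho T z.1 ^+ k).
  rewrite /v'; case: ifPn => [/andP[t0 tT]|]; last by rewrite !mul0r.
  rewrite !mulr_ge0 ?powR_ge0// exprn_ge0//.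
  by have /(rho_bound T0)/andP[] : 0 <= z.1 <= T by rewrite !ltW.
under eq_integral do rewrite pE.
rewrite -ge0_integralZl_EFin//; last 3 first.
- by move=> z _; rewrite lee_fin.
- by apply/measurable_EFinP; apply: measurable_funM => //; exact/measurable_EFinP.
- exact: ltW.
apply: ge0_le_integral => //.
- by move=> z _; rewrite mule_ge0// lee_fin ?(ltW rm0).
- apply: measurable_funeM; apply/measurable_EFinP; apply: measurable_funM => //.
  exact/measurable_EFinP.
- exact: emeasurable_funM.
move=> z _; rewrite /v'; case: ifPn => [/andP[t0 tT]|]; last by rewrite !mul0r mule0 mul0e.
rewrite [(v _ _ * _ * _)%:E]EFinM muleCA lee_wpmul2l ?lee_fin ?mulr_ge0// -EFinM mulrA.
by apply: rweight_ge => //; rewrite t0.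
Qed.

End slab.

Lemma dominated_Rintegral d (X : measurableType d) (R : realType)
    (m : {measure set X -> \bar R}) (D : set X) (f g : X -> R) :
  measurable D -> measurable_fun D f -> measurable_fun D g ->
  (forall x, D x -> `|f x| <= g x) -> (\int[m]_(x in D) (g x)%:E < +oo)%E ->
  m.-integrable D (EFin \o f) /\ (`|\int[m]_(x in D) f x|%:E <= \int[m]_(x in D) (g x)%:E)%E.
Proof.
move=> mD mf mg fg goo.
have mnf : measurable_fun D (fun x => `|f x|) by exact: measurableT_comp.
have le : (\int[m]_(x in D) `|f x|%:E <= \int[m]_(x in D) (g x)%:E)%E.
  apply: ge0_le_integral => //; try exact/measurable_EFinP.
have intf : m.-integrable D (EFin \o f).
  by apply/integrableP; split; [exact/measurable_EFinP|exact: le_lt_trans goo].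
split => //; rewrite EFin_normr_Rintegral//; apply: le_trans le.
by apply: le_abse_integral => //; exact/measurable_EFinP.
Qed.

Lemma slab_integral_snd d (X : measurableType d) (R : realType)
    (m : {sigma_finite_measure set X -> \bar R}) (T : R) (g : X -> R) :
  0 < T -> measurable_fun setT g -> (forall x, 0 <= g x) ->
  (\int[@lebesgue_measure R \x m]_(z in @slab _ X R T) (g z.2)%:E = T%:E * \int[m]_x (g x)%:E)%E.
Proof.
move=> T0 mg g0; rewrite integral_mkcond.
rewrite (fubini_tonelli2 ((fun z => (g z.2)%:E) \_ (@slab _ X R T))).
- rewrite -ge0_integralZl//; last 3 first.
  + exact/measurable_EFinP.
  + by move=> x _; rewrite lee_fin.
  + by rewrite lee_fin ltW.
  apply: eq_integral => x _; rewrite /fubini_G.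
  transitivity (\int[@lebesgue_measure R]_(t in `]0%R, T[) (g x)%:E)%E.
    rewrite [RHS]integral_mkcond; apply: eq_integral => t _.
    by rewrite !patchE mem_slab mem_setE in_itv.
  by rewrite integral_cst//= lebesgue_measure_itv/= lte_fin T0 sube0 muleC.
- apply/(measurable_restrictT _ (@measurable_slab _ X R T)); apply: measurable_funTS.
  by apply/measurable_EFinP; exact: (measurableT_comp mg measurable_snd).
- by move=> z; rewrite patchE; case: ifP => // _; rewrite lee_fin.
Qed.

Section time_profile.
Context {R : realType}.
Variables (T : R) (n : nat).
Hypothesis T1 : 1 <= T.
Let T0 : 0 < T. Proof. exact: lt_le_trans T1. Qed.

(** Two powers above [n], because two time derivatives fall on it and every term must still be
    bounded by [rho T t ^+ n]. Each derivative also brings a factor 1/T. *)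
Definition profile (t : R) := rho T t ^+ n.+2.
Definition profile' (t : R) := - (n.+2%:R / T) * rho T t ^+ n.+1.
Definition profile'' (t : R) := (n.+2%:R / T) * (n.+1%:R / T) * rho T t ^+ n.

Lemma is_derive_rhoX k t : is_derive t (1 : R) (fun t => rho T t ^+ k.+1)
  (- (k.+1%:R / T) * rho T t ^+ k).
Proof.
have d : is_derive t (1 : R) (rho T) (- T^-1).
  have := is_deriveB (is_derive_cst (1 : R) t (1 : R))
    (is_deriveM (is_derive_id t (1 : R)) (is_derive_cst (T^-1) t (1 : R))).
  rewrite /GRing.scale/= => H; apply: is_derive_eq H _; ring.
have := is_deriveX k.+1 d; rewrite /GRing.scale/= exprfctE => H.
by apply: is_derive_eq H _; ring.
Qed.

Lemma is_derive_profile t : is_derive t (1 : R) profile (profile' t).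
Proof. exact: is_derive_rhoX. Qed.

Lemma is_derive_profile' t : is_derive t (1 : R) profile' (profile'' t).
Proof.
have := is_deriveM (is_derive_cst (- (n.+2%:R / T)) t (1 : R)) (is_derive_rhoX n t).
rewrite /GRing.scale/= => H; apply: is_derive_eq H _; rewrite /profile''; ring.
Qed.

Lemma continuous_rho : continuous (rho T).
Proof.
move=> t; apply: cvgB; first exact: cvg_cst.
by apply: cvgM; [exact: cvg_id|exact: cvg_cst].
Qed.

Lemma C2_profile : C2_on T profile profile' profile''.
Proof.
have cX k : continuous (fun t => rho T t ^+ k).
  move=> t; apply: (@continuous_comp _ _ _ (rho T) (fun x => x ^+ k)).
    exact: continuous_rho.
  exact: exprn_continuous.
split.
- exact/continuous_subspaceT/cX.
- by apply: continuous_subspaceT => t; apply: cvgM; [exact: cvg_cst|exact: cX].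
- by apply: continuous_subspaceT => t; apply: cvgM; [exact: cvg_cst|exact: cX].
- by move=> t _; exact: is_derive_profile.
- by move=> t _; exact: is_derive_profile'.
Qed.

Lemma rho_end : rho T T = 0.
Proof. by rewrite /rho divff ?subrr// gt_eqF. Qed.

Lemma profile_end : profile T = 0.
Proof. by rewrite /profile rho_end expr0n. Qed.

Lemma profile'_end : profile' T = 0.
Proof. by rewrite /profile' rho_end expr0n mulr0. Qed.

Lemma measurable_profile : measurable_fun setT profile.
Proof. by apply: measurable_funX; exact: measurable_rho. Qed.

Lemma measurable_profile' : measurable_fun setT profile'.
Proof.
by apply: measurable_funM => //; apply: measurable_funX; exact: measurable_rho.
Qed.

Lemma measurable_profile'' : measurable_fun setT profile''.
Proof.
by apply: measurable_funM => //; apply: measurable_funX; exact: measurable_rho.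
Qed.

Lemma profile_le t : 0 <= t <= T -> `|profile t| <= rho T t ^+ n.
Proof.
move=> /(rho_bound T0)/andP[r0 r1]; rewrite ger0_norm ?exprn_ge0//.
by apply: ler_wiXn2l => //; rewrite -addn2 leq_addr.
Qed.

Lemma profile'_le t : 0 <= t <= T -> `|profile' t| <= n.+2%:R / T * rho T t ^+ n.
Proof.
move=> /(rho_bound T0)/andP[r0 r1]; rewrite normrM normrN (ger0_norm (exprn_ge0 _ r0)).
have k0 : 0 <= n.+2%:R / T by rewrite divr_ge0// ltW.
by rewrite (ger0_norm k0) ler_wpM2l// ler_wiXn2l.
Qed.

Lemma profile''_le t : 0 <= t <= T ->
  `|profile'' t| <= n.+2%:R * n.+1%:R / T ^+ 2 * rho T t ^+ n.
Proof.
move=> /(rho_bound T0)/andP[r0 r1]; rewrite normrM (ger0_norm (exprn_ge0 _ r0)).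
rewrite ger0_norm; last by rewrite mulr_ge0// divr_ge0// ltW.
by rewrite le_eqVlt; apply/orP; left; apply/eqP; field; rewrite gt_eqF.
Qed.

End time_profile.

(** * The weak inequality for one translate of the bump *)

Section weak_inequality.
Context {R : realType} {N : nat}.
Local Notation Rn := 'rV[R]_N.
Local Notation mu := (@lebesgue_measure R).
Local Notation mR := (measurableTypeR R).
Local Notation P := (mu \x lebesgue_Rn N)%E.
Local Notation Slab T := (@slab _ Rn R T).

(** The factor grows with [z], so the bound serves only to prove finiteness of shifted integrals, or
    for shifts of bounded size. *)
Lemma weight_shift_le q (x z : Rn) : 0 <= q ->
  weight q (x - z) <= (2 * (1 + enorm z ^+ 2)) `^ (q / 2) * weight q x.
Proof.
move=> q0; have := enormD2_le (x - z) z; rewrite subrK => xz.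
have z0 := sqr_ge0 (enorm z); have x0 := sqr_ge0 (enorm x); have xz0 := sqr_ge0 (enorm (x - z)).
have p1 : 0 < 1 + enorm x ^+ 2 by lra.
have p2 : 0 < 1 + enorm (x - z) ^+ 2 by lra.
have p3 : 0 < 1 + enorm z ^+ 2 by lra.
rewrite /weight mulNr !powRN ler_pdivlMr ?powR_gt0// mulrC ler_pdivrMr ?powR_gt0//.
rewrite -powRM ?(ltW p2) ?mulr_ge0 ?(ltW p3)//.
apply: ge0_ler_powR; rewrite ?nnegrE ?divr_ge0 ?mulr_ge0 ?(ltW p1) ?(ltW p2) ?(ltW p3)//.
have := mulr_ge0 z0 xz0; lra.
Qed.

Lemma le_1DpowR (a r : R) : 0 <= a -> 1 <= r -> a <= 1 + a `^ r.
Proof.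
move=> a0 r1; have [a1|/ltW a1] := leP a 1.
  by rewrite (le_trans a1)// lerDl powR_ge0.
by rewrite (le_trans (le1r_powR a1 r1))// lerDr.
Qed.

Variables (p gamma sigma eta m q : R) (n : nat).
Hypothesis p0 : 1 < p.
Hypothesis al0 : 0 < 1 - gamma.
Hypothesis Nq : N%:R < q.
Hypothesis s01 : 0 <= sigma <= 1.
Hypothesis e01 : 0 <= eta <= 1.
Hypothesis Hs : [\/ sigma = 0, sigma = 1 | q <= N%:R + 2 * sigma].
Hypothesis He : [\/ eta = 0, eta = 1 | q <= N%:R + 2 * eta].

Let al := 1 - gamma.
Let q0 : 0 < q. Proof. by apply: le_lt_trans Nq. Qed.

(** [C] is fixed before [T], [z], the data and [u]. The identity expresses the nonlinear term
    through the linear ones and the data, which are bounded in absolute value; [frac_energy] bounds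
    the nonlinear term from below. *)
Lemma weak_inequality : exists2 C : R, 0 <= C & forall (T : R) (z : Rn) (u0 u1 : Rn -> R) (u : R -> Rn -> R),
  1 <= T ->
  measurable_fun (Slab T) (fun z => u z.1 z.2) ->
  (\int[P]_(y in Slab T) (`|u y.1 y.2| `^ p * weight q y.2)%:E < +oo)%E ->
  measurable_fun setT u0 -> measurable_fun setT u1 ->
  (\int[lebesgue_Rn N]_x ((`|u0 x| + `|u1 x|) * weight q x)%:E < +oo)%E ->
  weak_identity p gamma sigma eta m u0 u1 T u (psi0 z) (profile T n) (profile' T n) (profile'' T n) ->
  (\int[P]_(y in Slab T) (`|u y.1 y.2| `^ p * psi0 z y.2 * ((T - y.1) `^ al * rho T y.1 ^+ n.+2))%:E
  <= C%:E * (\int[P]_(y in Slab T) (`|u y.1 y.2| * weight q (y.2 - z) * rho T y.1 ^+ n)%:E +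
     \int[lebesgue_Rn N]_x ((`|u0 x| + `|u1 x|) * weight q (x - z))%:E))%E.
Proof.
have [A A0 HA] := @frac_laplacian_psi0_bound R N sigma q s01 q0 Hs.
have [B B0 HB] := @frac_laplacian_psi0_bound R N eta q e01 q0 He.
(* At order 0 the operator is the identity, so this bounds the bump itself by the weight. *)
have [|D D0 HD] := @frac_laplacian_psi0_bound R N 0 q _ q0 (Or31 _ _ erefl); first by rewrite lexx ler01.
pose E : R := n.+2%:R * n.+1%:R + `|m| * n.+2%:R.
have E0 : 0 <= E by rewrite addr_ge0// mulr_ge0.
pose C1 := A + B + D.
have C10 : 0 <= C1 by rewrite !addr_ge0.
pose c := (Gamma al)^-1 * rweight_min al n.+2.
have c0 : 0 < c by rewrite mulr_gt0 ?rweight_min_gt0// invr_gt0 Gamma_gt0.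
exists (c^-1 * (C1 * (1 + E))); first by rewrite !mulr_ge0 ?invr_ge0 ?(ltW c0) ?addr_ge0.
move=> T z u0 u1 u T1 mu' Iu mu0 mu1 I0 Hw.
have T0 : 0 < T by exact: lt_le_trans T1.
have mS := @measurable_slab _ Rn R T.
pose K x := C1 * weight q (x - z).
have K0 x : 0 <= K x by rewrite mulr_ge0// weight_ge0.
have KA x : `|frac_laplacian sigma (psi0 z) x| <= K x.
  by apply: le_trans (HA z x) _; rewrite ler_wpM2r ?weight_ge0// /C1; lra.
have KB x : `|frac_laplacian eta (psi0 z) x| <= K x.
  by apply: le_trans (HB z x) _; rewrite ler_wpM2r ?weight_ge0// /C1; lra.
have KD x : `|psi0 z x| <= K x.
  have := HD z x; rewrite {1}/frac_laplacian eqxx => /le_trans; apply.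
  by rewrite ler_wpM2r ?weight_ge0// /C1; lra.
have mK : measurable_fun setT K.
  apply: measurable_funM; first exact: measurable_cst.
  exact: (measurableT_comp (measurable_weight q) (measurable_rVBr z)).
have mpsi : measurable_fun setT (psi0 z) by exact: measurable_tbump.
have mfs := measurable_frac_laplacian_psi0 z s01.
have mfe := measurable_frac_laplacian_psi0 z e01.
pose Cz := (2 * (1 + enorm z ^+ 2)) `^ (q / 2).
have Cz0 : 0 <= Cz by exact: powR_ge0.
have wz x : weight q (x - z) <= Cz * weight q x by apply: weight_shift_le; exact: ltW.
have inslab (y : mR * Rn) : Slab T y -> 0 <= y.1 <= T.
  by move=> [/=]; rewrite in_itv/= => /andP[? ?] _; rewrite !ltW.
have mt (f : R -> R) : measurable_fun setT f -> measurable_fun (Slab T) (fun y : mR * Rn => f y.1).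
  by move=> mf; apply: measurable_funTS; exact: (measurableT_comp mf measurable_fst).
have mx (f : Rn -> R) : measurable_fun setT f -> measurable_fun (Slab T) (fun y : mR * Rn => f y.2).
  by move=> mf; apply: measurable_funTS; exact: (measurableT_comp mf measurable_snd).
have mau : measurable_fun (Slab T) (fun y : mR * Rn => `|u y.1 y.2|) by exact: measurableT_comp.
have mup : measurable_fun (Slab T) (fun y : mR * Rn => `|u y.1 y.2| `^ p).
  by apply: (measurableT_comp (measurable_powR p)).
have mr k : measurable_fun (Slab T) (fun y : mR * Rn => rho T y.1 ^+ k).
  by apply: (mt (fun t => rho T t ^+ k)); apply: measurable_funX; exact: measurable_rho.
have mwz : measurable_fun setT (fun x : Rn => weight q (x - z)).
  exact: (measurableT_comp (measurable_weight q) (measurable_rVBr z)).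
set J1 := (\int[P]_(y in Slab T) (`|u y.1 y.2| * weight q (y.2 - z) * rho T y.1 ^+ n)%:E)%E.
set J0 := (\int[lebesgue_Rn N]_x ((`|u0 x| + `|u1 x|) * weight q (x - z))%:E)%E.
pose G1 (y : mR * Rn) := `|u y.1 y.2| * weight q (y.2 - z) * rho T y.1 ^+ n.
have G10 y : Slab T y -> 0 <= G1 y.
  by move=> /inslab/(rho_bound T0)/andP[r0 _]; rewrite !mulr_ge0 ?weight_ge0// exprn_ge0.
have mG1 : measurable_fun (Slab T) G1.
  apply: measurable_funM; last exact: mr.
  by apply: measurable_funM; [exact: mau|exact: (mx _ mwz)].
pose G0 x := (`|u0 x| + `|u1 x|) * weight q (x - z).
have G00 x : 0 <= G0 x by rewrite mulr_ge0 ?weight_ge0 ?addr_ge0.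
have mau01 : measurable_fun setT (fun x => `|u0 x| + `|u1 x|).
  by apply: measurable_funD; exact: measurableT_comp.
have mG0 : measurable_fun setT G0 by exact: measurable_funM.
have mupw : measurable_fun (Slab T) (fun y : mR * Rn => `|u y.1 y.2| `^ p * weight q y.2).
  by apply: measurable_funM; [exact: mup|exact: (mx _ (measurable_weight q))].
(* Since |u| <= 1 + |u|^p and the weight has finite integral over a slab of finite length, the
   hypothesis on |u|^p is enough. *)
have J1fin : (J1 < +oo)%E.
  apply: (@le_lt_trans _ _ (\int[P]_(y in Slab T) (Cz%:E * (weight q y.2)%:E +
      Cz%:E * (`|u y.1 y.2| `^ p * weight q y.2)%:E))%E).
    apply: ge0_le_integral => //.
    - exact/measurable_EFinP.
    - apply: emeasurable_funD; apply: measurable_funeM; apply/measurable_EFinP => //.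
      exact: (mx (weight q) (measurable_weight q)).
    - move=> y Sy; rewrite -!EFinM -EFinD lee_fin.
      have /(rho_bound T0)/andP[r0 r1] := inslab y Sy.
      apply: (@le_trans _ _ (`|u y.1 y.2| * weight q (y.2 - z))).
        by rewrite ler_piMr ?mulr_ge0 ?weight_ge0// exprn_ile1.
      apply: (@le_trans _ _ ((1 + `|u y.1 y.2| `^ p) * (Cz * weight q y.2))).
        by apply: ler_pM; rewrite ?weight_ge0// le_1DpowR// ltW.
      by rewrite mulrDl mul1r lerD2l mulrCA.
  rewrite ge0_integralD//; last 4 first.
  - by move=> y _; rewrite -EFinM lee_fin mulr_ge0// weight_ge0.
  - by apply: measurable_funeM; apply/measurable_EFinP; exact: (mx (weight q) (measurable_weight q)).
  - by move=> y _; rewrite -EFinM lee_fin !mulr_ge0// ?powR_ge0// weight_ge0.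
  - by apply: measurable_funeM; exact/measurable_EFinP.
  rewrite !ge0_integralZl_EFin//; last 4 first.
  - by move=> y _; rewrite lee_fin mulr_ge0 ?powR_ge0// weight_ge0.
  - exact/measurable_EFinP.
  - by move=> y _; rewrite lee_fin weight_ge0.
  - by apply/measurable_EFinP; exact: (mx (weight q) (measurable_weight q)).
  apply: lte_add_pinfty; apply: lte_mul_pinfty => //.
  rewrite (@slab_integral_snd _ _ _ (lebesgue_Rn N) T (weight q) T0 (measurable_weight q) (weight_ge0 q)).
  apply: lte_mul_pinfty => //; first by rewrite lee_fin ltW.
  have := @weight_integral_le R N q 0 Nq; under eq_integral do rewrite subr0.
  by move=> /le_lt_trans; apply; exact: ltry.
have J0fin : (J0 < +oo)%E.
  apply: (@le_lt_trans _ _ (\int[lebesgue_Rn N]_x (Cz%:E * ((`|u0 x| + `|u1 x|) * weight q x)%:E))%E).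
    apply: ge0_le_integral => //.
    - by move=> x _; rewrite lee_fin; exact: G00.
    - exact/measurable_EFinP.
    - apply: measurable_funeM; apply/measurable_EFinP; apply: measurable_funM; first exact: mau01.
      exact: measurable_weight.
    - move=> x _; rewrite -EFinM lee_fin mulrCA; exact: ler_wpM2l.
  rewrite ge0_integralZl_EFin//; last 2 first.
  - by move=> x _; rewrite lee_fin mulr_ge0 ?weight_ge0// addr_ge0.
  - by apply/measurable_EFinP; apply: measurable_funM; [exact: mau01|exact: measurable_weight].
  exact: lte_mul_pinfty.
have J10 : (0 <= J1)%E by apply: integral_ge0 => y Sy; rewrite lee_fin; exact: G10.
have J00 : (0 <= J0)%E by apply: integral_ge0 => x _; rewrite lee_fin; exact: G00.
have J1Z (a : R) : 0 <= a -> (\int[P]_(y in Slab T) (a * G1 y)%:E = a%:E * J1)%E.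
  move=> a0; rewrite -ge0_integralZl_EFin//; last exact/measurable_EFinP.
have J1Zfin (a : R) : 0 <= a -> (\int[P]_(y in Slab T) (a * G1 y)%:E < +oo)%E.
  by move=> a0; rewrite J1Z//; apply: lte_mul_pinfty.
have Tm1 : T^-1 <= 1 by rewrite invf_le1.
pose F2 y := u y.1 y.2 * frac_laplacian sigma (fun x => psi0 z x * profile T n y.1) y.2.
pose F3 y := u y.1 y.2 * (psi0 z y.2 * profile'' T n y.1 +
   m * frac_laplacian eta (fun x => - (psi0 z x * profile' T n y.1)) y.2).
pose F1 y := (u0 y.2 + y.1 * u1 y.2) * (psi0 z y.2 * profile'' T n y.1)
     + m * u0 y.2 * frac_laplacian eta (fun x => - (psi0 z x * profile' T n y.1)) y.2.
pose F0 y := frac_integral al (fun s => `|u s y.2| `^ p) y.1 * (psi0 z y.2 * profile T n y.1).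
have fsE (t : R) x : frac_laplacian sigma (fun x => psi0 z x * profile T n t) x =
    profile T n t * frac_laplacian sigma (psi0 z) x.
  rewrite (_ : (fun x => _) = (fun y => profile T n t * psi0 z y)).
    exact: frac_laplacian_psi0Z.
  by apply/funext => y; rewrite mulrC.
have feE (t : R) x : frac_laplacian eta (fun x => - (psi0 z x * profile' T n t)) x =
    - profile' T n t * frac_laplacian eta (psi0 z) x.
  rewrite (_ : (fun x => _) = (fun y => - profile' T n t * psi0 z y)).
    exact: frac_laplacian_psi0Z.
  by apply/funext => y; rewrite mulNr mulrC.
have [i2 b2] : P.-integrable (Slab T) (EFin \o F2) /\
    (`|\int[P]_(y in Slab T) F2 y|%:E <= \int[P]_(y in Slab T) (C1 * G1 y)%:E)%E.
  apply: dominated_Rintegral => //.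
  - apply: (eq_measurable_fun (fun y => u y.1 y.2 * (profile T n y.1 * frac_laplacian sigma (psi0 z) y.2))).
      by move=> y _; rewrite /F2 fsE.
    apply: measurable_funM; first exact: mu'.
    apply: measurable_funM.
      by apply: (mt (profile T n)); exact: measurable_profile.
    exact: (mx _ mfs).
  - exact: measurable_funM.
  - move=> y Sy; rewrite /F2 fsE normrM [`|profile T n _ * _|]normrM.
    have H1 := profile_le n T1 (inslab y Sy).
    apply: (@le_trans _ _ (`|u y.1 y.2| * (rho T y.1 ^+ n * K y.2))).
      by rewrite ler_wpM2l// ler_pM.
    by rewrite /K /G1 le_eqVlt; apply/orP; left; apply/eqP; ring.
  - exact: J1Zfin.
have [i3 b3] : P.-integrable (Slab T) (EFin \o F3) /\
    (`|\int[P]_(y in Slab T) F3 y|%:E <= \int[P]_(y in Slab T) (C1 * E * G1 y)%:E)%E.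
  apply: dominated_Rintegral => //.
  - apply: (eq_measurable_fun (fun y => u y.1 y.2 * (psi0 z y.2 * profile'' T n y.1 +
        m * (- profile' T n y.1 * frac_laplacian eta (psi0 z) y.2)))).
      by move=> y _; rewrite /F3 feE.
    apply: measurable_funM; first exact: mu'.
    apply: measurable_funD; apply: measurable_funM.
    + exact: (mx _ mpsi).
    + by apply: (mt (profile'' T n)); exact: measurable_profile''.
    + exact: measurable_cst.
    + apply: measurable_funM; last exact: (mx _ mfe).
      by apply: measurable_funN; apply: (mt (profile' T n)); exact: measurable_profile'.
  - exact: measurable_funM.
  - move=> y Sy; rewrite /F3 feE normrM.
    have /(rho_bound T0)/andP[r0 r1] := inslab y Sy.
    have rn0 := exprn_ge0 n r0.
    have H1 := profile'_le n T1 (inslab y Sy); have H2 := profile''_le n T1 (inslab y Sy).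
    have {}H1 : `|profile' T n y.1| <= n.+2%:R * rho T y.1 ^+ n.
      apply: le_trans H1 _; rewrite ler_wpM2r//.
      by rewrite ler_piMr.
    have {}H2 : `|profile'' T n y.1| <= n.+2%:R * n.+1%:R * rho T y.1 ^+ n.
      apply: le_trans H2 _; rewrite ler_wpM2r//.
      by rewrite ler_piMr ?mulr_ge0// -exprVn exprn_ile1// invr_ge0 ltW.
    apply: (@le_trans _ _ (`|u y.1 y.2| * (K y.2 * (n.+2%:R * n.+1%:R * rho T y.1 ^+ n) +
        `|m| * (n.+2%:R * rho T y.1 ^+ n * K y.2)))).
      rewrite ler_wpM2l//; apply: le_trans (ler_normD _ _) _.
      rewrite [`|m * _|]normrM [`|psi0 z _ * _|]normrM [`|- profile' T n _ * _|]normrM normrN.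
      apply: lerD; first exact: ler_pM.
      by rewrite ler_wpM2l// ler_pM.
    by rewrite /K /G1 /E le_eqVlt; apply/orP; left; apply/eqP; ring.
  - by apply: J1Zfin; exact: mulr_ge0.
(* The slab has length [T], so a data term of size 1/T contributes an amount independent of [T]. *)
have GT0 : (\int[P]_(y in Slab T) (C1 * E / T * G0 y.2)%:E = (C1 * E)%:E * J0)%E.
  have CE0 : 0 <= C1 * E / T by rewrite divr_ge0 ?mulr_ge0// ltW.
  rewrite (@slab_integral_snd _ _ _ _ _ (fun x => C1 * E / T * G0 x))//; last 2 first.
  - exact: measurable_funM.
  - by move=> x; rewrite mulr_ge0.
  under eq_integral do rewrite EFinM.
  rewrite ge0_integralZl_EFin; [|exact: measurableT|by move=> x _; rewrite lee_fin; exact: G00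
    |exact/measurable_EFinP|exact: CE0].
  by rewrite muleA -EFinM mulrCA divff ?mulr1// gt_eqF.
have [i1 b1] : P.-integrable (Slab T) (EFin \o F1) /\
    (`|\int[P]_(y in Slab T) F1 y|%:E <= \int[P]_(y in Slab T) (C1 * E / T * G0 y.2)%:E)%E.
  apply: dominated_Rintegral => //.
  - apply: (eq_measurable_fun (fun y : mR * Rn => (u0 y.2 + y.1 * u1 y.2) * (psi0 z y.2 * profile'' T n y.1) +
        m * u0 y.2 * (- profile' T n y.1 * frac_laplacian eta (psi0 z) y.2))).
      by move=> y _; rewrite /F1 feE.
    apply: measurable_funD; apply: measurable_funM.
    + apply: measurable_funD; first exact: (mx _ mu0).
      by apply: measurable_funM; [exact: (mt id (@measurable_id _ _ _))|exact: (mx _ mu1)].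
    + apply: measurable_funM; first exact: (mx _ mpsi).
      by apply: (mt (profile'' T n)); exact: measurable_profile''.
    + by apply: measurable_funM; [exact: measurable_cst|exact: (mx _ mu0)].
    + apply: measurable_funM; last exact: (mx _ mfe).
      by apply: measurable_funN; apply: (mt (profile' T n)); exact: measurable_profile'.
  - by apply: measurable_funM; [exact: measurable_cst|exact: (mx _ mG0)].
  - move=> y Sy; rewrite /F1 feE.
    have /andP[y0 yT] := inslab y Sy.
    have /(rho_bound T0)/andP[r0 r1] := inslab y Sy.
    have rn0 := exprn_ge0 n r0; have rn1 := exprn_ile1 n r0 r1.
    have H1 := profile'_le n T1 (inslab y Sy); have H2 := profile''_le n T1 (inslab y Sy).
    have nT0 : 0 <= n.+2%:R / T by rewrite divr_ge0// ltW.
    have nT20 : 0 <= n.+2%:R * n.+1%:R / T ^+ 2 by rewrite divr_ge0 ?mulr_ge0 ?exprn_ge0// ltW.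
    have {}H1 : `|profile' T n y.1| <= n.+2%:R / T.
      by apply: le_trans H1 _; rewrite ler_piMr.
    have {}H2 : `|profile'' T n y.1| <= n.+2%:R * n.+1%:R / T ^+ 2.
      by apply: le_trans H2 _; rewrite ler_piMr.
    (* The factor [T] lost here, where [1 <= T] is used for [u0], is compensated by the T^(-2) of
       the second derivative; the damping term has the 1/T of the first. *)
    have H3 : `|u0 y.2 + y.1 * u1 y.2| <= T * (`|u0 y.2| + `|u1 y.2|).
      apply: le_trans (ler_normD _ _) _; rewrite normrM mulrDr (ger0_norm y0) lerD//.
        by rewrite ler_peMl.
      by rewrite ler_wpM2r.
    apply: (@le_trans _ _ (T * (`|u0 y.2| + `|u1 y.2|) * (K y.2 * (n.+2%:R * n.+1%:R / T ^+ 2)) +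
        `|m| * (`|u0 y.2| + `|u1 y.2|) * (n.+2%:R / T * K y.2))).
      apply: le_trans (ler_normD _ _) _.
      rewrite [`|(_ + _) * _|]normrM [`|psi0 z _ * _|]normrM [`|m * _ * _|]normrM.
      rewrite [`|m * _|]normrM [`|- profile' T n _ * _|]normrM normrN; apply: lerD.
        by apply: ler_pM => //; exact: ler_pM.
      apply: ler_pM => //; first by rewrite ler_wpM2l// lerDl.
      exact: ler_pM.
    rewrite /K /G0 /E le_eqVlt; apply/orP; left; apply/eqP; field.
    by rewrite gt_eqF.
  - by rewrite GT0; apply: lte_mul_pinfty => //; rewrite lee_fin mulr_ge0.
have [i0 b0] : P.-integrable (Slab T) (EFin \o F0) /\
  (((Gamma al)^-1 * rweight_min al n.+2)%:E *
    \int[P]_(y in Slab T) (`|u y.1 y.2| `^ p * psi0 z y.2 * ((T - y.1) `^ al * rho T y.1 ^+ n.+2))%:E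
  <= \int[P]_(y in Slab T) (F0 y)%:E)%E.
  apply: (@frac_energy _ _ _ _ T T0 al n.+2 al0 (fun t x => `|u t x| `^ p) (psi0 z)) => //.
    exact: tbump_ge0.
  apply: (@le_lt_trans _ _ (\int[P]_(y in Slab T) ((C1 * Cz)%:E * (`|u y.1 y.2| `^ p * weight q y.2)%:E))%E).
    apply: ge0_le_integral => //.
    - by move=> y _; rewrite lee_fin mulr_ge0 ?powR_ge0//; exact: tbump_ge0.
    - by apply/measurable_EFinP; apply: measurable_funM; [exact: mup|exact: (mx _ mpsi)].
    - by apply: measurable_funeM; exact/measurable_EFinP.
    - move=> y _; rewrite -EFinM lee_fin [leRHS]mulrCA; apply: ler_wpM2l; first exact: powR_ge0.
      apply: le_trans (ler_norm _) _; apply: le_trans (KD _) _.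
      by rewrite /K -mulrA ler_wpM2l.
  rewrite ge0_integralZl_EFin//; last 3 first.
  - by move=> y _; rewrite lee_fin mulr_ge0 ?powR_ge0// weight_ge0.
  - exact/measurable_EFinP.
  - exact: mulr_ge0.
  by apply: lte_mul_pinfty => //; rewrite lee_fin mulr_ge0.
have i01 : P.-integrable (Slab T) (EFin \o (fun y => F0 y + F1 y)).
  by have := integrableD mS i0 i1; apply: eq_integrable.
(* With joint integrability of all terms known, the identity moves onto the slab, where it says that
   the integral of [F0] is that of [F2] plus that of [F3] minus that of [F1]. *)
move: Hw; rewrite /weak_identity.
rewrite (@iterated_Rintegral _ _ _ _ T
  (fun t x => u t x * frac_laplacian sigma (fun x => psi0 z x * profile T n t) x))//.
rewrite (@iterated_Rintegral _ _ _ _ T (fun t x => u t x * (psi0 z x * profile'' T n t +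
   m * frac_laplacian eta (fun x => - (psi0 z x * profile' T n t)) x)))//.
rewrite (@iterated_Rintegral _ _ _ _ T (fun t x =>
  frac_integral al (fun s => `|u s x| `^ p) t * (psi0 z x * profile T n t) + (u0 x + t * u1 x) * (psi0 z x * profile'' T n t)
     + m * u0 x * frac_laplacian eta (fun y => - (psi0 z y * profile' T n t)) x)); last first.
  by apply: eq_integrable i01 => // y _ /=; rewrite addrA.
rewrite -/F2 -/F3.
rewrite [X in X = _](_ : _ = \int[P]_(y in Slab T) (F0 y + F1 y)); last first.
  by apply: eq_Rintegral => y _; rewrite /F0 /F1 addrA.
rewrite RintegralD// => Hw.
have J1f : J1 \is a fin_num by rewrite ge0_fin_numE.
have J0f : J0 \is a fin_num by rewrite ge0_fin_numE.
set L := (\int[P]_(y in Slab T) _)%E in b0 *.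
rewrite J1Z// in b2; rewrite J1Z ?mulr_ge0// in b3; rewrite GT0 in b1.
have j10 : 0 <= fine J1 by rewrite fine_ge0.
have j00 : 0 <= fine J0 by rewrite fine_ge0.
rewrite -(fineK J1f) -(fineK J0f) -?EFinM -?EFinD ?lee_fin in b1 b2 b3 *.
have {}b0 : (L <= (c^-1)%:E * (\int[P]_(y in Slab T) F0 y)%:E)%E.
  by rewrite lee_pdivlMl// fineK// integrable_fin_num.
apply: (le_trans b0); rewrite -EFinM lee_fin -[leRHS]mulrA; apply: ler_wpM2l.
  by rewrite invr_ge0 ltW.
apply: (@le_trans _ _ (C1 * fine J1 + C1 * E * fine J1 + C1 * E * fine J0)).
  move: b1 b2 b3; rewrite !ler_norml => /andP[? ?] /andP[? ?] /andP[? ?].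
  have -> : \int[P]_(y in Slab T) F0 y = \int[P]_(y in Slab T) F2 y +
      \int[P]_(y in Slab T) F3 y - \int[P]_(y in Slab T) F1 y by rewrite -Hw addrK.
  by apply: lerD; [exact: lerD|rewrite lerNl].
rewrite -subr_ge0 [X in 0 <= X](_ : _ = C1 * fine J0); first exact: mulr_ge0.
ring.
Qed.

End weak_inequality.

(** * Averaging over the translates *)

Lemma tonelli_within d1 d2 (Y : measurableType d1) (Z : measurableType d2) (R : realType)
    (m1 : {sigma_finite_measure set Y -> \bar R})
    (m2 : {sigma_finite_measure set Z -> \bar R})
    (D : set Y) (h : Y -> R) (K : Y * Z -> R) :
  measurable D -> measurable_fun D h -> (forall y, D y -> 0 <= h y) ->
  measurable_fun setT K -> (forall p, 0 <= K p) ->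
  (\int[m2]_z \int[m1]_(y in D) (h y * K (y, z))%:E =
   \int[m1]_(y in D) \int[m2]_z (h y * K (y, z))%:E)%E.
Proof.
move=> mD mh h0 mK K0.
pose F (p : Y * Z) := ((h \_ D) p.1 * K p)%:E.
have h'0 y : 0 <= (h \_ D) y.
  by rewrite patchE; case: ifPn => // yD; apply: h0; rewrite inE in yD.
have mF : measurable_fun setT F.
  apply/measurable_EFinP; apply: measurable_funM; last exact: mK.
  apply: (@measurableT_comp _ _ _ _ _ _ (h \_ D)); last exact: measurable_fst.
  exact/(measurable_restrictT _ mD).
have F0 p : (0 <= F p)%E by rewrite lee_fin mulr_ge0.
transitivity (\int[m2]_z fubini_G m1 F z)%E.
  apply: eq_integral => z _; rewrite integral_mkcond /fubini_G.
  apply: eq_integral => y _; rewrite /F/= !patchE.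
  by case: ifP => // _; rewrite mul0r.
rewrite -(fubini_tonelli F mF F0).
rewrite [RHS]integral_mkcond; apply: eq_integral => y _; rewrite patchE /fubini_F /F/= patchE.
by case: ifP => // _; apply: integral0_eq => z _; rewrite mul0r.
Qed.

Section convolution.
Context {R : realType} {N : nat}.
Local Notation Rn := 'rV[R]_N.
Variable q : R.
Hypothesis Nq : N%:R < q.
Let q0 : 0 < q. Proof. exact: le_lt_trans Nq. Qed.

(* One of [z], [x - z] has norm at least half that of [x]. *)
Lemma weightM_le (x z : Rn) :
  weight q z * weight q (x - z) <= 4 `^ (q / 2) * weight q x * (weight q z + weight q (x - z)).
Proof.
have := enormD2_le (x - z) z; rewrite subrK => xz.
have z0 := sqr_ge0 (enorm z); have x0 := sqr_ge0 (enorm x); have xz0 := sqr_ge0 (enorm (x - z)).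
have key (y : Rn) : 1 + enorm x ^+ 2 <= 4 * (1 + enorm y ^+ 2) ->
    weight q y <= 4 `^ (q / 2) * weight q x.
  move=> H; have y0 := sqr_ge0 (enorm y).
  have p1 : 0 < 1 + enorm x ^+ 2 by lra.
  have p2 : 0 < 1 + enorm y ^+ 2 by lra.
  rewrite /weight mulNr !powRN ler_pdivlMr ?powR_gt0// mulrC ler_pdivrMr ?powR_gt0//.
  rewrite -powRM ?(ltW p2)//.
  by apply: ge0_ler_powR; rewrite ?nnegrE ?divr_ge0 ?mulr_ge0 ?(ltW p1) ?(ltW p2) ?(ltW q0).
have wz := weight_ge0 q z; have wxz := weight_ge0 q (x - z); have wx := weight_ge0 q x.
have c0 : 0 <= 4 `^ (q / 2) * weight q x by rewrite mulr_ge0 ?powR_ge0.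
rewrite mulrDr; have [le|/ltW le] := leP (enorm z ^+ 2) (enorm (x - z) ^+ 2).
  have /key H : 1 + enorm x ^+ 2 <= 4 * (1 + enorm (x - z) ^+ 2) by lra.
  rewrite mulrC; apply: (@le_trans _ _ (4 `^ (q / 2) * weight q x * weight q z)).
    by rewrite ler_wpM2r.
  by rewrite lerDl mulr_ge0.
have /key H : 1 + enorm x ^+ 2 <= 4 * (1 + enorm z ^+ 2) by lra.
apply: (@le_trans _ _ (4 `^ (q / 2) * weight q x * weight q (x - z))).
  by rewrite ler_wpM2r.
by rewrite lerDr mulr_ge0.
Qed.

Lemma weight_reflect (x z : Rn) : weight q (x - z) = weight q (z - x).
Proof. by rewrite /weight -enormN opprB. Qed.

Lemma measurable_weight_conv (x : Rn) :
  measurable_fun setT (fun z : Rn => weight q (x - z)).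
Proof.
apply: (eq_measurable_fun (fun z : Rn => weight q (z - x))).
  by move=> z _; rewrite weight_reflect.
exact: (measurableT_comp (measurable_weight q) (measurable_rVBr x)).
Qed.

(** Averaging with density [weight q z] has to reproduce the same weight for the inequality to
    close. After [weightM_le] there remain two integrals of a weight, both bounded uniformly in
    [x]. *)
Lemma weight_conv_le : exists2 C : R, 0 <= C & forall x : Rn,
  (\int[lebesgue_Rn N]_z (weight q z * weight q (x - z))%:E <= (C * weight q x)%:E)%E.
Proof.
pose K : R := 2 ^+ N * (2 `^ q / (1 - 2 `^ (N%:R - q))).
have HK := @weight_integral_le R N q _ Nq; rewrite -/K in HK.
have K0 : 0 <= K.
  rewrite -lee_fin; apply: le_trans (HK 0); apply: integral_ge0 => x _.
  by rewrite lee_fin weight_ge0.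
pose c := 4 `^ (q / 2) : R.
exists (c * (K + K)); first by rewrite mulr_ge0 ?powR_ge0 ?addr_ge0.
move=> x.
have cw0 : 0 <= c * weight q x by rewrite mulr_ge0 ?powR_ge0 ?weight_ge0.
have mw := @measurable_weight R N q; have mwx := measurable_weight_conv x.
apply: (@le_trans _ _ (\int[lebesgue_Rn N]_z ((c * weight q x)%:E * ((weight q z)%:E + (weight q (x - z))%:E)))%E).
  apply: ge0_le_integral.
  - exact: measurableT.
  - by move=> z _; rewrite lee_fin mulr_ge0 ?weight_ge0.
  - by apply/measurable_EFinP; exact: measurable_funM.
  - apply: measurable_funeM; apply: emeasurable_funD; exact/measurable_EFinP.
  - by move=> z _; rewrite -EFinD -EFinM lee_fin; exact: weightM_le.
rewrite ge0_integralZl_EFin//; last 2 first.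
- by move=> z _; rewrite -EFinD lee_fin addr_ge0 ?weight_ge0.
- by apply: emeasurable_funD; exact/measurable_EFinP.
rewrite ge0_integralD//; last 4 first.
- by move=> z _; rewrite lee_fin weight_ge0.
- exact/measurable_EFinP.
- by move=> z _; rewrite lee_fin weight_ge0.
- exact/measurable_EFinP.
rewrite [leRHS](_ : _ = (c * weight q x)%:E * (K%:E + K%:E))%E; last first.
  by rewrite -EFinD -EFinM mulrAC.
apply: lee_wpmul2l; first by rewrite lee_fin.
apply: leeD.
  have <- : (\int[lebesgue_Rn N]_x (weight q (x - 0))%:E = \int[lebesgue_Rn N]_x (weight q x)%:E)%E.
    by apply: eq_integral => y _; rewrite subr0.
  exact: HK.
by under eq_integral do rewrite weight_reflect; exact: HK.
Qed.

Lemma measurable_psi0 : measurable_fun setT (fun p : Rn * Rn => psi0 p.2 p.1).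
Proof.
apply: (eq_measurable_fun (fun p : Rn * Rn => psi0 0 (p.1 - p.2))).
  by move=> p _; rewrite /psi0 [RHS]tbumpE.
exact: (measurableT_comp (measurable_tbump 0 _) measurable_rVB).
Qed.

Lemma measurable_psi0_center (x : Rn) : measurable_fun setT (fun z : Rn => psi0 z x).
Proof.
apply: (eq_measurable_fun (fun z : Rn => psi0 0 (x - z))).
  by move=> z _; rewrite /psi0 [RHS]tbumpE.
apply: (measurableT_comp (measurable_tbump 0 _)).
exact: (measurableT_comp measurable_rVB (pair_measurable x)).
Qed.

(** Only the [z] in the cube of side 1 and volume 1 around [x] are kept: there the bump is at least
    exp(-4)^N and the two weights are comparable by [weight_shift_le]. *)
Lemma weight_conv_ge : exists2 c : R, 0 < c & forall x : Rn,
  ((c * weight q x)%:E <= \int[lebesgue_Rn N]_z (weight q z * psi0 z x)%:E)%E.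
Proof.
pose c1 : R := (2 * (1 + N%:R)) `^ (q / 2).
have c10 : 0 < c1 by rewrite powR_gt0// mulr_gt0// ltr_pwDl.
pose c2 : R := expR (- 4) ^+ N.
have c20 : 0 < c2 by rewrite exprn_gt0// expR_gt0.
exists (c1^-1 * c2); first by rewrite mulr_gt0// invr_gt0.
move=> x; pose B := cube x 2^-1.
have mB : measurable B by exact: measurable_cube.
apply: (@le_trans _ _ (\int[lebesgue_Rn N]_(z in B) (cst (c1^-1 * weight q x * c2)%:E z))%E).
  have lB : lebesgue_Rn N B = 1%E.
    by rewrite /B lebesgue_Rn_cube ?invr_gt0// divff// expr1n.
  by rewrite integral_cst//= lB mule1 lee_fin mulrAC.
apply: (@le_trans _ _ (\int[lebesgue_Rn N]_(z in B) (weight q z * psi0 z x)%:E)%E); last first.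
  apply: ge0_subset_integral => //.
    apply/measurable_EFinP; apply: measurable_funM; first exact: measurable_weight.
    exact: measurable_psi0_center.
  by move=> z _; rewrite lee_fin mulr_ge0 ?weight_ge0//; exact: tbump_ge0.
apply: ge0_le_integral => //.
- by move=> z _; rewrite lee_fin !mulr_ge0 ?weight_ge0 ?invr_ge0 ?(ltW c10) ?(ltW c20).
- apply: measurable_funTS; apply/measurable_EFinP; apply: measurable_funM; first exact: measurable_weight.
  exact: measurable_psi0_center.
move=> z zB; rewrite lee_fin; apply: ler_pM.
- by rewrite mulr_ge0 ?weight_ge0 ?invr_ge0 ?(ltW c10).
- exact: ltW.
- rewrite ler_pdivrMl//.
  have := weight_shift_le z (z - x) (ltW q0); rewrite opprB addrC subrK => /le_trans; apply.
  rewrite ler_wpM2r ?weight_ge0//.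
  have zN : enorm (z - x) ^+ 2 <= N%:R.
    apply: cube_enorm2_le => i; apply: lt_le_trans (zB i) _.
    by rewrite invf_le1// ler1n.
  have e0 := sqr_ge0 (enorm (z - x)).
  have N0 : (0:R) <= N%:R by [].
  apply: ge0_ler_powR; rewrite ?nnegrE ?divr_ge0 ?(ltW q0)//; lra.
- by apply: tbump_ge => i; rewrite distrC; exact: zB.
Qed.

End convolution.

Section product_sigma_finite.
Context d1 d2 (T1 : measurableType d1) (T2 : measurableType d2) (R : realType).
Variables (m1 : {sigma_finite_measure set T1 -> \bar R})
          (m2 : {sigma_finite_measure set T2 -> \bar R}).

(* A constant naming the product, so that its sigma-finite structure can be
   inferred when it is itself a factor of a product. *)
Definition prod_measure : set (T1 * T2) -> \bar R := (m1 \x m2)%E.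

HB.instance Definition _ := Measure.on prod_measure.

Let prod_measure_sigma_finite : sigma_finite setT prod_measure.
Proof.
have /sigma_finiteP[F [TF ndF Foo]] := sigma_finiteT m1.
have /sigma_finiteP[G [TG ndG Goo]] := sigma_finiteT m2.
exists (fun n => F n `*` G n).
  rewrite predeqE => -[x y]; split=> // _.
  have [i _ Fix] : (\bigcup_k F k) x by rewrite -TF.
  have [j _ Gjy] : (\bigcup_k G k) y by rewrite -TG.
  exists (maxn i j) => //; split => /=.
  - by move: x Fix; exact/subsetPset/ndF/leq_maxl.
  - by move: y Gjy; exact/subsetPset/ndG/leq_maxr.
move=> k; have [mFk Fk] := Foo k; have [mGk Gk] := Goo k.
split; first exact: measurableX.
by rewrite /prod_measure product_measure1E// lte_mul_pinfty// ge0_fin_numE.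
Qed.

HB.instance Definition _ := Measure_isSigmaFinite.Build _ _ _ prod_measure
  prod_measure_sigma_finite.

End product_sigma_finite.

Section tonelli_bounds.
Context d1 d2 (Y : measurableType d1) (Z : measurableType d2) (R : realType).
Variables (m1 : {sigma_finite_measure set Y -> \bar R})
          (m2 : {sigma_finite_measure set Z -> \bar R}).
Variables (D : set Y) (h : Y -> R) (K : Y * Z -> R).
Hypothesis mD : measurable D.
Hypothesis mh : measurable_fun D h.
Hypothesis h0 : forall y, D y -> 0 <= h y.
Hypothesis mK : measurable_fun setT K.
Hypothesis K0 : forall p, 0 <= K p.

Let F (p : Y * Z) := ((h \_ D) p.1 * K p)%:E.

Let mF : measurable_fun setT F.
Proof.
apply/measurable_EFinP; apply: measurable_funM; last exact: mK.
apply: (@measurableT_comp _ _ _ _ _ _ (h \_ D)); last exact: measurable_fst.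
exact/(measurable_restrictT _ mD).
Qed.

Let F0 p : (0 <= F p)%E.
Proof.
rewrite lee_fin mulr_ge0// patchE; case: ifPn => // yD.
by apply: h0; rewrite inE in yD.
Qed.

Lemma measurable_within1 :
  measurable_fun D (fun y => \int[m2]_z (h y * K (y, z))%:E)%E.
Proof.
have mG := measurable_fun_fubini_tonelli_F (m2 := m2) F mF F0.
apply: (eq_measurable_fun (fubini_F m2 F)); last exact: measurable_funTS.
by move=> y yD; apply: eq_integral => z _; rewrite /F/= patchE yD.
Qed.

Lemma measurable_within2 :
  measurable_fun setT (fun z => \int[m1]_(y in D) (h y * K (y, z))%:E)%E.
Proof.
have mG := measurable_fun_fubini_tonelli_G (m1 := m1) F mF F0.
apply: (eq_measurable_fun (fubini_G m1 F)); last exact: mG.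
move=> z _; rewrite [RHS]integral_mkcond; apply: eq_integral => y _.
by rewrite /F/= !patchE; case: ifP => // _; rewrite mul0r.
Qed.

Let mKy y : measurable_fun setT (fun z => (K (y, z))%:E).
Proof.
apply/measurable_EFinP; apply: (measurableT_comp mK).
by apply/measurable_fun_pairP; split; [exact: measurable_cst|exact: measurable_id].
Qed.

Let hK y : D y -> (\int[m2]_z (h y * K (y, z))%:E = (h y)%:E * \int[m2]_z (K (y, z))%:E)%E.
Proof.
move=> Dy; under eq_integral do rewrite EFinM.
by rewrite ge0_integralZl_EFin//; [move=> z _; rewrite lee_fin|exact: h0].
Qed.

Lemma tonelli_le (k : Y -> R) : measurable_fun D k ->
  (forall y, D y -> (\int[m2]_z (K (y, z))%:E <= (k y)%:E)%E) ->
  (\int[m2]_z \int[m1]_(y in D) (h y * K (y, z))%:E <=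
   \int[m1]_(y in D) (h y * k y)%:E)%E.
Proof.
move=> mk Kk; rewrite tonelli_within//.
apply: ge0_le_integral.
- exact: mD.
- by move=> y Dy; apply: integral_ge0 => z _; rewrite lee_fin mulr_ge0// h0.
- exact: measurable_within1.
- by apply/measurable_EFinP; exact: measurable_funM.
- by move=> y Dy; rewrite hK// EFinM; apply: lee_wpmul2l; [rewrite lee_fin h0|exact: Kk].
Qed.

Lemma tonelli_ge (k : Y -> R) : measurable_fun D k -> (forall y, D y -> 0 <= k y) ->
  (forall y, D y -> ((k y)%:E <= \int[m2]_z (K (y, z))%:E)%E) ->
  (\int[m1]_(y in D) (h y * k y)%:E <=
   \int[m2]_z \int[m1]_(y in D) (h y * K (y, z))%:E)%E.
Proof.
move=> mk k0 Kk; rewrite tonelli_within//.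
apply: ge0_le_integral.
- exact: mD.
- by move=> y Dy; rewrite lee_fin mulr_ge0 ?h0 ?k0.
- by apply/measurable_EFinP; exact: measurable_funM.
- exact: measurable_within1.
- by move=> y Dy; rewrite hK// EFinM; apply: lee_wpmul2l; [rewrite lee_fin h0|exact: Kk].
Qed.

End tonelli_bounds.

Section integrated_inequality.
Context {R : realType} {N : nat}.
Local Notation Rn := 'rV[R]_N.
Local Notation mu := (@lebesgue_measure R).
Local Notation mR := (measurableTypeR R).
Local Notation P := (mu \x lebesgue_Rn N)%E.
Local Notation Slab T := (@slab _ Rn R T).
Variables (p gamma sigma eta m q : R) (n : nat).
Hypothesis p0 : 1 < p.
Hypothesis al0 : 0 < 1 - gamma.
Hypothesis Nq : N%:R < q.
Hypothesis s01 : 0 <= sigma <= 1.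
Hypothesis e01 : 0 <= eta <= 1.
Hypothesis Hs : [\/ sigma = 0, sigma = 1 | q <= N%:R + 2 * sigma].
Hypothesis He : [\/ eta = 0, eta = 1 | q <= N%:R + 2 * eta].

Let al := 1 - gamma.

(** [weak_inequality] is multiplied by [weight q z] and integrated in [z], which is legitimate with
    one constant because its [C] does not depend on [z]. *)
Lemma integrated_inequality : exists2 C : R, 0 <= C & forall (T : R) (u0 u1 : Rn -> R) (u : R -> Rn -> R),
  1 <= T ->
  measurable_fun (Slab T) (fun z => u z.1 z.2) ->
  (\int[P]_(y in Slab T) (`|u y.1 y.2| `^ p * weight q y.2)%:E < +oo)%E ->
  measurable_fun setT u0 -> measurable_fun setT u1 ->
  (\int[lebesgue_Rn N]_x ((`|u0 x| + `|u1 x|) * weight q x)%:E < +oo)%E ->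
  (forall z, weak_identity p gamma sigma eta m u0 u1 T u (psi0 z) (profile T n) (profile' T n) (profile'' T n)) ->
  (\int[P]_(y in Slab T) (`|u y.1 y.2| `^ p * ((T - y.1) `^ al * rho T y.1 ^+ n.+2) * weight q y.2)%:E
  <= C%:E * (\int[P]_(y in Slab T) (`|u y.1 y.2| * rho T y.1 ^+ n * weight q y.2)%:E +
     \int[lebesgue_Rn N]_x ((`|u0 x| + `|u1 x|) * weight q x)%:E))%E.
Proof.
have [C1 C10 HC1] := @weak_inequality R N p gamma sigma eta m q n p0 al0 Nq s01 e01 Hs He.
have [K K0 HK] := @weight_conv_le R N q Nq.
have [c c0 Hc] := @weight_conv_ge R N q Nq.
exists (c^-1 * (C1 * K)); first by rewrite !mulr_ge0// invr_ge0 ltW.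
move=> T u0 u1 u T1 mu' Iu mu0 mu1 I0 Hw.
have T0 : 0 < T by exact: lt_le_trans T1.
have mS := @measurable_slab _ Rn R T.
have inslab (y : mR * Rn) : Slab T y -> 0 <= y.1 <= T.
  by move=> [/=]; rewrite in_itv/= => /andP[? ?] _; rewrite !ltW.
pose h y := `|u y.1 y.2| `^ p * ((T - y.1) `^ al * rho T y.1 ^+ n.+2).
pose h1 y := `|u y.1 y.2| * rho T y.1 ^+ n.
pose h0 x := `|u0 x| + `|u1 x|.
pose k0 (y : (mR * Rn) * Rn) := weight q y.2 * psi0 y.2 y.1.2.
pose k1 (y : (mR * Rn) * Rn) := weight q y.2 * weight q (y.1.2 - y.2).
pose k2 (y : Rn * Rn) := weight q y.2 * weight q (y.1 - y.2).
have hge0 y : Slab T y -> 0 <= h y.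
  move=> /inslab/(rho_bound T0)/andP[r0 _]; apply: mulr_ge0; first exact: powR_ge0.
  by apply: mulr_ge0; [exact: powR_ge0|exact: exprn_ge0].
have h1ge0 y : Slab T y -> 0 <= h1 y.
  by move=> /inslab/(rho_bound T0)/andP[r0 _]; apply: mulr_ge0 => //; exact: exprn_ge0.
have h0ge0 x : 0 <= h0 x by rewrite addr_ge0.
have k0ge0 y : 0 <= k0 y by apply: mulr_ge0; [exact: weight_ge0|exact: tbump_ge0].
have k1ge0 y : 0 <= k1 y by apply: mulr_ge0; exact: weight_ge0.
have k2ge0 y : 0 <= k2 y by apply: mulr_ge0; exact: weight_ge0.
have mau : measurable_fun (Slab T) (fun y : mR * Rn => `|u y.1 y.2|) by exact: measurableT_comp.
have mup : measurable_fun (Slab T) (fun y : mR * Rn => `|u y.1 y.2| `^ p).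
  by apply: (measurableT_comp (measurable_powR p)).
have mr k : measurable_fun (Slab T) (fun y : mR * Rn => rho T y.1 ^+ k).
  apply: measurable_funTS; apply: measurable_funX.
  exact: (measurableT_comp (measurable_rho T) measurable_fst).
have mTt : measurable_fun (Slab T) (fun y : mR * Rn => (T - y.1) `^ al).
  apply: measurable_funTS; apply: (measurableT_comp (measurable_powR al)).
  by apply: measurable_funB; [exact: measurable_cst|exact: measurable_fst].
have mh : measurable_fun (Slab T) h.
  apply: measurable_funM; first exact: mup.
  by apply: measurable_funM; [exact: mTt|exact: mr].
have mh1 : measurable_fun (Slab T) h1 by apply: measurable_funM; [exact: mau|exact: mr].
have mh0 : measurable_fun setT h0 by apply: measurable_funD; exact: measurableT_comp.
have mw := @measurable_weight R N q.
have mwS : measurable_fun (Slab T) (fun y : mR * Rn => weight q y.2).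
  by apply: measurable_funTS; exact: (measurableT_comp mw measurable_snd).
have mp12 : measurable_fun setT (fun y : (mR * Rn) * Rn => (y.1.2, y.2)).
  apply/measurable_fun_pairP; split; last exact: measurable_snd.
  exact: (measurableT_comp measurable_snd measurable_fst).
have mw2 : measurable_fun setT (fun y : Rn * Rn => weight q (y.1 - y.2)).
  exact: (measurableT_comp mw measurable_rVB).
have mk0 : measurable_fun setT k0.
  apply: measurable_funM; first exact: (measurableT_comp mw measurable_snd).
  exact: (measurableT_comp measurable_psi0 mp12).
have mk1 : measurable_fun setT k1.
  apply: measurable_funM; first exact: (measurableT_comp mw measurable_snd).
  exact: (measurableT_comp mw2 mp12).
have mk2 : measurable_fun setT k2.
  by apply: measurable_funM; [exact: (measurableT_comp mw measurable_snd)|exact: mw2].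
pose muS := (mu : {sigma_finite_measure set mR -> \bar R}).
pose PS : {sigma_finite_measure set (mR * Rn)%type -> \bar R} := prod_measure muS (lebesgue_Rn N).
have mcw : measurable_fun (Slab T) (fun y : mR * Rn => c * weight q y.2).
  by apply: measurable_funM; [exact: measurable_cst|exact: mwS].
have mKw : measurable_fun (Slab T) (fun y : mR * Rn => K * weight q y.2).
  by apply: measurable_funM; [exact: measurable_cst|exact: mwS].
have mKw0 : measurable_fun setT (fun x : Rn => K * weight q x).
  by apply: measurable_funM; [exact: measurable_cst|exact: mw].
have cw0 (y : mR * Rn) : Slab T y -> 0 <= c * weight q y.2.
  by move=> _; apply: mulr_ge0; [exact: ltW|exact: weight_ge0].
(* Exchanging [z] with the other variables turns each kernel into a convolution: the bump is bounded
   below in [L1], the shifted weight above in [L2] for [u] and in [L3] for the data. *)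
have L1 := @tonelli_ge _ _ _ _ R PS (lebesgue_Rn N) (Slab T) h k0 mS mh hge0 mk0 k0ge0
  (fun y => c * weight q y.2) mcw cw0 (fun y _ => Hc y.2).
have L2 := @tonelli_le _ _ _ _ R PS (lebesgue_Rn N) (Slab T) h1 k1 mS mh1 h1ge0 mk1 k1ge0
  (fun y => K * weight q y.2) mKw (fun y _ => HK y.2).
have L3 := @tonelli_le _ _ _ _ R (lebesgue_Rn N) (lebesgue_Rn N) setT h0 k2 measurableT mh0
  (fun x _ => h0ge0 x) mk2 k2ge0 (fun x => K * weight q x) mKw0 (fun x _ => HK x).
have mI1 := @measurable_within2 _ _ _ _ R PS (Slab T) h1 k1 mS mh1 h1ge0 mk1 k1ge0.
have mI2 := @measurable_within2 _ _ _ _ R (lebesgue_Rn N) setT h0 k2 measurableT mh0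
  (fun x _ => h0ge0 x) mk2 k2ge0.
have mI0 := @measurable_within2 _ _ _ _ R PS (Slab T) h k0 mS mh hge0 mk0 k0ge0.
have L4 z : (\int[P]_(y in Slab T) (h y * k0 (y, z))%:E <=
   C1%:E * (\int[P]_(y in Slab T) (h1 y * k1 (y, z))%:E + \int[lebesgue_Rn N]_x (h0 x * k2 (x, z))%:E))%E.
  have wz0 := weight_ge0 q z.
  have mpsi : measurable_fun (Slab T) (fun y : mR * Rn => psi0 z y.2).
    by apply: measurable_funTS; exact: (measurableT_comp (measurable_tbump z _) measurable_snd).
  have mwz : measurable_fun setT (fun x : Rn => weight q (x - z)).
    exact: (measurableT_comp mw (measurable_rVBr z)).
  have mwzS : measurable_fun (Slab T) (fun y : mR * Rn => weight q (y.2 - z)).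
    by apply: measurable_funTS; exact: (measurableT_comp mwz measurable_snd).
  have E0 : (\int[P]_(y in Slab T) (h y * k0 (y, z))%:E = (weight q z)%:E *
      \int[P]_(y in Slab T) (`|u y.1 y.2| `^ p * psi0 z y.2 * ((T - y.1) `^ al * rho T y.1 ^+ n.+2))%:E)%E.
    rewrite -(ge0_integralZl_EFin _ mS _ _ wz0).
    - by apply: eq_integral => y _; rewrite -EFinM /h /k0/=; congr (_%:E); ring.
    - move=> y /hge0; rewrite /h !lee_fin => h0'.
      rewrite mulrAC; apply: mulr_ge0; [exact: h0'|exact: tbump_ge0].
    - apply/measurable_EFinP; apply: measurable_funM; first by apply: measurable_funM; [exact: mup|exact: mpsi].
      by apply: measurable_funM; [exact: mTt|exact: mr].
  have E1 : (\int[P]_(y in Slab T) (h1 y * k1 (y, z))%:E = (weight q z)%:E *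
      \int[P]_(y in Slab T) (`|u y.1 y.2| * weight q (y.2 - z) * rho T y.1 ^+ n)%:E)%E.
    rewrite -(ge0_integralZl_EFin _ mS _ _ wz0).
    - by apply: eq_integral => y _; rewrite -EFinM /h1 /k1/=; congr (_%:E); ring.
    - move=> y /h1ge0; rewrite /h1 !lee_fin => h0'.
      rewrite mulrAC; apply: mulr_ge0; [exact: h0'|exact: weight_ge0].
    - apply/measurable_EFinP; apply: measurable_funM; last exact: mr.
      by apply: measurable_funM; [exact: mau|exact: mwzS].
  have E2 : (\int[lebesgue_Rn N]_x (h0 x * k2 (x, z))%:E = (weight q z)%:E *
      \int[lebesgue_Rn N]_x ((`|u0 x| + `|u1 x|) * weight q (x - z))%:E)%E.
    rewrite -(ge0_integralZl_EFin _ measurableT _ _ wz0).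
    - by apply: eq_integral => y _; rewrite -EFinM /h0 /k2/=; congr (_%:E); ring.
    - by move=> x _; rewrite lee_fin; apply: mulr_ge0; [exact: h0ge0|exact: weight_ge0].
    - by apply/measurable_EFinP; apply: measurable_funM; [exact: mh0|exact: mwz].
  have := HC1 T z u0 u1 u T1 mu' Iu mu0 mu1 I0 (Hw z).
  rewrite E0 E1 E2 -ge0_muleDr; last 2 first.
  - apply: integral_ge0 => y /h1ge0; rewrite /h1 lee_fin => h0'.
    by rewrite mulrAC; apply: mulr_ge0; [exact: h0'|exact: weight_ge0].
  - by apply: integral_ge0 => x _; rewrite lee_fin; apply: mulr_ge0; [exact: h0ge0|exact: weight_ge0].
  by move=> H; rewrite [leRHS]muleCA; apply: lee_wpmul2l; first by rewrite lee_fin.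
have c0' := ltW c0.
have I1ge0 z : (0 <= \int[P]_(y in Slab T) (h1 y * k1 (y, z))%:E)%E.
  by apply: integral_ge0 => y /h1ge0 h0'; rewrite lee_fin; apply: mulr_ge0; [exact: h0'|exact: k1ge0].
have I2ge0 z : (0 <= \int[lebesgue_Rn N]_x (h0 x * k2 (x, z))%:E)%E.
  by apply: integral_ge0 => x _; rewrite lee_fin; apply: mulr_ge0; [exact: h0ge0|exact: k2ge0].
have L5 : (\int[lebesgue_Rn N]_z \int[P]_(y in Slab T) (h y * k0 (y, z))%:E <=
   C1%:E * (\int[lebesgue_Rn N]_z \int[P]_(y in Slab T) (h1 y * k1 (y, z))%:E +
     \int[lebesgue_Rn N]_z \int[lebesgue_Rn N]_x (h0 x * k2 (x, z))%:E))%E.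
  rewrite -(ge0_integralD _ measurableT (fun z _ => I1ge0 z) mI1 (fun z _ => I2ge0 z) mI2).
  rewrite -(ge0_integralZl_EFin _ measurableT _ _ C10).
  - apply: ge0_le_integral.
    + exact: measurableT.
    + by move=> z _; apply: integral_ge0 => y /hge0 h0'; rewrite lee_fin; apply: mulr_ge0;
        [exact: h0'|exact: k0ge0].
    + exact: mI0.
    + by apply: measurable_funeM; apply: emeasurable_funD; [exact: mI1|exact: mI2].
    + by move=> z _; exact: L4.
  - by move=> z _; apply: adde_ge0; [exact: I1ge0|exact: I2ge0].
  - by apply: emeasurable_funD; [exact: mI1|exact: mI2].
have Z0 : (\int[P]_(y in Slab T) (h y * (c * weight q y.2))%:E =
    c%:E * \int[P]_(y in Slab T) (`|u y.1 y.2| `^ p * ((T - y.1) `^ al * rho T y.1 ^+ n.+2) * weight q y.2)%:E)%E.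
  rewrite -(ge0_integralZl_EFin _ mS _ _ c0').
  - by apply: eq_integral => y _; rewrite -EFinM /h/=; congr (_%:E); ring.
  - by move=> y /hge0; rewrite /h lee_fin => h0'; apply: mulr_ge0 => //; exact: weight_ge0.
  - by apply/measurable_EFinP; apply: measurable_funM; [exact: mh|exact: mwS].
have Z1 : (\int[P]_(y in Slab T) (h1 y * (K * weight q y.2))%:E =
    K%:E * \int[P]_(y in Slab T) (`|u y.1 y.2| * rho T y.1 ^+ n * weight q y.2)%:E)%E.
  rewrite -(ge0_integralZl_EFin _ mS _ _ K0).
  - by apply: eq_integral => y _; rewrite -EFinM /h1/=; congr (_%:E); ring.
  - by move=> y /h1ge0; rewrite /h1 lee_fin => h0'; apply: mulr_ge0 => //; exact: weight_ge0.
  - by apply/measurable_EFinP; apply: measurable_funM; [exact: mh1|exact: mwS].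
have Z2 : (\int[lebesgue_Rn N]_x (h0 x * (K * weight q x))%:E =
    K%:E * \int[lebesgue_Rn N]_x ((`|u0 x| + `|u1 x|) * weight q x)%:E)%E.
  rewrite -(ge0_integralZl_EFin _ measurableT _ _ K0).
  - by apply: eq_integral => y _; rewrite -EFinM /h0/=; congr (_%:E); ring.
  - by move=> x _; rewrite lee_fin; apply: mulr_ge0; [exact: h0ge0|exact: weight_ge0].
  - by apply/measurable_EFinP; apply: measurable_funM; [exact: mh0|exact: mw].
have L6 := le_trans L1 (le_trans L5 (lee_wpmul2l _ (leeD L2 L3))).
rewrite EFinM -muleA lee_pdivlMl//.
rewrite -Z0 EFinM -muleA ge0_muleDr; last 2 first.
- by apply: integral_ge0 => y /h1ge0 h0'; rewrite lee_fin; apply: mulr_ge0; [exact: h0'|exact: weight_ge0].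
- by apply: integral_ge0 => x _; rewrite lee_fin; apply: mulr_ge0; [exact: h0ge0|exact: weight_ge0].
by rewrite -Z1 -Z2; apply: L6; rewrite lee_fin.
Qed.

End integrated_inequality.

(** * The two passes of Young's inequality *)

Section real_bootstrap.
Context {R : realType}.

(** Used for two quantities: the time [T], and the parameter of Young's inequality, for which the
    exponent is 1/(p - 1). The maximum with 0 allows any sign of [K]. *)
Lemma powerRN_cvg0 (al K e : R) : 0 < al -> 0 < e ->
  exists2 T0 : R, 1 <= T0 & forall T, T0 <= T -> T `^ (- al) * K <= e.
Proof.
move=> al0 e0; pose b := Num.max 1 ((Num.max 0 K) / e).
have b1 : 1 <= b by rewrite le_max lexx.
exists (b `^ al^-1) => [|T bT].
  by rewrite -(powRr0 b) ler_powR// invr_ge0 ltW.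
have b0 : 0 < b by exact: lt_le_trans b1.
have T0 : 0 < T by apply: lt_le_trans bT; rewrite powR_gt0.
rewrite powRN ler_pdivrMl ?powR_gt0//.
have : b <= T `^ al.
  have -> : b = (b `^ al^-1) `^ al by rewrite -powRrM mulVf ?gt_eqF// powRr1// ltW.
  by apply: ge0_ler_powR; rewrite ?nnegrE ?powR_ge0 ?(ltW al0) ?(ltW T0).
have : Num.max 0 K <= b * e.
  by rewrite -ler_pdivrMr// le_max lexx orbT.
have : K <= Num.max 0 K by rewrite le_max lexx orbT.
by move=> h1 h2 h3; rewrite (le_trans h1)// (le_trans h2)// ler_pM2r.
Qed.

Lemma bounded_nondecreasing_eps (Y : R -> R) (K d : R) : 0 < d ->
  (forall A B, 1 <= A -> A <= B -> Y A <= Y B) -> (forall A, 1 <= A -> Y A <= K) ->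
  exists2 B, 1 <= B & forall A, B <= A -> Y A - Y B <= d.
Proof.
move=> d0 Ymon YK; pose E := [set Y A | A in [set A | 1 <= A]].
have supE : has_sup E.
  by split; [exists (Y 1), 1 => /=|exists K => _ [A /= A1 <-]; exact: YK].
have [_ [B /= B1 <-] HB] := sup_adherent d0 supE.
exists B => // A BA; have : Y A <= sup E.
  by apply: sup_upper_bound => //; exists A => //=; exact: le_trans BA.
by move: HB; rewrite -/E; lra.
Qed.

(** The choices are made in the order [d], [E], [B], [T]. Being bounded and nondecreasing, [Y]
    varies little after a suitable [B], even multiplied by the large [E]; [Z B] has no a priori
    bound, but it is fixed before [T] grows and is then killed by T^(-al). *)
Lemma bootstrap_eq0 (al C M0 K c0 : R) (X Y Z : R -> R) :
  0 < al -> 0 < c0 ->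
  (forall A B, 1 <= A -> A <= B -> Y A <= Y B) -> (forall A, 0 <= Y A) ->
  (forall T, 1 <= T -> X T <= K) ->
  (forall A, 1 <= A -> c0 * Y A <= X (2 * A)) ->
  (forall d, 0 < d -> exists2 E, 0 <= E & forall B T, 1 <= B -> B <= T ->
    X T <= d + E * (Y T - Y B) + T `^ (- al) * (C * (Z B + M0))) ->
  forall A, 1 <= A -> Y A = 0.
Proof.
move=> al0 c00 Ymon Y0 XK YX HX A A1; apply/eqP; rewrite eq_le Y0 andbT.
have YK B : 1 <= B -> Y B <= K / c0.
  move=> B1; rewrite ler_pdivlMr// mulrC (le_trans (YX _ B1))// XK//; lra.
suff : c0 * Y A <= 0 by rewrite pmulr_rle0.
apply/ler_addgt0Pr => e e0; rewrite add0r.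
have d0 : 0 < e / 3 by rewrite divr_gt0.
have [E E0 HE] := HX _ d0.
(* [E] may be 0, and the variation of [Y] is to be at most e/3 divided by this number. *)
have E1 : 0 < E + 1 by rewrite ltr_wpDl.
have [B B1 HB] := bounded_nondecreasing_eps (divr_gt0 d0 E1) Ymon YK.
have [T0 T01 HT] := powerRN_cvg0 (C * (Z B + M0)) al0 d0.
pose a := Num.max A (Num.max B T0).
have Aa : A <= a by rewrite le_max lexx.
have Ba : B <= 2 * a.
  by have : B <= a; [rewrite !le_max lexx !orbT|lra].
have Ta : T0 <= 2 * a.
  by have : T0 <= a; [rewrite !le_max lexx !orbT|lra].
have a1 : 1 <= a by exact: le_trans Aa.
have h1 : c0 * Y A <= c0 * Y a by rewrite ler_pM2l// Ymon.
have h2 := YX _ a1; have h3 := HE _ _ B1 Ba; have h4 := HT _ Ta.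
have h5 : E * (Y (2 * a) - Y B) <= e / 3.
  apply: le_trans (_ : (E + 1) * (e / 3 / (E + 1)) <= _); last first.
    by rewrite mulrC divfK ?gt_eqF.
  have := HB _ Ba; have : 0 <= Y (2 * a) - Y B by rewrite subr_ge0 Ymon.
  by have := ltW E1; nra.
lra.
Qed.

(* Young with exponents [p] and [p / (p - 1)]: the hypothesis on [al] makes
   [T `^ (- al)] to the conjugate exponent at most [1 / T]. *)
Lemma young_profile (p al a r T e : R) n : 1 < p -> 1 - p^-1 <= al -> 0 < e ->
  al + n.+2%:R <= n%:R * p -> 1 <= T -> 0 <= a -> 0 <= r <= 1 ->
  T `^ (- al) * (a * r ^+ n) <=
    e * (a `^ p * (r `^ al * r ^+ n.+2)) + e `^ (- (p - 1)^-1) / T.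
Proof.
move=> p1 alp e0 hn T1 a0 /andP[r0 r1].
have p0 : 0 < p by lra.
have T0 : 0 < T by lra.
have ip : p^-1 < 1 by rewrite invf_lt1.
have ip0 : 0 < p^-1 by rewrite invr_gt0.
have q0 : 0 < (1 - p^-1)^-1 by rewrite invr_gt0 subr_gt0.
have eq1 : p^-1 + (1 - p^-1)^-1^-1 = 1 by rewrite invrK addrC subrK.
(* The powers of [e] cancel in the product [x * y]; after Young they leave [e] in front of the
   energy and e^(-1/(p - 1)) in the remainder. *)
pose x := e `^ p^-1 * (a * r ^+ n); pose y := e `^ (- p^-1) * T `^ (- al).
have x0 : 0 <= x by rewrite !mulr_ge0 ?powR_ge0 ?exprn_ge0.
have y0 : 0 <= y by rewrite mulr_ge0 ?powR_ge0.
have := conjugate_powR x0 y0 p0 q0 eq1.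
have -> : x * y = T `^ (- al) * (a * r ^+ n).
  rewrite /x /y [LHS](_ : _ = e `^ p^-1 * e `^ (- p^-1) * (T `^ (- al) * (a * r ^+ n))); last by ring.
  by rewrite (powRN e) mulfV ?mul1r// gt_eqF// powR_gt0.
move=> /le_trans; apply; apply: lerD.
  rewrite ler_pdivrMr// powRM ?powR_ge0 ?mulr_ge0 ?exprn_ge0// -powRrM mulVf ?gt_eqF// powRr1 ?(ltW e0)//.
  apply: le_trans (_ : e * (a `^ p * (r `^ al * r ^+ n.+2)) <= _); last first.
    rewrite ler_peMr ?(ltW p1)//; apply: mulr_ge0; first exact: ltW.
    by do 2 (apply: mulr_ge0; first exact: powR_ge0); exact: exprn_ge0.
  rewrite ler_pM2l// powRM ?exprn_ge0// ler_wpM2l ?powR_ge0//.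
  (* At [r = 0] the left side vanishes only if [n] is nonzero; [n = 0] would turn the hypothesis on
     [n] into [al + 2 <= 0], whereas [al] is nonnegative. *)
  move: r0; rewrite le_eqVlt => /predU1P[r0|r0].
    rewrite -r0; have -> : 0 ^+ n = 0 :> R.
      rewrite expr0n; case: n hn {x x0 y y0} => [|//] /=; rewrite mul0r => ?.
      have : 0 <= al by lra.
      by have : 0 < 2 :> R by []; lra.
    by rewrite powR0 ?gt_eqF// mulr_ge0 ?powR_ge0 ?exprn_ge0.
  rewrite -!powR_mulrn ?(ltW r0)// -powRD; last by rewrite (gt_eqF r0) implybT.
  by rewrite -powRrM; apply: ger_powR => //; rewrite r0.
rewrite ler_pdivrMr// powRM ?powR_ge0// -!powRrM.
apply: le_trans (_ : e `^ (- (p - 1)^-1) / T <= _); last first.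
  rewrite ler_peMr ?divr_ge0 ?powR_ge0 ?ltW// ?ltW//.
  by rewrite invf_gt1 ?subr_gt0// gtrBl.
have -> : - p^-1 * (1 - p^-1)^-1 = - (p - 1)^-1.
  by field; rewrite subr_eq0 !gt_eqF.
rewrite ler_wpM2l ?powR_ge0// -(powR_inv1 (ltW T0)) ler_powR//.
rewrite mulNr lerN2 ler_pdivlMr ?mul1r//.
by rewrite subr_gt0.
Qed.

End real_bootstrap.

Lemma Rintegral_split d (T : measurableType d) (R : realType) (m : {measure set T -> \bar R})
    (A B : set T) (f : T -> R) : measurable A -> measurable B -> A `<=` B ->
  m.-integrable B (EFin \o f) ->
  \int[m]_(x in B) f x = \int[m]_(x in A) f x + \int[m]_(x in B `\` A) f x.
Proof.
move=> mA mB AB fi; rewrite -[X in Rintegral _ X _](setDUK AB).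
rewrite Rintegral_setU//; first exact: measurableD.
- by rewrite setDUK.
- by rewrite disj_set2E setDIK.
Qed.

Section vanishing.
Context {R : realType} {N : nat}.
Local Notation Rn := 'rV[R]_N.
Local Notation mu := (@lebesgue_measure R).
Local Notation mR := (measurableTypeR R).
Local Notation P := (mu \x lebesgue_Rn N)%E.
Local Notation Slab T := (@slab _ Rn R T).
Variables (p gamma sigma eta m q : R).
Hypothesis p1 : 1 < p.
Hypothesis al0 : 0 < 1 - gamma.
Hypothesis Nq : N%:R < q.
Hypothesis s01 : 0 <= sigma <= 1.
Hypothesis e01 : 0 <= eta <= 1.
Hypothesis Hs : [\/ sigma = 0, sigma = 1 | q <= N%:R + 2 * sigma].
Hypothesis He : [\/ eta = 0, eta = 1 | q <= N%:R + 2 * eta].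
Hypothesis pg : p * gamma <= 1.
Variables (u0 u1 : Rn -> R) (u : R -> Rn -> R).
Hypothesis mu0 : measurable_fun setT u0.
Hypothesis mu1 : measurable_fun setT u1.
Hypothesis I0 : (\int[lebesgue_Rn N]_x ((`|u0 x| + `|u1 x|) * weight q x)%:E < +oo)%E.
Hypothesis mu_ : forall T, 0 < T -> measurable_fun (Slab T) (fun z => u z.1 z.2).
Hypothesis Iu : forall T, 0 < T ->
  (\int[P]_(y in Slab T) (`|u y.1 y.2| `^ p * weight q y.2)%:E < +oo)%E.
Hypothesis Hw : forall T z n, 1 <= T ->
  weak_identity p gamma sigma eta m u0 u1 T u (psi0 z) (profile T n) (profile' T n) (profile'' T n).

Let al := 1 - gamma.
Let w (y : mR * Rn) := weight q y.2.
Let a (y : mR * Rn) := `|u y.1 y.2|.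

Let w0 y : 0 <= w y. Proof. exact: weight_ge0. Qed.

Let mw T : measurable_fun (Slab T) w.
Proof. by apply: measurable_funTS; exact: (measurableT_comp (measurable_weight q) measurable_snd). Qed.

Let a0 y : 0 <= a y. Proof. exact: normr_ge0. Qed.

Let ap0 y : 0 <= a y `^ p. Proof. exact: powR_ge0. Qed.

Let ma T : 0 < T -> measurable_fun (Slab T) a.
Proof. by move=> T0; apply: measurableT_comp => //; exact: mu_. Qed.

Let map T : 0 < T -> measurable_fun (Slab T) (fun y => a y `^ p).
Proof. by move=> T0; apply: (measurableT_comp (measurable_powR p)); exact: ma. Qed.

Let mr T k : measurable_fun (Slab T) (fun y : mR * Rn => rho T y.1 ^+ k).
Proof.
apply: measurable_funTS; apply: measurable_funX.
exact: (measurableT_comp (measurable_rho T) measurable_fst).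
Qed.

Let mra T : measurable_fun (Slab T) (fun y : mR * Rn => rho T y.1 `^ al).
Proof.
apply: measurable_funTS; apply: (measurableT_comp (measurable_powR al)).
exact: (measurableT_comp (measurable_rho T) measurable_fst).
Qed.

Let mS T : measurable (Slab T). Proof. exact: measurable_slab. Qed.

Let W := fine (\int[lebesgue_Rn N]_x (weight q x)%:E)%E.

Let Wfin : (\int[lebesgue_Rn N]_x (weight q x)%:E < +oo)%E.
Proof.
have := @weight_integral_le R N q 0 Nq; under eq_integral do rewrite subr0.
by move=> /le_lt_trans; apply; rewrite ltry.
Qed.

Let iW T : 0 < T -> (\int[P]_(y in Slab T) (w y)%:E = (T * W)%:E)%E.
Proof.
move=> T0.
rewrite (@slab_integral_snd _ _ _ _ T (weight q) T0 (measurable_weight q) (weight_ge0 q)).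
rewrite EFinM fineK// ge0_fin_numE//.
by apply: integral_ge0 => x _; rewrite lee_fin weight_ge0.
Qed.

Let slab_pos T y : Slab T y -> 0 < T.
Proof. by move=> [/=]; rewrite in_itv/= => /andP[+ + _]; exact: lt_trans. Qed.

Let slab_rho T y : Slab T y -> 0 <= rho T y.1 <= 1.
Proof.
move=> yS; have T0 := slab_pos yS; apply: rho_bound => //.
by move: yS => [/=]; rewrite in_itv/= => /andP[? ?] _; rewrite !ltW.
Qed.

Let iw T : 0 < T -> P.-integrable (Slab T) (EFin \o w).
Proof.
move=> T0; apply/integrableP; split; first by apply/measurable_EFinP; exact: mw.
under eq_integral do rewrite gee0_abs ?lee_fin//.
by rewrite iW// ltry.
Qed.

Let iY T : 0 < T -> P.-integrable (Slab T) (EFin \o (fun y => a y `^ p * w y)).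
Proof.
move=> T0; apply/integrableP; split.
  by apply/measurable_EFinP; apply: measurable_funM; [exact: map|exact: mw].
under eq_integral do rewrite gee0_abs ?lee_fin ?mulr_ge0 ?powR_ge0//.
exact: Iu.
Qed.

Let iZ T : 0 < T -> P.-integrable (Slab T) (EFin \o (fun y => a y * w y)).
Proof.
move=> T0; apply: le_integrable (integrableD (mS T) (iw T0) (iY T0)) => //.
  by apply/measurable_EFinP; apply: measurable_funM; [exact: ma|exact: mw].
move=> y _; rewrite /= lee_fin ger0_norm ?mulr_ge0 ?a0//.
rewrite ger0_norm ?addr_ge0 ?mulr_ge0 ?powR_ge0 ?a0// -[X in X + _]mul1r -mulrDl.
by rewrite ler_wpM2r// le_1DpowR ?a0// ltW.
Qed.

Variable n : nat.
Hypothesis hn : al + n.+2%:R <= n%:R * p.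

Let g T (y : mR * Rn) := rho T y.1 `^ al * rho T y.1 ^+ n.+2.

Let g01 T y : Slab T y -> 0 <= g T y <= 1.
Proof.
move=> /slab_rho/andP[r0 r1]; rewrite mulr_ge0 ?powR_ge0 ?exprn_ge0//=.
apply: mulr_ile1; rewrite ?powR_ge0 ?exprn_ge0 ?exprn_ile1//.
by rewrite -[leRHS](one_powR al); apply: ge0_ler_powR; rewrite ?nnegrE ?(ltW al0).
Qed.

Let iX T : 0 < T -> P.-integrable (Slab T) (EFin \o (fun y => a y `^ p * g T y * w y)).
Proof.
move=> T0; apply: le_integrable (iY T0) => //.
  apply/measurable_EFinP; apply: measurable_funM; last exact: mw.
  by apply: measurable_funM; [exact: map|apply: measurable_funM; [exact: mra|exact: mr]].
move=> y /g01/andP[? ?]; rewrite /= lee_fin !ger0_norm; [|exact: mulr_ge0|].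
  by rewrite ler_wpM2r// ler_piMr ?powR_ge0.
by apply: mulr_ge0 => //; exact: mulr_ge0.
Qed.

Let iI T : 0 < T -> P.-integrable (Slab T) (EFin \o (fun y => a y * rho T y.1 ^+ n * w y)).
Proof.
move=> T0; apply: le_integrable (iZ T0) => //.
  apply/measurable_EFinP; apply: measurable_funM; last exact: mw.
  by apply: measurable_funM; [exact: ma|exact: mr].
move=> y /slab_rho/andP[r0 r1].
have rn0 : 0 <= rho T y.1 ^+ n by exact: exprn_ge0.
rewrite /= lee_fin !ger0_norm; [|exact: mulr_ge0|].
  by rewrite ler_wpM2r// ler_piMr ?exprn_ile1 ?a0.
by apply: mulr_ge0 => //; exact: mulr_ge0.
Qed.

Let X T := \int[P]_(y in Slab T) (a y `^ p * g T y * w y).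
Let Y T := \int[P]_(y in Slab T) (a y `^ p * w y).
Let Z T := \int[P]_(y in Slab T) (a y * w y).
Let I T := \int[P]_(y in Slab T) (a y * rho T y.1 ^+ n * w y).
Let M0 := fine (\int[lebesgue_Rn N]_x ((`|u0 x| + `|u1 x|) * weight q x)%:E)%E.

Let W0 : 0 <= W.
Proof. by apply: fine_ge0; apply: integral_ge0 => x _; rewrite lee_fin weight_ge0. Qed.

Let M00 : 0 <= M0.
Proof.
apply: fine_ge0; apply: integral_ge0 => x _.
by rewrite lee_fin mulr_ge0 ?addr_ge0 ?weight_ge0.
Qed.

(** Since T - t = T rho(t), the factor (T - t)^al splits into T^al, moved to the right-hand side,
    and rho(t)^al, which becomes part of [g]. *)
Let energy : exists2 C, 0 <= C & forall T, 1 <= T -> X T <= T `^ (- al) * (C * (I T + M0)).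
Proof.
have [C C0 HC] := @integrated_inequality R N p gamma sigma eta m q n p1 al0 Nq s01 e01 Hs He.
exists C => // T T1; have T0 : 0 < T by exact: lt_le_trans T1.
have := HC T u0 u1 u T1 (mu_ T0) (Iu T0) mu0 mu1 I0 (fun z => Hw z n T1).
have iXa : P.-integrable (Slab T) (EFin \o (fun y => T `^ al * (a y `^ p * g T y * w y))).
  exact: integrableZl (iX T0).
have E1 : (\int[P]_(y in Slab T) (`|u y.1 y.2| `^ p * ((T - y.1) `^ al * rho T y.1 ^+ n.+2) * weight q y.2)%:E
    = (T `^ al * X T)%:E)%E.
  rewrite -RintegralZl//; last exact: iX.
  rewrite fineK; last exact: (integrable_fin_num (mS T) iXa).
  apply: eq_integral => y; rewrite inE => /slab_rho/andP[r0 _]; congr EFin.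
  have -> : T - y.1 = T * rho T y.1 by rewrite /rho mulrBr mulr1 mulrC divfK// gt_eqF.
  by rewrite powRM ?(ltW T0)// /g /w /a -/al; ring.
have E2 : (\int[P]_(y in Slab T) (`|u y.1 y.2| * rho T y.1 ^+ n * weight q y.2)%:E = (I T)%:E)%E.
  by rewrite fineK//; exact: (integrable_fin_num (mS T) (iI T0)).
have E3 : (\int[lebesgue_Rn N]_x ((`|u0 x| + `|u1 x|) * weight q x)%:E = M0%:E)%E.
  rewrite fineK// ge0_fin_numE//; apply: integral_ge0 => x _.
  by rewrite lee_fin mulr_ge0 ?addr_ge0 ?weight_ge0.
rewrite E1 E2 E3 -EFinD -EFinM lee_fin powRN => H.
by rewrite ler_pdivlMl ?powR_gt0.
Qed.

Let le_W T D : 0 < T -> measurable D -> D `<=` Slab T -> \int[P]_(y in D) w y <= T * W.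
Proof.
move=> T0 mD DS; have -> : T * W = \int[P]_(y in Slab T) w y by rewrite /Rintegral iW.
rewrite (Rintegral_split mD (mS T) DS (iw T0)) lerDl.
by apply: Rintegral_ge0.
Qed.

(** The 1/T of [young_profile] cancels the length of the slab, so the remainder is free of [T]. The
    set [D] is the whole slab in the first pass and the times from [B] on in the second. *)
Let young T e D : 1 <= T -> 0 < e -> measurable D -> D `<=` Slab T ->
  T `^ (- al) * \int[P]_(y in D) (a y * rho T y.1 ^+ n * w y) <=
  e * \int[P]_(y in D) (a y `^ p * g T y * w y) + e `^ (- (p - 1)^-1) * W.
Proof.
move=> T1 e0 mD DS; have T0 : 0 < T by exact: lt_le_trans T1.
have sub f : P.-integrable (Slab T) f -> P.-integrable D f.
  by move=> fi; apply: (integrableS (mS T)).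
have alp : 1 - p^-1 <= al.
  have p0 : 0 < p by exact: lt_trans p1.
  by rewrite /al lerD2l lerN2 -[p^-1]mul1r ler_pdivlMr// mulrC.
apply: (@le_trans _ _ (e * \int[P]_(y in D) (a y `^ p * g T y * w y) +
    (e `^ (- (p - 1)^-1) / T) * \int[P]_(y in D) w y)).
  rewrite -(RintegralZl _ mD (sub _ (iI T0))) -(RintegralZl _ mD (sub _ (iX T0))).
  rewrite -(RintegralZl _ mD (sub _ (iw T0))).
  rewrite -RintegralD//; last 2 first.
  - exact: sub (integrableZl (mS T) e (iX T0)).
  - exact: sub (integrableZl (mS T) _ (iw T0)).
  apply: le_Rintegral => //.
  - exact: sub (integrableZl (mS T) _ (iI T0)).
  - exact: sub (integrableD (mS T) (integrableZl (mS T) e (iX T0)) (integrableZl (mS T) _ (iw T0))).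
  move=> y /DS/slab_rho r01; have := ler_wpM2r (w0 y) (young_profile p1 alp e0 hn T1 (a0 y) r01).
  by rewrite mulrDl -!mulrA.
rewrite lerD2l -mulrA ler_wpM2l ?powR_ge0// ler_pdivrMl//.
exact: le_W.
Qed.

Let Slab_le A B : A <= B -> Slab A `<=` Slab B.
Proof.
move=> AB y [/=]; rewrite in_itv/= => /andP[y0 yA] _; split => //=.
by rewrite in_itv/= y0 (lt_le_trans yA).
Qed.

Let Y0 A : 0 <= Y A.
Proof. by apply: Rintegral_ge0 => y _; rewrite mulr_ge0 ?powR_ge0. Qed.

Let Ymon A B : 1 <= A -> A <= B -> Y A <= Y B.
Proof.
move=> A1 AB; have B0 : 0 < B by lra.
rewrite /Y (Rintegral_split (mS A) (mS B) (Slab_le AB) (iY B0)) lerDl.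
by apply: Rintegral_ge0 => y _; rewrite mulr_ge0 ?powR_ge0.
Qed.

(** Before time [A] the profile with horizon [2 * A] is at least 1/2, so the energy with time weight
    controls the one without. *)
Let YX A : 1 <= A -> 2^-1 `^ al * 2^-1 ^+ n.+2 * Y A <= X (2 * A).
Proof.
move=> A1; have A0 : 0 < A by lra.
have A20 : 0 < 2 * A by lra.
have AB : A <= 2 * A by lra.
have iXA : P.-integrable (Slab A) (EFin \o (fun y => a y `^ p * g (2 * A) y * w y)).
  by apply: (integrableS (mS (2 * A)) _ (Slab_le AB) (iX A20)); exact: mS.
rewrite /X (Rintegral_split (mS A) (mS (2 * A)) (Slab_le AB) (iX A20)).
rewrite -[leLHS]addr0; apply: lerD; last first.
  apply: Rintegral_ge0 => y [/g01/andP[? _] _].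
  by apply: mulr_ge0 => //; apply: mulr_ge0 => //; exact: powR_ge0.
rewrite /Y -RintegralZl//; last exact: iY.
apply: le_Rintegral => //; first exact: (integrableZl (mS A) _ (iY A0)).
move=> y yA; rewrite mulrA ler_wpM2r// mulrC ler_wpM2l ?powR_ge0//.
have hr : 2^-1 <= rho (2 * A) y.1.
  move: yA => [/=]; rewrite in_itv/= => /andP[_ yA] _.
  rewrite /rho lerBrDl -lerBrDr ler_pdivrMr//; move: (y.1 : R) yA => t; lra.
have h2 : (0 : R) <= 2^-1 by rewrite invr_ge0.
apply: ler_pM; rewrite ?powR_ge0 ?exprn_ge0//.
  by apply: ge0_ler_powR; rewrite ?nnegrE ?(ltW al0)// (le_trans h2 hr).
by rewrite lerXn2r ?nnegrE// (le_trans h2 hr).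
Qed.

Let powN_le1 T : 1 <= T -> T `^ (- al) <= 1.
Proof. by move=> T1; rewrite -(powRr0 T) ler_powR// oppr_le0 ltW. Qed.

Lemma energy_vanishes A : 1 <= A ->
  \int[P]_(y in Slab A) (`|u y.1 y.2| `^ p * weight q y.2) = 0.
Proof.
have [C C0 HC] := energy.
have C1 : 0 < C + 1 by rewrite ltr_wpDl.
(* Makes [C * e1] at most 1/2, so half of [X T] is absorbed on the left; [K] is twice what remains.
   Adding 1 covers [C = 0]. *)
pose e1 : R := (2 * (C + 1))^-1.
have e10 : 0 < e1 by rewrite invr_gt0 mulr_gt0.
pose K := 2 * (C * (e1 `^ (- (p - 1)^-1) * W + M0)).
have c00 : 0 < 2^-1 `^ al * 2^-1 ^+ n.+2 :> R by rewrite mulr_gt0 ?powR_gt0 ?exprn_gt0 ?invr_gt0.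
apply: (@bootstrap_eq0 R al C M0 K _ X Y Z al0 c00 Ymon Y0 _ YX).
  move=> T T1; have := HC T T1; have := young T1 e10 (mS T) (@subset_refl _ _).
  rewrite -/(I T) -/(X T).
  have X0 : 0 <= X T.
    apply: Rintegral_ge0 => y /g01/andP[? _].
    by apply: mulr_ge0 => //; apply: mulr_ge0 => //; exact: powR_ge0.
  rewrite [_ * (C * _)](_ : _ = C * (T `^ (- al) * I T) + C * (T `^ (- al) * M0)); last by ring.
  move=> h1 h2.
  have h3 : C * (T `^ (- al) * M0) <= C * M0 by rewrite ler_wpM2l// ler_piMl// powN_le1.
  have h4 := ler_wpM2l C0 h1.
  have h5 : C * (e1 * X T) <= 2^-1 * X T.
    by rewrite mulrA ler_wpM2r// /e1 ler_pdivrMr ?mulr_gt0//; lra.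
  rewrite /K; lra.
move=> d d0.
have q0 : 0 < (p - 1)^-1 by rewrite invr_gt0 subr_gt0.
(* a large [e] makes the constant term of Young's inequality small *)
have [e e_1 He'] := powerRN_cvg0 (C * W) q0 d0.
have e0 : 0 < e by exact: lt_le_trans e_1.
have {}He' := He' e (lexx e).
exists (C * e); first by rewrite mulr_ge0// ltW.
move=> B T B1 BT; have T1 : 1 <= T by exact: le_trans BT.
have B0 : 0 < B by exact: lt_le_trans B1.
have T0 : 0 < T by exact: lt_le_trans T1.
have mD : measurable (Slab T `\` Slab B) by exact: measurableD.
have DS : Slab T `\` Slab B `<=` Slab T by exact: subDsetl.
have h1 := young T1 e0 mD DS.
have h2 : \int[P]_(y in Slab T `\` Slab B) (a y `^ p * g T y * w y) <= Y T - Y B.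
  rewrite /Y (Rintegral_split (mS B) (mS T) (Slab_le BT) (iY T0)) addrAC subrr add0r.
  apply: le_Rintegral => //.
  - exact: (integrableS (mS T) mD DS (iX T0)).
  - exact: (integrableS (mS T) mD DS (iY T0)).
  - by move=> y [/g01/andP[? ?] _]; rewrite ler_wpM2r// ler_piMr ?powR_ge0.
have h3 : \int[P]_(y in Slab B) (a y * rho T y.1 ^+ n * w y) <= Z B.
  apply: le_Rintegral => //.
  - exact: (integrableS (mS T) (mS B) (Slab_le BT) (iI T0)).
  - exact: iZ.
  - by move=> y /(Slab_le BT)/slab_rho/andP[? ?]; rewrite ler_wpM2r// ler_piMr ?exprn_ile1 ?normr_ge0.
(* Young's inequality is applied only to the late part, where the energy is at most [Y T - Y B]; the
   early part is left as [Z B], still carrying the factor T^(-al). *)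
have h4 : I T = \int[P]_(y in Slab B) (a y * rho T y.1 ^+ n * w y) +
    \int[P]_(y in Slab T `\` Slab B) (a y * rho T y.1 ^+ n * w y).
  exact: (Rintegral_split (mS B) (mS T) (Slab_le BT) (iI T0)).
have h5 := HC T T1; rewrite h4 in h5.
have t0 : 0 <= T `^ (- al) by exact: powR_ge0.
have h6 := ler_wpM2l (mulr_ge0 C0 t0) h3.
have h7 := ler_wpM2l C0 h1.
have h8 := ler_wpM2l (mulr_ge0 C0 (ltW e0)) h2.
move: h5 h6 h7 h8 He'.
move: (Rintegral _ (Slab B) _) (Rintegral _ (_ `\` _) (fun y => _ * _ ^+ _ * _)).
move: (Rintegral _ (_ `\` _) _) => x1 x2 x3; nra.
Qed.

End vanishing.

(** * The normalising constant of [chi] and the proof of the theorem *)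

Lemma Rintegral_weight_gt0 (R : realType) (N : nat) (q : R) : N%:R < q ->
  0 < \int[lebesgue_Rn N]_x weight q x.
Proof.
move=> Nq; have w0 (x : 'rV[R]_N) : 0 <= weight q x by exact: weight_ge0.
rewrite lt0r; apply/andP; split; last exact: Rintegral_ge0.
apply/negP => /eqP I0.
have mw := @measurable_weight R N q.
have fin : (\int[lebesgue_Rn N]_x (weight q x)%:E)%E \is a fin_num.
  rewrite ge0_fin_numE; last by apply: integral_ge0 => x _; rewrite lee_fin.
  have := @weight_integral_le R N q 0 Nq; under eq_integral do rewrite subr0.
  by move=> /le_lt_trans; apply; rewrite ltry.
have : (\int[lebesgue_Rn N]_x `|(weight q x)%:E| = 0)%E.
  under eq_integral do rewrite gee0_abs ?lee_fin//.
  by rewrite -(fineK fin); congr (_%:E).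
move=> /(ae_eq_integral_abs _ measurableT (proj2 (measurable_EFinP _ _) mw)).
move=> [A [mA A0 subA]].
(* The weight vanishes nowhere, so a null set off which it vanishes would have to contain the unit
   cube, whose volume is 2^N. *)
have : (lebesgue_Rn N (cube (0 : 'rV[R]_N) 1) <= lebesgue_Rn N A)%E.
  apply: le_measure; rewrite ?inE//; first exact: measurable_cube.
  move=> x _; apply: subA => /= H; have := H Logic.I => -[wx].
  by have := weight_gt0 q x; rewrite wx ltxx.
by rewrite A0 lebesgue_Rn_cube// leNgt lte_fin exprn_gt0// mulr1.
Qed.

(** The decay estimate treats each operator by itself: either it is local, or [q] stays below its
    own threshold. The three regimes of the definition are recast in that form. *)
Lemma admissible_exponentP (R : realType) (N : nat) (sigma eta q : R) :
  @admissible_exponent R N sigma eta q ->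
  [/\ N%:R < q, [\/ sigma = 0, sigma = 1 | q <= N%:R + 2 * sigma] &
    [\/ eta = 0, eta = 1 | q <= N%:R + 2 * eta]].
Proof.
case=> [[-> h Nq]|[_ h /andP[Nq qs]]|[_ _ /andP[Nq]]].
- by split => //; [exact: Or32|case: h => ->; [exact: Or31|exact: Or32]].
- by split => //; [exact: Or33|case: h => ->; [exact: Or31|exact: Or32]].
- have [se qs|es qe] := leP sigma eta; split=> //; apply: Or33 => //; lra.
Qed.

Theorem theorem1p1 (R : realType) (N : nat) (p gamma sigma eta mu q : R)
    (u0 u1 : 'rV[R]_N -> R) (T : \bar R) (u : R -> 'rV[R]_N -> R) :
  (1 <= N)%N ->
  1 < p -> gamma < 1 -> 0 < sigma <= 1 -> 0 <= eta <= 1 ->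
  @admissible_exponent R N sigma eta q ->
  (lebesgue_Rn N).-integrable setT (fun x => (u0 x * chi q x)%:E) ->
  (lebesgue_Rn N).-integrable setT (fun x => (u1 x * chi q x)%:E) ->
  (0 < T)%E ->
  weak_solution_upto p gamma sigma eta mu u0 u1 T u ->
  nontrivial T u ->
  L1loc_in_time T (fun t x => `|u t x| `^ p * chi q x) ->
  p * gamma <= 1 ->
  (T < +oo)%E.
Proof.
move=> _ p1 g1 /andP[s0 s1] e01 adm i0 i1 _ sol nt L1 pg.
case: T sol nt L1 => [r _ _ _|sol nt L1|//]; first exact: ltry.
exfalso; apply: nt.
have [Nq Hs He] := admissible_exponentP adm.
have s01 : 0 <= sigma <= 1 by rewrite s1 ltW.
have al0 : 0 < 1 - gamma by rewrite subr_gt0.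
pose c := \int[lebesgue_Rn N]_x weight q x.
have c0 : 0 < c := Rintegral_weight_gt0 Nq.
have mwt := @measurable_weight R N q.
have wE (x : 'rV[R]_N) : weight q x = c * chi q x.
  by rewrite /chi mulrA mulfV ?mul1r// gt_eqF.
have cx0 (x : 'rV[R]_N) : 0 < chi q x.
  by have := weight_gt0 q x; rewrite wE pmulr_rgt0.
(* Measurability of the datum itself is recovered from that of its product with [chi], which is
   positive everywhere. *)
have datum v : (lebesgue_Rn N).-integrable setT (fun x => (v x * chi q x)%:E) ->
    measurable_fun setT v /\
    (lebesgue_Rn N).-integrable setT (fun x => (`|v x| * weight q x)%:E).
  move=> iv; split.
    apply: (eq_measurable_fun (fun x => v x * chi q x * (chi q x)^-1)).
      by move=> x _; rewrite mulfK// gt_eqF.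
    apply: measurable_funM; first by apply/measurable_EFinP; exact: (measurable_int _ iv).
    apply: (eq_measurable_fun (fun x => chi q x `^ (-1))).
      by move=> x _; rewrite powR_inv1// ltW.
    apply: (measurableT_comp (measurable_powR (-1))).
    apply: (eq_measurable_fun (fun x => c^-1 * weight q x)).
      by move=> x _; rewrite wE mulrA mulVf ?mul1r// gt_eqF.
    by apply: measurable_funM; [exact: measurable_cst|exact: mwt].
  have := integrableZl measurableT c (integrable_abse iv).
  apply: eq_integrable => // x _.
  by rewrite /= -EFinM normrM wE (ger0_norm (ltW (cx0 x))); congr EFin; ring.
have [mu0 iu0] := datum _ i0; have [mu1 iu1] := datum _ i1.
have I0 : (\int[lebesgue_Rn N]_x ((`|u0 x| + `|u1 x|) * weight q x)%:E < +oo)%E.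
  have := integrable_lty measurableT (integrableD measurableT iu0 iu1).
  by under eq_integral do rewrite -EFinD -mulrDl.
have mu_ T : 0 < T -> measurable_fun (@slab _ 'rV[R]_N R T) (fun z => u z.1 z.2).
  by move=> /sol[_ [+ _] _ _].
have Iu T : 0 < T ->
    (\int[@lebesgue_measure R \x lebesgue_Rn N]_(y in @slab _ 'rV[R]_N R T)
      (`|u y.1 y.2| `^ p * weight q y.2)%:E < +oo)%E.
  move=> T0; have mS := @measurable_slab _ 'rV[R]_N R T.
  have := integrable_lty mS (integrableZl mS c (L1 T T0 (ltry _))).
  apply: le_lt_trans; rewrite le_eqVlt; apply/orP; left; apply/eqP.
  by apply: eq_integral => y _; rewrite -EFinM wE; congr EFin; ring.
have Hw T z n : 1 <= T ->
    weak_identity p gamma sigma eta mu u0 u1 T u (psi0 z) (profile T n) (profile' T n) (profile'' T n).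
  move=> T1; have T0 : 0 < T by exact: lt_le_trans T1.
  have [_ _ _ H] := sol T T0; apply: H.
  - exact: test_function_tbump.
  - exact: C2_profile.
  - exact: profile_end.
  - exact: profile'_end.
(* The requirement al + n + 2 <= n p amounts to n (p - 1) >= al + 2. *)
pose n := Num.bound ((1 - gamma + 2) / (p - 1)).
have hn : 1 - gamma + n.+2%:R <= n%:R * p.
  have : (1 - gamma + 2) / (p - 1) < n%:R.
    by apply: archi_boundP; rewrite divr_ge0//; lra.
  rewrite ltr_pdivrMr ?subr_gt0// -(addn2 n) natrD; lra.
have van k : {ae (@lebesgue_measure R \x lebesgue_Rn N)%E, forall z,
    @slab _ 'rV[R]_N R k.+1%:R z -> u z.1 z.2 = 0}.
  have k0 : 0 < k.+1%:R :> R by [].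
  have k1 : 1 <= k.+1%:R :> R by rewrite ler1n.
  have mS := @measurable_slab _ 'rV[R]_N R k.+1%:R.
  have V := @energy_vanishes R N p gamma sigma eta mu q p1 al0 Nq s01 e01 Hs He pg
    u0 u1 u mu0 mu1 I0 mu_ Iu Hw n hn _ k1.
  have f0 (y : measurableTypeR R * 'rV[R]_N) : 0 <= `|u y.1 y.2| `^ p * weight q y.2.
    by apply: mulr_ge0; [exact: powR_ge0|exact: weight_ge0].
  have mf : measurable_fun (@slab _ 'rV[R]_N R k.+1%:R)
      (fun y => (`|u y.1 y.2| `^ p * weight q y.2)%:E).
    apply/measurable_EFinP; apply: measurable_funM.
      apply: (measurableT_comp (measurable_powR p)).
      by apply: measurableT_comp => //; exact: mu_.
    by apply: measurable_funTS; exact: (measurableT_comp mwt measurable_snd).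
  have fin : (\int[@lebesgue_measure R \x lebesgue_Rn N]_(y in @slab _ 'rV[R]_N R k.+1%:R)
      (`|u y.1 y.2| `^ p * weight q y.2)%:E)%E \is a fin_num.
    rewrite ge0_fin_numE; first exact: Iu.
    by apply: integral_ge0 => y _; rewrite lee_fin.
  have E0 : (\int[@lebesgue_measure R \x lebesgue_Rn N]_(y in @slab _ 'rV[R]_N R k.+1%:R)
      `|(`|u y.1 y.2| `^ p * weight q y.2)%:E| = 0)%E.
    under eq_integral do rewrite gee0_abs ?lee_fin//.
    by rewrite -(fineK fin); congr (_%:E).
  move: E0 => /(ae_eq_integral_abs _ mS mf); apply: filterS => y /= H yS.
  have [/eqP] := H yS; rewrite mulf_eq0 [_ == 0 in X in _ || X]gt_eqF ?weight_gt0// orbF.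
  by rewrite powR_eq0 normr_eq0 => /andP[/eqP].
(* The half-space of positive times is a countable union of slabs of integer length, so the
   exceptional null sets can be joined; [Num.bound] picks a slab containing the point. *)
move: van => /ae_foralln; apply: filterS => y H y0 _.
apply: (H (Num.bound y.1)); split => //=.
rewrite in_itv/= y0/=; apply: (lt_le_trans (archi_boundP (ltW y0))).
by rewrite ler_nat.
Qed.
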